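(* Let $n\ge3$. The $n$ Schubert varieties $\mathcal S_{12},\mathcal S_{23},\dots,\mathcal S_{n-1,n},\mathcal S_{1n}$ in $\mathrm{Gr}(2,n)$ have GD degree $1$. Moreover, for each of these varieties $\mathcal S_{ij}$ and generic real data $Y=[y_{rs}]\in\mathrm{Gr}(2,n)$, the minimizer of $$\|\tilde P-\tilde Q\|^2\quad\text{subject to}\quad X\in\mathcal S_{ij}\text{ real},\qquad \tilde P=\tfrac{2}{\mathrm{trace}(X^2)}X^2,\quad \tilde Q=\tfrac{2}{\mathrm{trace}(Y^2)}Y^2,$$ is obtained from the data point $Y$ by zeroing out the appropriate Pl\''ucker coordinates, namely by setting $y_{rs}$ (with $r<s$) to zero whenever $r<i$ or $s<j$.
   Context: $\mathrm{Gr}(2,n)\subset\mathbb P(\wedge^2\mathbb C^n)$ is the variety of complex skew-symmetric $n\times n$ matrices $X=[x_{rs}]$ of rank $2$ up to scaling; the entries $x_{rs}$, $r<s$, are the Pl\''ucker coordinates. For $1\le i<j\le n$, the Schubert variety is $\mathcal S_{ij}=\{X\in\mathrm{Gr}(2,n): x_{rs}=0\text{ for all } r<s\text{ with } r<i\text{ or }s<j\}$. $\|\cdot\|$ is the Frobenius norm. For an irreducible subvariety $\mathcal M\subseteq\mathrm{Gr}(2,n)$ with ideal $I_{\mathcal M}$, let $c=\mathrm{codim}(\mathcal M)$ in $\mathbb P(\wedge^2\mathbb C^n)$, let $\mathcal J_{\mathcal M}(X)$ be the Jacobian matrix of generators of $I_{\mathcal M}$, and $I_{\mathrm{Sing}(\mathcal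 M)}=I_{\mathcal M}+\langle c\times c\text{ minors of }\mathcal J_{\mathcal M}(X)\rangle$. For data $Y\in\mathrm{Gr}(2,n)$ and $\tilde Q=\frac{2}{\mathrm{trace}(Y^2)}Y^2$, let $\mathcal J^{\tilde Q}_{\mathcal M}(X)$ be $\mathcal J_{\mathcal M}(X)$ with two extra rows: the row with entries $(X\tilde Q+\tilde QX)_{rs}$, $r<s$, and the row with entries $x_{rs}$, $r<s$. The Lagrangian ideal is $I^{\tilde Q}_{\mathcal M}=\bigl(I_{\mathcal M}+\langle(c+2)\times(c+2)\text{ minors of }\mathcal J^{\tilde Q}_{\mathcal M}(X)\rangle\bigr):I_{\mathrm{Sing}(\mathcal M)}^\infty$. The GD critical ideal is the saturation of $I^{\tilde Q}_{\mathcal M}$ by $\langle\mathrm{trace}(XY)\rangle^\infty$, and also by $\langle\mathrm{trace}(X^2)\rangle^\infty$ when $\mathcal M$ does not intersect $\{\mathrm{trace}(X^2)=0\}$ transversely. The GD degree of $\mathcal M$ is the number of complex points in the variety of the GD critical ideal for generic $Y\in\mathrm{Gr}(2,n)$. *)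

(* Defs.v *)
From HB Require Import structures.
From mathcomp Require Import all_boot all_order all_algebra.
From mathcomp Require Import boolp classical_sets reals.
From mathcomp Require Import complex.
From mathcomp Require Import mpoly.

Set Implicit Arguments.
Unset Strict Implicit.
Unset Printing Implicit Defensive.

Import Order.TTheory GRing.Theory Num.Theory.
Local Open Scope ring_scope.
Local Open Scope classical_set_scope.

(* Points of a projective space are represented by nonzero vectors, and
   subvarieties by the set of all nonzero representatives of their points
   (so these sets are stable under multiplication by nonzero scalars).
   Row and column indices run over 'I_n, i.e. from 0 to n - 1. *)

Section PolynomialIdeals.
Variables (F : fieldType) (N : nat).
Implicit Types (A I J : set {mpoly F[N]}).

Definition ideal_gen A : set {mpoly F[N]} :=
  [set f | exists (k : nat) (a b : 'I_k -> {mpoly F[N]}),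
     (forall i, A (b i)) /\ f = \sum_(i < k) a i * b i].

Definition ideal_add I J : set {mpoly F[N]} := ideal_gen (I `|` J).

Definition ideal_pow J (k : nat) : set {mpoly F[N]} :=
  ideal_gen [set f | exists b : 'I_k -> {mpoly F[N]},
     (forall i, J (b i)) /\ f = \prod_(i < k) b i].

(* I : J^oo *)
Definition saturation I J : set {mpoly F[N]} :=
  [set f | exists k : nat, forall h, ideal_pow J k h -> I (f * h)].

Definition minors (k : nat) (rows : set 'rV[{mpoly F[N]}]_N) :
    set {mpoly F[N]} :=
  [set p | exists (A : 'M[{mpoly F[N]}]_(k, N)) (h : 'I_k -> 'I_N),
     (forall i, rows (row i A)) /\ p = \det (colsub h A)].

Definition gradient (f : {mpoly F[N]}) : 'rV[{mpoly F[N]}]_N :=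
  \row_k f^`M(k).

(* The rows of the Jacobian matrix of the family A.  Families of generators
   are arbitrary sets of polynomials, not necessarily finite. *)
Definition jacobian_rows A : set 'rV[{mpoly F[N]}]_N := gradient @` A.

Definition alg_indep_mod I (k : nat) (t : k.-tuple {mpoly F[N]}) : Prop :=
  forall p : {mpoly F[k]}, I (p \mPo t) -> p = 0.

(* For I the homogeneous ideal of an irreducible projective variety: its
   dimension is one less than the transcendence degree of its homogeneous
   coordinate ring. *)
Definition proj_dim I (d : nat) : Prop :=
  (exists t : d.+1.-tuple {mpoly F[N]}, alg_indep_mod I t) /\
  (forall t : d.+2.-tuple {mpoly F[N]}, ~ alg_indep_mod I t).

Definition proj_codim I (c : nat) : Prop :=
  exists2 d : nat, proj_dim I d & (c + d).+1 = N.

End PolynomialIdeals.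

Section Grassmannian.
Variables (F : fieldType) (n : nat).

Definition upper : {pred 'I_n * 'I_n} := fun p => (p.1 < p.2)%N.

Definition ncoord : nat := #|upper|.

Definition prow (k : 'I_ncoord) : 'I_n := (enum_val k).1.
Definition pcol (k : 'I_ncoord) : 'I_n := (enum_val k).2.

Definition plucker (X : 'M[F]_n) : 'I_ncoord -> F :=
  fun k => X (prow k) (pcol k).

Definition skew (X : 'M[F]_n) : Prop := X^T = - X.

Definition gr2 : set 'M[F]_n := [set X | skew X /\ \rank X = 2%N].

Definition schubert (i j : 'I_n) : set 'M[F]_n :=
  [set X | gr2 X /\ forall r s : 'I_n,
     (r < s)%N -> (r < i)%N || (s < j)%N -> X r s = 0].

Definition prop_to (X Y : 'M[F]_n) : Prop :=
  exists2 a : F, a != 0 & X = a *: Y.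

(* P holds on a nonempty principal Zariski open subset of Gr(2,n), hence on a
   dense one, Gr(2,n) being irreducible (for F infinite). *)
Definition generic_gr2 (P : 'M[F]_n -> Prop) : Prop :=
  exists (d : nat) (f : {mpoly F[ncoord]}),
    [/\ f \is d.-homog,
        exists2 Y, gr2 Y & f.@[plucker Y] != 0 &
        forall Y, gr2 Y -> f.@[plucker Y] != 0 -> P Y].

(* Only meaningful if \tr (X ^2) <> 0. *)
Definition proj_of (X : 'M[F]_n) : 'M[F]_n :=
  (2%:R / \tr (X *m X)) *: (X *m X).

(* Zero out the Plucker coordinates y_rs (r < s) with r < i or s < j, keeping
   the matrix skew-symmetric. *)
Definition zero_out (i j : 'I_n) (Y : 'M[F]_n) : 'M[F]_n :=
  \matrix_(r, s)
    if (minn r s < i)%N || (maxn r s < j)%N then 0 else Y r s.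

Local Notation poly := {mpoly F[ncoord]}.

Definition generic_skew : 'M[poly]_n :=
  \sum_(k < ncoord)
    'X_k *: (delta_mx (prow k) (pcol k) - delta_mx (pcol k) (prow k)).

Definition cst_mx (A : 'M[F]_n) : 'M[poly]_n := map_mx (@mpolyC ncoord F) A.

Definition upper_row (A : 'M[poly]_n) : 'rV[poly]_ncoord :=
  \row_k A (prow k) (pcol k).

Definition trXY (Y : 'M[F]_n) : poly := \tr (generic_skew *m cst_mx Y).
Definition trX2 : poly := \tr (generic_skew *m generic_skew).

Definition vanishing_ideal (M : set 'M[F]_n) : set poly :=
  [set f | forall X, M X -> f.@[plucker X] = 0].

Definition zero_locus (I : set poly) : set 'M[F]_n :=
  [set X | [/\ skew X, X != 0 & forall f, I f -> f.@[plucker X] = 0]].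

Definition n_points (V : set 'M[F]_n) (d : nat) : Prop :=
  exists t : 'I_d -> 'M[F]_n,
    [/\ forall a, V (t a),
        forall a b, prop_to (t a) (t b) -> a = b &
        forall X, V X -> exists a, prop_to X (t a)].

Section GDDegree.
(* M : irreducible subvariety of Gr(2,n); G : generators of its ideal;
   c : its codimension. *)
Variables (M : set 'M[F]_n) (G : set poly) (c : nat).

Definition sing_ideal : set poly :=
  ideal_add (vanishing_ideal M) (ideal_gen (minors c (jacobian_rows G))).

Definition lagrange_rows (Q : 'M[F]_n) : set 'rV[poly]_ncoord :=
  jacobian_rows G `|`
  [set upper_row (generic_skew *m cst_mx Q + cst_mx Q *m generic_skew);
       upper_row generic_skew].

Definition lagrangian_ideal (Q : 'M[F]_n) : set poly :=
  saturation
    (ideal_add (vanishing_ideal M) (ideal_gen (minors c.+2 (lagrange_rows Q))))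
    sing_ideal.

(* Zariski tangent space at X to the affine cone over the scheme cut out
   by A. *)
Definition tangent (A : set poly) (X : 'M[F]_n) : set 'rV[F]_ncoord :=
  [set v | forall f, A f -> \sum_k (f^`M(k)).@[plucker X] * v 0 k = 0].

(* The quadric trace(X^2) = 0 is smooth, so only M may be singular. *)
Definition transverse_to_quadric : Prop :=
  forall X, M X -> \tr (X *m X) = 0 ->
    ~ zero_locus sing_ideal X /\
    forall w : 'rV[F]_ncoord, exists u v,
      [/\ tangent (vanishing_ideal M) X u, tangent [set trX2] X v
        & w = u + v].

Definition GD_critical_ideal (Y : 'M[F]_n) : set poly :=
  let I := saturation (lagrangian_ideal (proj_of Y)) (ideal_gen [set trXY Y])
  in if `[< transverse_to_quadric >] then I
     else saturation I (ideal_gen [set trX2]).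

End GDDegree.

(* The ideals above do not depend on the choice of the generators G. *)
Definition GD_degree (M : set 'M[F]_n) (d : nat) : Prop :=
  exists2 c : nat, proj_codim (vanishing_ideal M) c &
    forall G : set poly, ideal_gen G = vanishing_ideal M ->
      generic_gr2 (fun Y => n_points (zero_locus (GD_critical_ideal M G c Y)) d).

End Grassmannian.

Definition frobenius (R : rcfType) (n : nat) (A : 'M[R]_n) : R :=
  Num.sqrt (\sum_i \sum_j A i j ^+ 2).

(* Main.v *)
From mathcomp Require Import all_boot all_order all_algebra.
From mathcomp Require Import boolp classical_sets reals.
From mathcomp Require Import complex.
From mathcomp Require Import perm mpoly.
From mathcomp Require Import ring zify.
Require Import Defs.

(** The matrix [X] of a plane [U] is [wedge u v] for a basis [u], [v] of [U], and
    [proj_of X] is the orthogonal projection to [U]. Indices start at 0. For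
    [j = i + 1] the Schubert variety is the Grassmannian of the coordinate
    subspace [e_i, ..., e_(n-1)] and [zero_out i j Y = S Y S] with [S] the
    projection to this subspace; for [(i, j) = (0, n - 1)] it is the projective
    space of the planes through [e_j], and [zero_out i j Y] is the plane spanned
    by [e_j] and [Y e_j].

    GD degree. The ideal of critical points is handled through explicit elements
    of it, without the Nullstellensatz. By [lagrangian_pairings] the Lagrangian
    ideal contains the 2 x 2 determinants of the pairings of the two extra rows
    [X Q + Q X] and [X] with any two vector fields tangent to the variety.

    If the variety is a projective space, constant fields are tangent, among them
    [Y' = zero_out i j Y], which is an eigenvector of [X |-> X Q + Q X]
    compressed to the tangent space. Pairing with [Y'] then yields [tr (X Y)]
    times the linear equations of the eigenspace of [Y'], and that eigenspace is
    a line ([linear_critical_equations], [block_linear_uniq],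
    [point_linear_uniq]).

    This covers all cases except the planes in a subspace of dimension at least
    four. There the fields [E X + X E^T] are used: the determinants say that
    [X^2] commutes with [S Q S], and after inverting [tr (X^2)] and [tr (X Y)]
    they force [X] to be a multiple of [Y'] ([critical_relation]). Inverting
    [tr (X^2)] is legitimate because such a subspace contains totally isotropic
    planes, where the variety fails to be transverse to the quadric
    [tr (X^2) = 0] ([not_transverse]).

    Conversely [Y'] is a zero of the critical ideal ([critical_zero]): it lies on
    the big cell [x_ij <> 0], which consists of smooth points, and there the
    tangent spaces are parametrized by the rows [i] and [j] of [X]. The same
    parametrization computes the codimension ([codim_schubertP]).

    Closest point. For real planes with projections [P] and [Q] the squared
    distance is [4 - 2 tr (P Q)], and [tr (P Q)] plus a squared norm does not
    depend on [P] in the variety; the norm vanishes exactly at [Y']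
    ([block_minimizes], [point_minimizes]). *)

Set Implicit Arguments.
Unset Strict Implicit.
Unset Printing Implicit Defensive.

Import Order.TTheory GRing.Theory Num.Theory.
Local Open Scope ring_scope.

(** * Multivariate polynomials and curves *)

Section PolynomialsAlongCurves.
Variables (F : comNzRingType) (N : nat).
Implicit Types (p q : {mpoly F[N]}) (c : 'I_N -> {poly F}).

Lemma mpoly_ring_ind (P : {mpoly F[N]} -> Prop) :
    (forall a, P a%:MP) -> (forall i, P 'X_i) ->
    (forall p q, P p -> P q -> P (p + q)) ->
    (forall p q, P p -> P q -> P (p * q)) ->
  forall p, P p.
Proof.
move=> PC PX PD PM; apply: mpolyind => [|a m p _ _ Pp].
  by rewrite -mpolyC0.
apply: (PD _ _ _ Pp); rewrite -mul_mpolyC; apply: (PM _ _ (PC a)).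
rewrite mpolyXE_id; apply: (big_ind P) => //; first by rewrite -mpolyC1.
move=> i _; elim: (m i) => [|k IHk]; first by rewrite expr0 -mpolyC1.
by rewrite exprS; apply: PM.
Qed.

Definition along c p : {poly F} := mmap (@polyC F) c p.

Lemma along_eval c p s : (along c p).[s] = p.@[fun k => (c k).[s]].
Proof.
rewrite /along; elim/mpoly_ring_ind: p => [a|i|p q IHp IHq|p q IHp IHq].
- by rewrite mmapC hornerC mevalC.
- by rewrite mmapX mmap1U mevalXU.
- by rewrite rmorphD hornerD mevalD IHp IHq.
- by rewrite rmorphM hornerM mevalM IHp IHq.
Qed.

Lemma along_deriv c p :
  (along c p)^`() = \sum_k along c p^`M(k) * (c k)^`().
Proof.
rewrite /along; elim/mpoly_ring_ind: p => [a|i|p q IHp IHq|p q IHp IHq].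
- by rewrite mmapC derivC big1 // => k _; rewrite mderivC rmorph0 mul0r.
- rewrite mmapX mmap1U (bigD1 i) //= big1 => [|k ki].
    have -> : 'X_i^`M(i) = 1 :> {mpoly F[N]}.
      rewrite mderivX mnm1E eqxx scale1r (_ : (_ - _)%MM = 0%MM) ?mpolyX0 //.
      by apply/mnmP => k; rewrite mnmBE subnn mnm0E.
    by rewrite rmorph1 mul1r addr0.
  by rewrite mderivX mnm1E eq_sym (negbTE ki) scale0r rmorph0 mul0r.
- rewrite rmorphD derivD IHp IHq -big_split; apply: eq_bigr => k _.
  by rewrite mderivD rmorphD mulrDl.
- rewrite rmorphM derivM IHp IHq mulr_suml mulr_sumr -big_split.
  apply: eq_bigr => k _; rewrite mderivM rmorphD !rmorphM /=.
  by ring.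
Qed.

End PolynomialsAlongCurves.

Section Vanishing.
Variable F : numFieldType.

Lemma poly_eq0_of_roots (p : {poly F}) : (forall s, p.[s] = 0) -> p = 0.
Proof.
move=> p0; apply: contraTeq isT => /max_poly_roots pP.
pose s := [seq k%:R : F | k <- iota 0 (size p)].
suff: (size s < size p)%N by rewrite size_map size_iota ltnn.
apply: pP; first by apply/allP => x _; apply/rootP.
by rewrite map_inj_uniq ?iota_uniq // => a b /eqP; rewrite eqr_nat => /eqP.
Qed.

(** In characteristic zero a polynomial is recovered from the values of its
    iterated partial derivatives at the origin, and all of them vanish when
    the polynomial function does. *)
Lemma mpoly_eq0_of_zeros N (p : {mpoly F[N]}) :
  (forall a, p.@[a] = 0) -> p = 0.
Proof.
move=> p0; apply/mpolyP => m; rewrite mcoeff0.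
move: {2}(mdeg m) (erefl (mdeg m)) => d; elim: d m p p0 => [|d IHd] m p p0.
  move/eqP; rewrite mdeg_eq0 => /eqP ->; rewrite -(p0 (fun=> 0)) mevalE.
  have [p00|p0n0] := boolP (0%MM \in msupp p).
    rewrite (bigD1_seq 0%MM) //= big1 ?mulr1 => [|i _]; last by rewrite mnmE.
    rewrite big1 ?addr0 // => m' m'0; apply/eqP; rewrite mulf_eq0; apply/orP.
    right; apply/eqP; have /existsP[i mi] : [exists i, m' i != 0%N].
      apply: contraR m'0; rewrite negb_exists => /forallP m'0.
      by apply/eqP/mnmP => i; rewrite mnmE; apply/eqP; rewrite -[_ == _]negbK.
    by rewrite (bigD1 i) //= expr0n (negbTE mi) mul0r.
  rewrite memN_msupp_eq0 // big_seq big1 // => m' m'p.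
  have /existsP[i mi] : [exists i, m' i != 0%N].
    apply: contraR p0n0; rewrite negb_exists => /forallP m'0.
    suff <- : m' = 0%MM by [].
    by apply/mnmP => i; rewrite mnmE; apply/eqP; rewrite -[_ == _]negbK.
  by rewrite (bigD1 i) //= expr0n (negbTE mi) mul0r mulr0.
move=> mS; have /existsP[i mi] : [exists i, m i != 0%N].
  apply: contra_eqT mS; rewrite negb_exists => /forallP m0.
  suff -> : m = 0%MM by rewrite mdeg0.
  by apply/mnmP => i; rewrite mnmE; apply/eqP; rewrite -[_ == _]negbK.
have mE : m = (m - U_(i) + U_(i))%MM.
  by rewrite submK //; apply/mnm_lepP => k; rewrite mnm1E; case: eqP => // <-; lia.
have := mcoeff_deriv i (m - U_(i))%MM p; rewrite -mE IHd.
- by move/esym/eqP; rewrite mulrn_eq0 /= => /eqP.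
- move=> a; pose c k := (a k)%:P + (k == i)%:R *: 'X : {poly F}.
  have ca k : (c k).[0] = a k by rewrite hornerD hornerC hornerZ hornerX mulr0 addr0.
  have := along_deriv c p.
  have -> : along c p = 0.
    by apply: poly_eq0_of_roots => s; rewrite along_eval.
  rewrite deriv0 => /(congr1 (fun q : {poly F} => q.[0])).
  rewrite horner0 horner_sum (bigD1 i) //= big1 => [|k ki].
    rewrite addr0 hornerM along_eval /c derivD derivZ derivX derivC.
    by rewrite eqxx add0r scale1r hornerC mulr1 (meval_eq _ ca) => <-.
  by rewrite /c (negbTE ki) scale0r addr0 derivC mulr0 horner0.
- by move: mS; rewrite {1}mE mdegD mdeg1 addn1 => -[].
Qed.

End Vanishing.

Section AlgebraicDependence.
Variable F : fieldType.

Lemma msizeM_leq N (p q : {mpoly F[N]}) a b :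
  (msize p <= a.+1)%N -> (msize q <= b.+1)%N -> (msize (p * q) <= (a + b).+1)%N.
Proof.
have [->|p0] := eqVneq p 0; first by rewrite mul0r msize0.
have [->|q0] := eqVneq q 0; first by rewrite mulr0 msize0.
move=> pa qb; rewrite msizeM //.
by move: (msize p) (msize q) pa qb => x y; lia.
Qed.

Lemma exists_left_kernel m n (A : 'M[F]_(m, n)) :
  (n < m)%N -> exists2 v : 'rV_m, v != 0 & v *m A = 0.
Proof.
move=> ltnm; have kA0 : kermx A != 0.
  by rewrite kermx_eq0 /row_free neq_ltn (leq_ltn_trans (rank_leq_col A)).
have /rowV0Pn[v /sub_kermxP vA v0] := kA0.
by exists v.
Qed.

(** A dimension count: among the products of powers of the [k + 1] given
    polynomials with exponents below [D] there are [D ^ (k + 1)] monomials,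
    while the polynomials in [k] variables of bounded degree that contain them
    form a space whose dimension only grows like [D ^ k]. *)
Lemma algebraic_dependence k (t : k.+1.-tuple {mpoly F[k]}) :
  exists2 p : {mpoly F[k.+1]}, p != 0 & p \mPo t = 0.
Proof.
pose e := \max_(i < k.+1) msize (tnth t i).
pose C := (k.+1 * e).+1; pose D := (C ^ k).+1; pose B := (D * C)%N.
pose mon (f : {ffun 'I_k.+1 -> 'I_D}) : 'X_{1..k.+1} := [multinom f i : nat | i < k.+1].
pose mon' (f : {ffun 'I_k -> 'I_B}) : 'X_{1..k} := [multinom f i : nat | i < k].
pose g f := \prod_(i < k.+1) tnth t i ^+ mon f i.
have tX i a : (msize (tnth t i ^+ a) <= (a * e).+1)%N.
  elim: a => [|a IHa]; first by rewrite expr0 msize1.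
  rewrite exprS mulSn; apply: msizeM_leq => //.
  by apply/leqW; rewrite /e (leq_bigmax i).
have gsize f : (msize (g f) <= B)%N.
  suff : (msize (g f) <= (\sum_(i < k.+1) (D * e)).+1)%N.
    move/leq_trans; apply; rewrite sum_nat_const card_ord /B /C /D.
    by rewrite mulnCA mulnS; lia.
  rewrite /g; apply: (big_ind2 (fun (q : {mpoly F[k]}) d => (msize q <= d.+1)%N)).
  - by rewrite msize1.
  - by move=> q1 d1 q2 d2; apply: msizeM_leq.
  - move=> i _; apply: leq_trans (tX i _) _; rewrite ltnS leq_mul2r orbC.
    by rewrite /mon mnmE ltnW.
pose A := \matrix_(a < #|{ffun 'I_k.+1 -> 'I_D}|, b < #|{ffun 'I_k -> 'I_B}|)
  (g (enum_val a))@_(mon' (enum_val b)).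
have [|v v0 vA] := @exists_left_kernel _ _ A.
  rewrite !card_ffun !card_ord /B expnMn expnS mulnC ltn_pmul2r ?expn_gt0 //.
exists (\sum_a v 0 a *: 'X_[mon (enum_val a)]).
  apply: contraNneq v0 => p0; apply/eqP/rowP => a; rewrite mxE.
  move/(congr1 (mcoeff (mon (enum_val a)))): p0.
  rewrite mcoeff0 raddf_sum (bigD1 a) //= big1 => [|b ba].
    by rewrite mcoeffZ mcoeffX eqxx mulr1 addr0.
  rewrite mcoeffZ mcoeffX; case: eqP => [mba|_]; last by rewrite mulr0.
  case/eqP: ba; apply/enum_val_inj/ffunP => i; apply/val_inj => /=.
  by move/(congr1 (fun m : 'X_{1..k.+1} => m i)): mba; rewrite !mnmE.
apply/mpolyP => m; rewrite mcoeff0 (raddf_sum (comp_mpoly t)) (raddf_sum (mcoeff m)) /=.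
under eq_bigr => a _ do rewrite comp_mpolyZ comp_mpolyX mcoeffZ -/(g (enum_val a)).
have [ltmB|leBm] := ltnP (mdeg m) B; last first.
  rewrite big1 // => a _; rewrite memN_msupp_eq0 ?mulr0 //.
  by apply: msize_mdeg_ge; apply: leq_trans (gsize _) leBm.
have miB i : (m i < B)%N.
  by apply: leq_ltn_trans ltmB; rewrite mdegE (bigD1 i) //= leq_addr.
pose f := [ffun i : 'I_k => Ordinal (miB i)].
have mf : mon' f = m by apply/mnmP => i; rewrite mnmE ffunE.
move/rowP/(_ (enum_rank f)): vA; rewrite !mxE; apply: etrans.
by apply: eq_bigr => a _; rewrite !mxE enum_rankK mf.
Qed.

End AlgebraicDependence.

(** * Skew matrices of rank two *)

Section Wedge.
Variables (A : comNzRingType) (n : nat).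
Implicit Types u v : 'rV[A]_n.

Definition wedge u v : 'M[A]_n := u^T *m v - v^T *m u.

Lemma wedgeE u v r s : wedge u v r s = u 0 r * v 0 s - v 0 r * u 0 s.
Proof. by rewrite !mxE !big_ord1 !mxE. Qed.

Lemma wedgeDD (u v u' v' : 'rV[A]_n) s :
  wedge (u + s *: u') (v + s *: v') =
  wedge u v + s *: (wedge u' v + wedge u v') + s ^+ 2 *: wedge u' v'.
Proof. by apply/matrixP => a b; rewrite !(wedgeE, mxE); ring. Qed.

End Wedge.

Section RankTwo.
Variables (F : numFieldType) (n : nat).
Implicit Types (X Y : 'M[F]_n) (u v : 'rV[F]_n).

Lemma skewE X : skew X -> forall r s, X r s = - X s r.
Proof. by move=> skX r s; have /matrixP/(_ s r) := skX; rewrite !mxE. Qed.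

Lemma skew_diag X : skew X -> forall r, X r r = 0.
Proof.
move=> skX r; apply/eqP; have /eqP := skewE skX r r.
by rewrite -addr_eq0 -mulr2n -mulr_natl mulf_eq0 pnatr_eq0.
Qed.

Lemma skew_wedge u v : skew (wedge u v).
Proof. by apply/matrixP => r s; rewrite !(wedgeE, mxE); ring. Qed.

Lemma mx_neq0_entry m p (X : 'M[F]_(m, p)) : X != 0 -> exists a b, X a b != 0.
Proof.
move=> X0; suff /existsP[a /existsP[b Xab]] : [exists a, exists b, X a b != 0].
  by exists a, b.
apply: contraR X0; rewrite negb_exists => /forallP X0; apply/eqP/matrixP => a b.
by move: (X0 a); rewrite negb_exists mxE => /forallP/(_ b); rewrite negbK => /eqP.
Qed.

Definition pair_fun (a b : 'I_n) (k : 'I_2) : 'I_n := if k == 0 then a else b.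

Lemma row_pair_free X a b : skew X -> X a b != 0 -> row_free (rowsub (pair_fun a b) X).
Proof.
move=> skX Xab; apply: inj_row_free => w /rowP wX; apply/rowP => k; rewrite mxE.
have wab t : w 0 0 * X a t + w 0 1 * X b t = 0.
  by have := wX t; rewrite !mxE big_ord_recl big_ord1 !mxE (_ : lift _ _ = 1) //; apply/val_inj.
have /eqP := wab a; have /eqP := wab b.
rewrite !skew_diag // !mulr0 addr0 add0r [X b a](skewE skX).
rewrite !mulf_eq0 oppr_eq0 (negbTE Xab) !orbF => /eqP w0 /eqP w1.
by have [->|->] : k = 0 \/ k = 1 by case: k => -[|[|//]] kP; [left|right]; apply/val_inj.
Qed.

Lemma gr2_neq0 X : gr2 X -> X != 0.
Proof. by case=> _ rX; apply: contra_eq_neq rX => ->; rewrite mxrank0. Qed.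

(** Two rows of [X] in which a nonzero coordinate [X a b] sits already span
    its row space, so every other row is the combination of them that is read
    off in the columns [a] and [b]. *)
Lemma gr2_wedge_rows X a b : gr2 X -> X a b != 0 ->
  X = wedge (- (X a b)^-1 *: row b X) (row a X).
Proof.
move=> [skX rX] Xab; have fr := row_pair_free skX Xab.
have sfX : (rowsub (pair_fun a b) X <= X)%MS by apply: rowsub_sub.
have /submxP[D XE] : (X <= rowsub (pair_fun a b) X)%MS.
  by have [_ <-] := mxrank_leqif_sup sfX; rewrite rX (eqP fr).
have DE r t : X r t = D r 0 * X a t + D r 1 * X b t.
  by rewrite {1}XE !mxE big_ord_recl big_ord1 !mxE (_ : lift _ _ = 1) //; apply/val_inj.
apply/matrixP => r s; rewrite wedgeE !mxE.
have := DE r s; have := DE r a; have := DE r b; rewrite !skew_diag //.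
rewrite [X b a](skewE skX) [X b r](skewE skX) [X a r](skewE skX) => -> -> ->.
by field.
Qed.

Lemma wedge_gr2 u v : wedge u v != 0 -> gr2 (wedge u v).
Proof.
move=> uv0; have skX := skew_wedge u v; split=> //; apply/eqP.
have [a [b Xab]] := mx_neq0_entry uv0.
rewrite eqn_leq; apply/andP; split; last first.
  by rewrite -(eqP (row_pair_free skX Xab)); apply/mxrankS/rowsub_sub.
apply: leq_trans (mxrank_add _ _) _; rewrite -[2%N]/(1 + 1)%N leq_add //.
  by apply: leq_trans (mxrankM_maxr _ _) _; apply: rank_leq_row.
by rewrite mxrank_opp; apply: leq_trans (mxrankM_maxr _ _) _; apply: rank_leq_row.
Qed.

Lemma gr2P X : gr2 X <-> X != 0 /\ exists u v, X = wedge u v.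
Proof.
split=> [gX|[X0 [u [v XE]]]]; last by rewrite XE in X0 *; apply: wedge_gr2.
have X0 := gr2_neq0 gX; split=> //; have [a [b Xab]] := mx_neq0_entry X0.
by exists (- (X a b)^-1 *: row b X), (row a X); apply: gr2_wedge_rows.
Qed.

Lemma gr2_plucker X a b r s : gr2 X ->
  X a b * X r s = X a r * X b s - X a s * X b r.
Proof. by case/gr2P => _ [u [v ->]]; rewrite !wedgeE; ring. Qed.

End RankTwo.

(** * Schubert varieties and their big cell *)

Section Schubert.
Variables (F : numFieldType) (n : nat) (i j : 'I_n).
Implicit Types (X Y : 'M[F]_n) (u v : 'rV[F]_n).

Definition zeroed (r s : 'I_n) : bool := (minn r s < i)%N || (maxn r s < j)%N.

(** The affine cone over a Schubert variety, vertex included. *)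
Definition schubert_cone X : Prop :=
  (exists u v, X = wedge u v) /\ forall r s, zeroed r s -> X r s = 0.

Definition supported_from (k : nat) u : Prop := forall r : 'I_n, (r < k)%N -> u 0 r = 0.

Lemma zeroedC r s : zeroed r s = zeroed s r.
Proof. by rewrite /zeroed minnC maxnC. Qed.

Lemma schubertP X : schubert i j X <-> X != 0 /\ schubert_cone X.
Proof.
split=> [[gX X0]|[X0 [XE Xz]]].
  have [nzX XE] := (gr2P X).1 gX; split=> //; split=> // r s.
  have skX := gX.1; rewrite /zeroed; case: (ltngtP r s) => [rs|sr|/val_inj ->].
  - by move=> h; apply: X0.
  - by move=> h; rewrite (skewE skX) X0 ?oppr0.
  - by rewrite skew_diag.
split; first exact/gr2P.
by move=> r s rs h; apply: Xz; rewrite /zeroed; lia.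
Qed.

Lemma schubert_skew X : schubert i j X -> skew X.
Proof. by case=> -[]. Qed.

Lemma schubert_zeroed X r s : schubert i j X -> zeroed r s -> X r s = 0.
Proof. by case/schubertP => _ [_]; apply. Qed.

Hypothesis ij : (i < j)%N.

Lemma wedge_in_cone u v :
  supported_from i u -> supported_from j v -> schubert_cone (wedge u v).
Proof.
move=> su sv; split; first by exists u, v.
move=> r s; rewrite wedgeE /zeroed => /orP[].
  have suv (t : 'I_n) : (t < i)%N -> u 0 t = 0 /\ v 0 t = 0.
    by move=> ti; rewrite su // sv //; lia.
  by rewrite gtn_min => /orP[] /suv[-> ->]; rewrite !(mul0r, mulr0) subrr.
by rewrite gtn_max => /andP[hr hs]; rewrite !sv // mulr0 mul0r subrr.
Qed.

Lemma cone_wedge X : schubert_cone X ->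
  exists u v, [/\ supported_from i u, supported_from j v & X = wedge u v].
Proof.
move=> cX; have [X0|X0] := eqVneq X 0.
  exists 0, 0; split; try by move=> r _; rewrite mxE.
  by rewrite X0 /wedge mulmx0 subrr.
have /schubertP sX : X != 0 /\ schubert_cone X by [].
have zX := schubert_zeroed sX; have [gX _] := sX.
(* The plane of [X] meets the span of the basis vectors from [j] on: a nonzero
   row of index below [j] lies in it, and without such a row all of them do. *)
suff [a [b [Xab Xa]]] : exists a b, X a b != 0 /\ supported_from j (row a X).
  exists (- (X a b)^-1 *: row b X), (row a X); split=> //; last exact: gr2_wedge_rows.
  by move=> r ri; rewrite !mxE [X _ r]zX ?mulr0 // /zeroed; lia.
have [/existsP[a /existsP[b /andP[aj Xab]]]|] :=
    boolP [exists a : 'I_n, exists b, (a < j)%N && (X a b != 0)].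
  by exists a, b; split=> // r rj; rewrite mxE zX // /zeroed; lia.
rewrite negb_exists => /forallP h; have [a [b Xab]] := mx_neq0_entry X0.
exists a, b; split=> // r rj; rewrite mxE (skewE gX.1).
by have := h r; rewrite negb_exists => /forallP/(_ a); rewrite rj negbK => /eqP ->; rewrite oppr0.
Qed.

(** The rows [i] and [j] thus give coordinates on the cell where [X i j] does
    not vanish. *)
Lemma cell_wedge X : schubert i j X -> X i j != 0 ->
  [/\ supported_from i (- (X i j)^-1 *: row j X), supported_from j (row i X)
    & X = wedge (- (X i j)^-1 *: row j X) (row i X)].
Proof.
move=> sX Xij; have zX := schubert_zeroed sX; split; last by apply: gr2_wedge_rows => //; case: sX.
  by move=> r ri; rewrite !mxE [X _ r]zX ?mulr0 // /zeroed; lia.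
by move=> r ri; rewrite !mxE zX // /zeroed; lia.
Qed.

End Schubert.

(** * Plucker coordinates *)

Section Coordinates.
Variable n : nat.
Implicit Types (k l : 'I_(ncoord n)).

Lemma prow_lt_pcol k : (prow k < pcol k)%N.
Proof. exact: (enum_valP k). Qed.

Lemma coord_of (r s : 'I_n) : (r < s)%N -> exists2 k, prow k = r & pcol k = s.
Proof.
move=> rs; have rsU : (r, s) \in @upper n by [].
by exists (enum_rank_in rsU (r, s)); rewrite /prow /pcol enum_rankK_in.
Qed.

Lemma coord_inj k l : prow k = prow l -> pcol k = pcol l -> k = l.
Proof.
move=> rkl ckl; apply: enum_val_inj.
by rewrite [enum_val k]surjective_pairing [enum_val l]surjective_pairing; congr pair.
Qed.

Section Ring.
Variable A : comNzRingType.
Implicit Types (w : 'I_(ncoord n) -> A) (X Y : 'M[A]_n).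

(** Skew-symmetry with a vanishing diagonal, which has to be required apart over
    a ring of arbitrary characteristic. *)
Definition alternating X := X^T = - X /\ forall r, X r r = 0.

Definition of_coords w : 'M[A]_n :=
  \sum_k w k *: (delta_mx (prow k) (pcol k) - delta_mx (pcol k) (prow k)).

Lemma of_coordsE w k : of_coords w (prow k) (pcol k) = w k.
Proof.
rewrite summxE (bigD1 k) //= big1 => [|l lk]; rewrite !mxE.
  have /negbTE rc : prow k != pcol k by rewrite neq_ltn prow_lt_pcol.
  by rewrite !eqxx rc /= subr0 mulr1 addr0.
have -> : (prow k == prow l) && (pcol k == pcol l) = false.
  apply/negP => /andP[/eqP rkl /eqP ckl]; case/eqP: lk.
  exact/esym/coord_inj.
suff -> : (prow k == pcol l) && (pcol k == prow l) = false by rewrite subrr mulr0.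
apply/negP => /andP[/eqP rkl /eqP ckl]; have := prow_lt_pcol k.
by rewrite rkl ckl ltnNge ltnW // prow_lt_pcol.
Qed.

Lemma alternating_of_coords w : alternating (of_coords w).
Proof.
split; last by move=> r; rewrite summxE big1 // => k _; rewrite !mxE andbC subrr mulr0.
rewrite linear_sum -sumrN; apply: eq_bigr => k _ /=.
by rewrite linearZ linearB /= !trmx_delta -scalerN opprB.
Qed.

Lemma alternating_ext X Y : alternating X -> alternating Y ->
  (forall k, X (prow k) (pcol k) = Y (prow k) (pcol k)) -> X = Y.
Proof.
move=> [tX dX] [tY dY] XY; apply/matrixP => r s.
have [rs|sr|/val_inj ->] := ltngtP r s; last by rewrite dX dY.
  by have [k <- <-] := coord_of rs; apply: XY.
have [k kr ks] := coord_of sr.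
have /matrixP/(_ s r) := tX; have /matrixP/(_ s r) := tY.
by rewrite !mxE => -> ->; rewrite -kr -ks XY.
Qed.

Lemma trace_alternating X Y : alternating X -> alternating Y ->
  \tr (X *m Y) = - 2 * \sum_k X (prow k) (pcol k) * Y (prow k) (pcol k).
Proof.
move=> [tX dX] [tY dY]; pose f (p : 'I_n * 'I_n) := X p.1 p.2 * Y p.1 p.2.
have fC r s : f (r, s) = f (s, r).
  have /matrixP/(_ s r) := tX; have /matrixP/(_ s r) := tY.
  by rewrite /f !mxE /= => -> ->; rewrite mulrNN.
pose U (p : 'I_n * 'I_n) := (p.1 < p.2)%N.
have sumU : \sum_(p | U p) f p = \sum_k X (prow k) (pcol k) * Y (prow k) (pcol k).
  have -> : \sum_(p | U p) f p = \sum_(p in @upper n) f p by apply: eq_bigl.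
  by rewrite big_enum_val.
have -> : \tr (X *m Y) = - \sum_p f p.
  rewrite -(pair_bigA _ (fun r s => f (r, s))) /= -sumrN; apply: eq_bigr => r _.
  rewrite mxE -sumrN; apply: eq_bigr => s _.
  by have /matrixP/(_ r s) := tY; rewrite !mxE => ->; rewrite /f mulrN.
pose swap (p : 'I_n * 'I_n) := (p.2, p.1).
rewrite (bigID U) /= sumU [X in _ + X](bigID (U \o swap)) /=.
rewrite [X in _ + (_ + X)]big1 ?addr0 => [|[r s] /andP[]]; last first.
  rewrite /U /swap /= => rs sr; have -> : r = s by apply: ord_inj; lia.
  by rewrite /f /= dX mul0r.
have swapI : injective swap by move=> [r s] [r' s'] [-> ->].
have -> : \sum_(p | ~~ U p && U (swap p)) f p = \sum_(p | U p) f p.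
  rewrite (reindex_inj swapI) /=.
  by apply: eq_big => [[r s]|[r s] _] /=; [rewrite /U /swap /=; lia | apply: fC].
by rewrite sumU mulNr mulr_natl mulr2n.
Qed.

End Ring.

Lemma alternating_skew (F : numFieldType) (X : 'M[F]_n) : skew X -> alternating X.
Proof. by move=> skX; split=> // r; apply: skew_diag. Qed.

Section GenericSkew.
Variable F : numFieldType.
Implicit Types (X : 'M[F]_n).

Lemma generic_skewE k :
  @generic_skew F n (prow k) (pcol k) = 'X_k.
Proof. exact: (of_coordsE (fun k => 'X_k)). Qed.

Lemma alternating_generic : alternating (@generic_skew F n).
Proof. exact: alternating_of_coords. Qed.

(** Evaluation of matrices of polynomials in the Plucker coordinates; an
    identity between such matrices modulo a vanishing ideal is checked through
    it, point by point. *)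
Definition ev X {m p} (P : 'M[{mpoly F[ncoord n]}]_(m, p)) : 'M[F]_(m, p) :=
  map_mx (meval (plucker X)) P.

Lemma ev_generic X : skew X -> ev X (@generic_skew F n) = X.
Proof.
move=> skX; apply: alternating_ext (alternating_skew skX) _ => [|k].
  have [tG dG] := alternating_generic; split; last by move=> r; rewrite mxE dG meval0.
  by rewrite /ev map_trmx tG map_mxN.
by rewrite mxE generic_skewE mevalXU.
Qed.

Lemma ev_cst X (Y : 'M[F]_n) : ev X (cst_mx Y) = Y.
Proof. by apply/matrixP => r s; rewrite !mxE mevalC. Qed.

Lemma evM X m p q (P : 'M_(m, p)) (Q : 'M_(p, q)) : ev X (P *m Q) = ev X P *m ev X Q.
Proof. exact: map_mxM. Qed.

Lemma evD X m p (P Q : 'M_(m, p)) : ev X (P + Q) = ev X P + ev X Q.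
Proof. exact: map_mxD. Qed.

Lemma evB X m p (P Q : 'M_(m, p)) : ev X (P - Q) = ev X P - ev X Q.
Proof. exact: map_mxB. Qed.

Lemma evZ X m p a (P : 'M_(m, p)) : ev X (a *: P) = a.@[plucker X] *: ev X P.
Proof. exact: map_mxZ. Qed.

Lemma evT X m p (P : 'M_(m, p)) : ev X P^T = (ev X P)^T.
Proof. by rewrite /ev map_trmx. Qed.

Lemma ev_tr X (P : 'M_n) : (\tr P).@[plucker X] = \tr (ev X P).
Proof. by rewrite /ev trace_map_mx. Qed.

Lemma ev_trXY X Y : skew X -> (trXY Y).@[plucker X] = \tr (X *m Y).
Proof. by move=> skX; rewrite /trXY ev_tr evM ev_generic // ev_cst. Qed.

Lemma ev_trX2 X : skew X -> (@trX2 F n).@[plucker X] = \tr (X *m X).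
Proof. by move=> skX; rewrite /trX2 ev_tr evM ev_generic. Qed.

End GenericSkew.

End Coordinates.

(** * Ideals, saturations and determinants *)

Section Ideals.
Variables (F : fieldType) (N : nat).
Implicit Types (A I J : {mpoly F[N]} -> Prop) (f g h : {mpoly F[N]}).

Definition is_ideal I : Prop :=
  [/\ I 0, forall f g, I f -> I g -> I (f + g) & forall a f, I f -> I (a * f)].

Lemma ideal_sum I (T : Type) (r : seq T) (P : pred T) (f : T -> {mpoly F[N]}) :
  is_ideal I -> (forall x, P x -> I (f x)) -> I (\sum_(x <- r | P x) f x).
Proof. by move=> [I0 ID _] If; apply: (big_ind I). Qed.

Lemma ideal_mulr I f a : is_ideal I -> I f -> I (f * a).
Proof. by case=> _ _ IM If; rewrite mulrC; apply: IM. Qed.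

Lemma ideal_opp I f : is_ideal I -> I f -> I (- f).
Proof. by case=> _ _ IM If; rewrite -mulN1r; apply: IM. Qed.

Lemma ideal_sub I f g : is_ideal I -> I f -> I g -> I (f - g).
Proof. by move=> iI If Ig; have [_ ID _] := iI; apply: ID => //; apply: ideal_opp. Qed.

Lemma ideal_scale I a f : is_ideal I -> I f -> I (a *: f).
Proof. by case=> _ _ IM If; rewrite -mul_mpolyC; apply: IM. Qed.

Lemma ideal_unscale I a f : is_ideal I -> a != 0 -> I (a *: f) -> I f.
Proof.
by move=> iI a0 /(ideal_scale a^-1 iI); rewrite scalerA mulVf // scale1r.
Qed.

Lemma ideal_gen_sub A f : A f -> ideal_gen A f.
Proof.
move=> Af; exists 1%N, (fun=> 1), (fun=> f); split=> //.
by rewrite big_ord1 mul1r.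
Qed.

Lemma ideal_gen_ideal A : is_ideal (ideal_gen A).
Proof.
split=> [|f g|c f].
- by exists 0%N, (fun=> 0), (fun=> 0); split=> [[]//|]; rewrite big_ord0.
- move=> [k [a [b [Ab ->]]]] [k' [a' [b' [Ab' ->]]]].
  exists (k + k')%N,
    (fun x => match split x with inl y => a y | inr y => a' y end),
    (fun x => match split x with inl y => b y | inr y => b' y end).
  split; first by move=> x; case: split.
  rewrite big_split_ord /=; congr (_ + _); apply: eq_bigr => x _.
    by rewrite (unsplitK (inl _ x)).
  by rewrite (unsplitK (inr _ x)).
- move=> [k [a [b [Ab ->]]]]; exists k, (fun x => c * a x), b; split=> //.
  by rewrite mulr_sumr; apply: eq_bigr => x _; rewrite mulrA.
Qed.

Lemma ideal_gen_min A I f : is_ideal I -> (forall g, A g -> I g) -> ideal_gen A f -> I f.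
Proof.
move=> iI AI [k [a [b [Ab ->]]]]; apply: ideal_sum => // x _.
by have [_ _ IM] := iI; apply/IM/AI.
Qed.

Lemma ideal_addl I J f : I f -> ideal_add I J f.
Proof. by move=> If; apply: ideal_gen_sub; left. Qed.

Lemma ideal_addr I J f : J f -> ideal_add I J f.
Proof. by move=> Jf; apply: ideal_gen_sub; right. Qed.

Lemma ideal_pow_addl J k l h : ideal_pow J (k + l) h -> ideal_pow J k h.
Proof.
apply: ideal_gen_min; first exact: ideal_gen_ideal.
move=> g [b [Jb ->]]; rewrite big_split_ord /= mulrC.
have [_ _ PM] : is_ideal (ideal_pow J k) by apply: ideal_gen_ideal.
by apply/PM/ideal_gen_sub; exists (fun x => b (lshift l x)).
Qed.

Lemma saturation_ideal I J : is_ideal I -> is_ideal (saturation I J).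
Proof.
move=> iI; have [I0 ID IM] := iI; split=> [|f g [k fk] [l gl]|a f [k fk]].
- by exists 0%N => h _; rewrite mul0r.
- exists (k + l)%N => h hkl; rewrite mulrDl; apply: ID.
    exact/fk/ideal_pow_addl/hkl.
  by apply/gl; move: hkl; rewrite addnC; apply: ideal_pow_addl.
- by exists k => h /fk If; rewrite -mulrA; apply: IM.
Qed.

Lemma saturation_sub I J f : is_ideal I -> I f -> saturation I J f.
Proof. by move=> iI If; exists 0%N => h _; apply: ideal_mulr. Qed.

Lemma saturation_colon I J f :
  is_ideal I -> (forall h, J h -> I (f * h)) -> saturation I J f.
Proof.
move=> iI fJ; exists 1%N => h [k [a [b [Jb ->]]]].
rewrite mulr_sumr; apply: ideal_sum => // x _; have [c [Jc ->]] := Jb x.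
by rewrite big_ord1 mulrCA; case: iI => _ _ IM; apply/IM/fJ.
Qed.

Lemma saturation_principal I g k f :
  is_ideal I -> I (f * g ^+ k) -> saturation I (ideal_gen (fun x => x = g)) f.
Proof.
move=> iI If; have [_ _ IM] := iI; exists k => h [l [a [b [Pb ->]]]].
rewrite mulr_sumr; apply: ideal_sum => // x _; have [c [gc ->]] := Pb x.
rewrite mulrCA; apply/IM.
have [d ->] : exists d, \prod_y c y = d * g ^+ k; last by rewrite mulrCA; apply: IM.
have cd y : exists d, c y = d * g.
  have [m [a' [b' [gb ->]]]] := gc y; exists (\sum_z a' z).
  by rewrite mulr_suml; apply: eq_bigr => z _; rewrite (gb z).
elim: k c cd {If h x b Pb gc} => [|k IHk] c cd.
  by exists 1; rewrite big_ord0 expr0 mulr1.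
rewrite big_ord_recl; have [d ->] := cd ord0.
by have [d' ->] := IHk _ (fun y => cd (lift ord0 y)); exists (d * d'); rewrite exprS; ring.
Qed.

(** At a point where [h] does not vanish the powers of [h] can be cancelled. *)
Lemma saturation_zero I J (x : 'I_N -> F) h f :
  J h -> h.@[x] != 0 -> (forall g, I g -> g.@[x] = 0) ->
  saturation I J f -> f.@[x] = 0.
Proof.
move=> Jh hx Ix [k fk]; have /fk/Ix/eqP : ideal_pow J k (h ^+ k).
  by apply: ideal_gen_sub; exists (fun=> h); split=> //; rewrite prodr_const card_ord.
by rewrite mevalM rmorphXn mulf_eq0 expf_eq0 (negbTE hx) andbF orbF => /eqP.
Qed.

End Ideals.

(** * Density and tangent vectors of the big cell *)

Section CurvesOnSchubert.
Variables (F : numFieldType) (n : nat) (i j : 'I_n).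
Hypothesis ij : (i < j)%N.
Implicit Types (X T Z W : 'M[F]_n) (f : {mpoly F[ncoord n]}).

Local Notation M := (@schubert F n i j).
Local Notation I := (vanishing_ideal M).

Lemma vanishing_ideal_ideal (V : 'M[F]_n -> Prop) : is_ideal (vanishing_ideal V).
Proof.
split=> [X _|f g If Ig X VX|a f If X VX]; first by rewrite meval0.
  by rewrite mevalD If // Ig // addr0.
by rewrite mevalM If // mulr0.
Qed.

(** The curve [X + s T + s^2 Z]. Wedges of two lines and orbits of one-parameter
    families [1 + s E] have this form, so degree two suffices throughout. *)
Definition quadratic_curve X T Z (k : 'I_(ncoord n)) : {poly F} :=
  (plucker X k)%:P + plucker T k *: 'X + plucker Z k *: 'X^2.

Lemma along_quadratic X T Z f s :
  (along (quadratic_curve X T Z) f).[s] =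
  f.@[plucker (X + s *: T + s ^+ 2 *: Z)].
Proof.
rewrite along_eval; apply: meval_eq => k.
by rewrite /quadratic_curve /plucker !mxE !hornerD hornerC !hornerZ hornerX hornerXn; ring.
Qed.

(** A polynomial vanishing on [M] vanishes identically along a curve in the
    cone that is not constantly the vertex, hence to first order. *)
Lemma curve_tangent X T Z f :
  X != 0 -> (forall s, schubert_cone i j (X + s *: T + s ^+ 2 *: Z)) ->
  I f -> \sum_k (f^`M(k)).@[plucker X] * plucker T k = 0.
Proof.
move=> X0 cX If; pose c := quadratic_curve X T Z.
have cX0 : schubert_cone i j X by have := cX 0; rewrite expr0n /= !scale0r !addr0.
have /schubertP sX : X != 0 /\ schubert_cone i j X by [].
have [k Xk] : exists k, plucker X k != 0.
  apply/existsP; apply: contraR X0; rewrite negb_exists => /forallP X0.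
  apply/eqP; apply: (alternating_ext (alternating_skew (schubert_skew sX))) => [|k].
    by split=> [|r]; rewrite ?mxE // trmx0 oppr0.
  by rewrite mxE; apply/eqP; have := X0 k; rewrite negbK.
have q0 : along c 'X_k != 0.
  apply: contraNneq Xk => /(congr1 (fun p : {poly F} => p.[0])).
  by rewrite along_quadratic horner0 mevalXU expr0n /= !scale0r !addr0 => ->.
have : along c f = 0.
  have /eqP : along c f * along c 'X_k = 0; last by rewrite mulf_eq0 (negbTE q0) orbF => /eqP.
  apply: poly_eq0_of_roots => s; rewrite hornerM !along_quadratic mevalXU.
  set Xs := _ + _; have [Xs0|Xs0] := eqVneq Xs 0.
    by rewrite Xs0 /plucker mxE mulr0.
  by rewrite If ?mul0r //; apply/schubertP; split=> //; apply: cX.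
move/(congr1 (fun p : {poly F} => p^`().[0])).
rewrite deriv0 horner0 along_deriv horner_sum => {2}<-; apply: eq_bigr => l _.
rewrite hornerM along_quadratic expr0n /= !scale0r !addr0; congr (_ * _).
rewrite /c /quadratic_curve !derivD derivC !derivZ derivX derivXn /=.
rewrite !(hornerD, hornerZ, hornerC, hornerMn, hornerX, horner0); ring.
Qed.

(** The curve [(u + s e_i) /\ (v + s e_j)] meets the big cell for almost all
    [s], so the big cell is dense. *)
Lemma vanishing_on_cell f :
  (forall X, M X -> X i j != 0 -> f.@[plucker X] = 0) -> I f.
Proof.
move=> fc X MX; have [X0 cX] := (schubertP i j X).1 MX.
have [u [v [su sv XE]]] := cone_wedge ij cX.
pose ei : 'rV[F]_n := delta_mx 0 i; pose ej : 'rV[F]_n := delta_mx 0 j.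
pose T := wedge ei v + wedge u ej; pose Z := wedge ei ej.
have cs s : schubert_cone i j (X + s *: T + s ^+ 2 *: Z).
  rewrite XE -wedgeDD; apply: wedge_in_cone => // r h; rewrite !mxE /=.
    rewrite su // (_ : r == i = false) ?andbF ?mulr0 ?addr0 //.
    by apply/negbTE; rewrite neq_ltn h.
  rewrite sv // (_ : r == j = false) ?andbF ?mulr0 ?addr0 //.
  by apply/negbTE; rewrite neq_ltn h.
have [k ki kj] := coord_of ij; pose c := quadratic_curve X T Z.
have Zk : plucker Z k = 1.
  rewrite /plucker ki kj wedgeE !mxE !eqxx /= (_ : j == i = false) ?mulr0 ?subr0 ?mulr1 //.
  by apply/negbTE; rewrite neq_ltn ij orbT.
have q0 : along c 'X_k != 0.
  apply: contraTneq isT => q0; have := oner_eq0 F; rewrite -Zk.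
  have -> : plucker Z k = (along c 'X_k)`_2; last by rewrite q0 coef0 eqxx.
  rewrite /along mmapX mmap1U /c /quadratic_curve !coefD !coefZ coefC coefX coefXn /=.
  by rewrite mulr0 mulr1 !add0r.
have : along c f = 0.
  have /eqP : along c f * along c 'X_k = 0; last by rewrite mulf_eq0 (negbTE q0) orbF => /eqP.
  apply: poly_eq0_of_roots => s; rewrite hornerM !along_quadratic mevalXU /plucker ki kj.
  set Xs := _ + _; have [->|Xs0] := eqVneq (Xs i j) 0; first by rewrite mulr0.
  rewrite -/(plucker Xs) fc ?mul0r //; apply/schubertP; split; last exact: cs.
  by apply: contraNneq Xs0 => ->; rewrite mxE.
move/(congr1 (fun p : {poly F} => p.[0])).
by rewrite along_quadratic expr0n /= !scale0r !addr0 horner0.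
Qed.

(** ** Coordinates on the big cell *)

(** The entries of the rows [i] and [j] that may be nonzero on the Schubert
    variety: they are coordinates of the big cell, as [cell_wedge] shows. *)
Definition free_coord : {pred 'I_(ncoord n)} := fun k =>
  ~~ zeroed i j (prow k) (pcol k) &&
  [|| prow k == i, prow k == j, pcol k == i | pcol k == j].

Definition in_support W := forall r s, zeroed i j r s -> W r s = 0.

Lemma free_coord_rows X W k : skew X -> skew W ->
  (forall s, X i s = W i s) -> (forall s, X j s = W j s) ->
  free_coord k -> plucker X k = plucker W k.
Proof.
move=> skX skW Xi Xj /andP[_]; rewrite /plucker.
by case/or4P => /eqP ->; rewrite ?Xi ?Xj // (skewE skX) ?Xi ?Xj -(skewE skW).
Qed.

Lemma support_rows W : skew W -> in_support W ->
  supported_from i (row j W) /\ supported_from j (row i W).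
Proof.
move=> skW zW; split=> r h; rewrite mxE zW // /zeroed; lia.
Qed.

Lemma cell_point W : skew W -> in_support W -> W i j != 0 ->
  exists2 X, M X & (forall s, X i s = W i s) /\ (forall s, X j s = W j s).
Proof.
move=> skW zW Wij; have [sj si] := support_rows skW zW.
pose X := wedge (- (W i j)^-1 *: row j W) (row i W).
have Xi s : X i s = W i s.
  by rewrite wedgeE !mxE [W j i](skewE skW) (skew_diag skW); field.
have Xj s : X j s = W j s.
  by rewrite wedgeE !mxE (skew_diag skW j); field.
exists X => //; apply/schubertP; split.
  by apply: contraNneq Wij => X0; rewrite -Xi X0 mxE.
by apply: wedge_in_cone => // r ri; rewrite mxE sj ?mulr0.
Qed.

(** Differentiating the parametrization of the cell by the rows [i] and [j]. *)
Lemma cell_tangent X W : M X -> X i j != 0 -> skew W -> in_support W ->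
  exists T Z, [/\ skew T, forall s, schubert_cone i j (X + s *: T + s ^+ 2 *: Z),
    (forall s, T i s = W i s) & (forall s, T j s = W j s)].
Proof.
move=> MX Xij skW zW; have [su sv XE] := cell_wedge ij MX Xij.
have [sj si] := support_rows skW zW; have skX := schubert_skew MX.
pose u := - (X i j)^-1 *: row j X.
pose u' := - (X i j)^-1 *: (row j W + W i j *: u); pose v' := row i W.
exists (wedge u' (row i X) + wedge u v'), (wedge u' v'); split.
- by apply/matrixP => r s; rewrite !(wedgeE, mxE); ring.
- move=> s; rewrite {1}XE -wedgeDD; apply: wedge_in_cone => // r h.
    by rewrite mxE su // mxE add0r mxE [_ 0 r]mxE sj // mxE su // mulr0 addr0 !mulr0.
  by rewrite mxE sv // mxE add0r si // mulr0.
- move=> s; rewrite !(wedgeE, mxE) (skew_diag skX) (skew_diag skW) [X j i](skewE skX) [W j i](skewE skW).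
  by field.
- move=> s; rewrite !(wedgeE, mxE) !(skew_diag skX) !(skew_diag skW).
  by field.
Qed.

End CurvesOnSchubert.

(** * The dimension of a Schubert variety *)

Section DirectionalDerivative.
Variables (F : numFieldType) (n : nat).
Implicit Types (X W : 'M[F]_n) (f g : {mpoly F[ncoord n]}).

Definition dir X W f : F := \sum_k (f^`M(k)).@[plucker X] * plucker W k.

Lemma dirD X W f g : dir X W (f + g) = dir X W f + dir X W g.
Proof.
by rewrite -big_split; apply: eq_bigr => k _; rewrite mderivD mevalD mulrDl.
Qed.

Lemma dirN X W f : dir X W (- f) = - dir X W f.
Proof.
by rewrite -sumrN; apply: eq_bigr => k _; rewrite mderivN mevalN mulNr.
Qed.

Lemma dirB X W f g : dir X W (f - g) = dir X W f - dir X W g.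
Proof. by rewrite dirD dirN. Qed.

Lemma dirM X W f g :
  dir X W (f * g) = dir X W f * g.@[plucker X] + f.@[plucker X] * dir X W g.
Proof.
rewrite /dir mulr_suml mulr_sumr -big_split; apply: eq_bigr => k _ /=.
by rewrite mderivM mevalD !mevalM; ring.
Qed.

Lemma dir_sum X W (T : Type) (r : seq T) (P : pred T) (f : T -> {mpoly F[ncoord n]}) :
  dir X W (\sum_(x <- r | P x) f x) = \sum_(x <- r | P x) dir X W (f x).
Proof.
apply: (big_morph _ (dirD X W)); rewrite /dir big1 // => k _.
by rewrite mderiv0 meval0 mul0r.
Qed.

Lemma dirX X W k : dir X W 'X_k = plucker W k.
Proof.
rewrite /dir (bigD1 k) //= big1 ?addr0 => [|l lk].
  have -> : 'X_k^`M(k) = 1 :> {mpoly F[ncoord n]}.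
    rewrite mderivX mnm1E eqxx scale1r (_ : (_ - _)%MM = 0%MM) ?mpolyX0 //.
    by apply/mnmP => l; rewrite mnmBE subnn mnm0E.
  by rewrite meval1 mul1r.
by rewrite mderivX mnm1E eq_sym (negbTE lk) scale0r meval0 mul0r.
Qed.

Lemma dir_generic X W r s : skew W -> dir X W (@generic_skew F n r s) = W r s.
Proof.
move=> skW; have [tG dG] := @alternating_generic n F.
have dir_upper (a b : 'I_n) : (a < b)%N -> dir X W (@generic_skew F n a b) = W a b.
  by case/coord_of=> k <- <-; rewrite generic_skewE dirX.
have [rs|sr|/val_inj ->] := ltngtP r s; first exact: dir_upper.
  have /matrixP/(_ s r) := tG; rewrite [in X in X = _]mxE [in X in _ = X]mxE => ->.
  by rewrite dirN dir_upper // -(skewE skW).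
by rewrite dG skew_diag // /dir big1 // => k _; rewrite mderiv0 meval0 mul0r.
Qed.

Lemma ev_entry X r s : skew X -> (@generic_skew F n r s).@[plucker X] = X r s.
Proof. by move=> skX; have /matrixP/(_ r s) := ev_generic skX; rewrite mxE. Qed.

End DirectionalDerivative.

Section Dimension.
Variables (F : numFieldType) (n : nat) (i j : 'I_n).
Hypothesis ij : (i < j)%N.
Implicit Types (X T Z W : 'M[F]_n) (f : {mpoly F[ncoord n]}).

Local Notation M := (@schubert F n i j).
Local Notation I := (vanishing_ideal M).
Local Notation N := (ncoord n).
Local Notation free := (@free_coord n i j).

Definition codim_schubert : nat := #|[predC free]|.

Lemma card_free_coord : (#|free| + codim_schubert)%N = N.
Proof. by rewrite cardC card_ord. Qed.

Lemma nfreeP k : ~~ free k -> zeroed i j (prow k) (pcol k) \/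
  ~~ [|| prow k == i, prow k == j, pcol k == i | pcol k == j].
Proof.
rewrite /free_coord; case: (zeroed _ _ _ _) => /=; first by left.
by right.
Qed.

Lemma corner_coord : exists2 k, free k & prow k = i /\ pcol k = j.
Proof.
have [k ki kj] := coord_of ij; exists k => //.
by rewrite /free_coord /zeroed ki kj eqxx andbT; lia.
Qed.

Lemma in_support_coords W : skew W ->
  (forall k, zeroed i j (prow k) (pcol k) -> plucker W k = 0) -> in_support i j W.
Proof.
move=> skW W0 r s rs; have [lt_rs|sr|/val_inj ->] := ltngtP r s; last exact: skew_diag.
  by have [k kr ks] := coord_of lt_rs; rewrite -kr -ks; apply: W0; rewrite kr ks.
have [k ks kr] := coord_of sr; rewrite (skewE skW) -kr -ks [W _ _]W0 ?oppr0 //.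
by rewrite kr ks zeroedC.
Qed.

Section Parametrization.
Variable d : nat.
Hypothesis card_free : #|free| = d.+1.

Definition free_val (l : 'I_d.+1) : 'I_N := enum_val (cast_ord (esym card_free) l).

Lemma free_valP l : free (free_val l).
Proof. exact: (enum_valP (cast_ord (esym card_free) l)). Qed.

Lemma free_val_inj : injective free_val.
Proof. by move=> l l' /enum_val_inj /cast_ord_inj. Qed.

Lemma free_val_surj k : free k -> exists l, free_val l = k.
Proof.
move=> fk; exists (cast_ord card_free (enum_rank_in (fk : k \in free) k)).
by rewrite /free_val cast_ordK enum_rankK_in.
Qed.

Definition extend (A : comNzRingType) (a : 'I_d.+1 -> A) (k : 'I_N) : A :=
  \sum_l a l * (free_val l == k)%:R.

Lemma extendE (A : comNzRingType) (a : 'I_d.+1 -> A) l : extend a (free_val l) = a l.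
Proof.
rewrite /extend (bigD1 l) //= eqxx mulr1 big1 ?addr0 // => l' l'l.
by rewrite (inj_eq free_val_inj) (negbTE l'l) mulr0.
Qed.

Lemma extend_out (A : comNzRingType) (a : 'I_d.+1 -> A) k : ~~ free k -> extend a k = 0.
Proof.
move=> nk; rewrite /extend big1 // => l _; case: eqP => [lk|_]; last by rewrite mulr0.
by move: nk; rewrite -lk free_valP.
Qed.

Lemma extend_restrict (A : comNzRingType) (w : 'I_N -> A) k :
  (~~ free k -> w k = 0) -> extend (fun l => w (free_val l)) k = w k.
Proof.
move=> wk; have [fk|nk] := boolP (free k); last by rewrite extend_out ?wk.
by have [l <-] := free_val_surj fk; rewrite extendE.
Qed.

Definition extend_mx (a : 'I_d.+1 -> F) : 'M[F]_n := of_coords (extend a).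

Lemma extend_mx_skew a : skew (extend_mx a).
Proof. by case: (alternating_of_coords (extend a)). Qed.

Lemma plucker_extend a k : plucker (extend_mx a) k = extend a k.
Proof. exact: of_coordsE. Qed.

Lemma extend_mx_support a : in_support i j (extend_mx a).
Proof.
apply: in_support_coords; first exact: extend_mx_skew.
by move=> k zk; rewrite plucker_extend extend_out // /free_coord zk.
Qed.

(** By [cell_point] the free coordinates take arbitrary values on the cell, as
    long as the one at [(i, j)] does not vanish. *)
Lemma free_coords_independent :
  alg_indep_mod I [tuple ('X_(free_val l) : {mpoly F[N]}) | l < d.+1].
Proof.
move=> p Ip; have [k0 fk0 [k0i k0j]] := corner_coord.
have [l0 l0k] := free_val_surj fk0; apply/eqP.
have /eqP : p * 'X_l0 = 0; last first.
  rewrite mulf_eq0 => /orP[//|/eqP X0].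
  by have := mevalXU (fun=> 1 : F) l0; rewrite X0 meval0 => /esym/eqP; rewrite oner_eq0.
apply: mpoly_eq0_of_zeros => a; rewrite mevalM mevalXU.
have [->|al0] := eqVneq (a l0) 0; first by rewrite mulr0.
have skW := extend_mx_skew a; have zW := extend_mx_support a.
have Wij : extend_mx a i j = a l0.
  by rewrite -(extendE a) -plucker_extend /plucker l0k k0i k0j.
rewrite -Wij in al0; have [X MX [Xi Xj]] := cell_point ij skW zW al0.
have := Ip X MX; rewrite comp_mpoly_meval => pX; rewrite -[p.@[a]]/(p.@[a]).
have -> : p.@[a] = 0; last by rewrite mul0r.
rewrite -pX; apply: meval_eq => l; rewrite tnth_mktuple mevalXU.
rewrite (free_coord_rows (schubert_skew MX) skW Xi Xj (free_valP l)).
by rewrite plucker_extend extendE.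
Qed.

(** The big cell is the image of a polynomial map in the free coordinates, so
    the pullbacks of too many polynomials are dependent, and a relation between
    them holds on the closure of the cell. *)
Lemma coordinate_ring_dependent (t : d.+2.-tuple {mpoly F[N]}) : ~ alg_indep_mod I t.
Proof.
move=> indep; pose W : 'M[{mpoly F[d.+1]}]_n := of_coords (extend (fun l => 'X_l)).
pose u : 'rV_n := \row_s if s == i then 1 else if s == j then 0 else W s j.
pose v := row i W; pose Psi := wedge u v.
pose t' := [tuple of [seq f \mPo [tuple Psi (prow k) (pcol k) | k < N] | f <- t]].
have [p p0 pt'] := algebraic_dependence t'.
case/negP: p0; apply/eqP/indep/vanishing_on_cell => // X MX Xij.
have skX := schubert_skew MX; have [_ _ XE] := cell_wedge ij MX Xij.
(* Parameters of [X]: they give [u = - row j X / X i j] and [v = row i X]. *)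
pose G : 'M[F]_n :=
  \matrix_(r, s) if (r == i) || (s == i) then X r s else X r s / X i j.
have altG : alternating G.
  split=> [|r]; last by rewrite mxE skew_diag // mul0r if_same.
  by apply/matrixP => r s; rewrite !mxE orbC (skewE skX); case: ifP => _ //; rewrite mulNr.
pose a l : F := plucker G (free_val l).
have Wa r s : (r == i) || (s == j) -> (W r s).@[a] = G r s.
  move=> rs; have -> : (W r s).@[a] = of_coords (extend a) r s.
    rewrite /W /of_coords !summxE raddf_sum /=; apply: eq_bigr => k _.
    rewrite !mxE mevalM /extend raddf_sum /=; congr (_ * _); last first.
      by rewrite mevalB; congr (_ - _); case: (_ && _); rewrite ?meval1 ?meval0.
    apply: eq_bigr => l _; rewrite mevalM mevalXU.
    by case: (_ == _); rewrite ?meval1 ?meval0.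
  have skW := alternating_of_coords (extend a).
  have [rs_lt|sr_lt|/val_inj <-] := ltngtP r s; last by rewrite skW.2 altG.2.
    have [k kr ks] := coord_of rs_lt; rewrite -kr -ks of_coordsE.
    rewrite extend_restrict // => /nfreeP[zk|].
      by rewrite /plucker mxE (schubert_zeroed MX) // mul0r if_same.
    by rewrite kr ks !negb_or; case/orP: rs => ->; rewrite ?andbF.
  have [k ks kr] := coord_of sr_lt.
  rewrite (skewE skW.1) (skewE altG.1) -ks -kr of_coordsE; congr (- _).
  rewrite extend_restrict // => /nfreeP[zk|].
    by rewrite /plucker mxE (schubert_zeroed MX) // mul0r if_same.
  by rewrite kr ks !negb_or; case/orP: rs => ->; rewrite ?andbF.
have Psia r s : (Psi r s).@[a] = X r s.
  have ua x : (u 0 x).@[a] = - (X i j)^-1 * X j x.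
    rewrite mxE; case: eqP => [->|/eqP xi].
      by rewrite meval1 [X j i](skewE skX) mulrNN mulVf.
    case: eqP => [->|/eqP xj]; first by rewrite meval0 skew_diag // mulr0.
    rewrite Wa ?eqxx ?orbT // mxE (negbTE xi) (_ : j == i = false) /=.
      by rewrite (skewE skX); field.
    by apply/negbTE; rewrite neq_ltn ij orbT.
  have va x : (v 0 x).@[a] = X i x by rewrite mxE Wa ?eqxx // mxE eqxx.
  have Xrs : X r s = - (X i j)^-1 * X j r * X i s - X i r * (- (X i j)^-1 * X j s).
    by have /matrixP/(_ r s) := XE; rewrite wedgeE !mxE.
  by rewrite /Psi wedgeE mevalB !mevalM !ua !va [RHS]Xrs; ring.
rewrite comp_mpoly_meval.
have := congr1 (meval a) pt'; rewrite meval0 comp_mpoly_meval => <-.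
apply: meval_eq => l; rewrite tnth_map comp_mpoly_meval.
by apply: meval_eq => k; rewrite tnth_mktuple Psia.
Qed.

End Parametrization.

Lemma codim_schubertP : proj_codim I codim_schubert.
Proof.
have [k0 fk0 _] := corner_coord.
have [d card_free] : exists d, #|free| = d.+1.
  by exists #|free|.-1; rewrite prednK //; apply/card_gt0P; exists k0.
exists d; last by rewrite -addnS -card_free addnC card_free_coord.
split; last by move=> t; apply: (coordinate_ring_dependent card_free).
by exists [tuple 'X_(free_val card_free l) | l < d.+1]; apply: free_coords_independent.
Qed.

End Dimension.

(** * Minors of the bordered Jacobian matrix *)

Section Minors.
Variable A : comNzRingType.

(** One half of the Cauchy-Binet formula: a determinant of a product is a
    combination of the maximal minors of its left factor. *)
Lemma det_mulmx_colsub k N (P : 'M[A]_(k, N)) (Q : 'M[A]_(N, k)) :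
  \det (P *m Q) =
  \sum_(h : {ffun 'I_k -> 'I_N}) (\prod_a Q (h a) a) * \det (colsub h P).
Proof.
rewrite -[LHS]det_tr [LHS]/determinant.
under eq_bigr => s _.
  under eq_bigr => a _ do rewrite !mxE.
  rewrite bigA_distr_bigA /= mulr_sumr; over.
rewrite exchange_big; apply: eq_bigr => h _.
rewrite -det_tr /determinant mulr_sumr; apply: eq_bigr => s _.
rewrite big_split /= [RHS]mulrCA [_ * \prod_(a < k) Q _ _]mulrC.
by congr (_ * (_ * _)); apply: eq_bigr => a _; rewrite !mxE.
Qed.

Lemma det2 (P : 'M[A]_2) : \det P = P 0 0 * P 1 1 - P 0 1 * P 1 0.
Proof.
rewrite (expand_det_row _ 0) big_ord_recl big_ord1 /cofactor !det_mx11 !mxE.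
have -> : lift (0 : 'I_2) (0 : 'I_1) = 1 by apply/val_inj.
have -> : lift (1 : 'I_2) (0 : 'I_1) = 0 by apply/val_inj.
by rewrite /= addn0 expr0 expr1; ring.
Qed.

End Minors.

Section IdealDeterminants.
Variables (F : fieldType) (N : nat).
Implicit Types (I : {mpoly F[N]} -> Prop).

Lemma ideal_minors I k (rows : 'rV[{mpoly F[N]}]_N -> Prop) m
    (P : 'M_(k, m)) (Q : 'M_(m, k)) (h : 'I_m -> 'I_N) (P' : 'M_(k, N)) :
  P = colsub h P' -> is_ideal I -> (forall p, minors k rows p -> I p) ->
  (forall a, rows (row a P')) -> I (\det (P *m Q)).
Proof.
move=> -> iI mI rP; rewrite det_mulmx_colsub; apply: ideal_sum => // f _.
have [_ _ IM] := iI; apply/IM/mI; exists P', (h \o f); split=> //.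
by congr (\det _); apply/matrixP => a b; rewrite !mxE.
Qed.

Lemma ideal_det_congr I k (P Q : 'M[{mpoly F[N]}]_k) :
  is_ideal I -> (forall a b, I (P a b - Q a b)) -> I (\det P - \det Q).
Proof.
move=> iI PQ; have [I0 ID IM] := iI; rewrite /determinant -sumrB.
apply: ideal_sum => // s _; rewrite -mulrBr; apply/IM.
apply: (big_rec2 (fun x y => I (x - y))) => [|a x y _ Ixy]; first by rewrite subrr.
rewrite (_ : _ - _ = P a (s a) * (x - y) + y * (P a (s a) - Q a (s a))); last by ring.
by apply: ID; apply/IM.
Qed.

End IdealDeterminants.

Section LagrangianMembership.
Variables (F : numFieldType) (n : nat) (M : 'M[F]_n -> Prop).
Variables (G : {mpoly F[ncoord n]} -> Prop) (c : nat).
Hypothesis GM : forall f, G f -> vanishing_ideal M f.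
Local Notation N := (ncoord n).
Local Notation poly := {mpoly F[N]}.
Local Notation I := (vanishing_ideal M).

Definition tangent_field (T : 'I_N -> poly) : Prop :=
  forall f, I f -> I (\sum_k f^`M(k) * T k).

Definition pairing (R : 'rV[poly]_N) (T : 'I_N -> poly) : poly := \sum_k R 0 k * T k.

(** Bordering a [c]-minor of the Jacobian matrix by the two extra rows, and
    multiplying on the right by the tangent fields [T], [T'] and the columns
    of that minor, gives modulo [I] a block triangular matrix whose
    determinant is the product of the minor and of the [2 x 2] determinant of
    the pairings. So the latter is killed by the minors that define the
    singular locus. *)
Lemma lagrangian_pairings (Q : 'M[F]_n) (T T' : 'I_N -> poly) :
  let R1 := upper_row (@generic_skew F n *m cst_mx Q + cst_mx Q *m @generic_skew F n) in
  let R2 := upper_row (@generic_skew F n) in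
  tangent_field T -> tangent_field T' ->
  lagrangian_ideal M G c Q
    (pairing R1 T * pairing R2 T' - pairing R1 T' * pairing R2 T).
Proof.
move=> R1 R2 tT tT'; set D := _ - _; rewrite /lagrangian_ideal.
set J := ideal_add _ _; have iJ : is_ideal J by apply: ideal_gen_ideal.
have iI : is_ideal I := vanishing_ideal_ideal M.
have [J0 JD JM] := iJ.
have iDJ : is_ideal (fun h => J (D * h)).
  split=> [|f g Jf Jg|a f Jf]; first by rewrite mulr0.
    by rewrite mulrDr; apply: JD.
  by rewrite mulrCA; apply: JM.
apply: saturation_colon => // h; apply: (ideal_gen_min iDJ) => {}h [Ih|].
  by apply/JM/ideal_addl.
apply: (ideal_gen_min iDJ) => {}h [A [e [rA ->]]].
pose P : 'M[poly]_(2, N) := \matrix_(a, k) if a == 0 then R1 0 k else R2 0 k.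
pose S : 'M[poly]_(N, 2) := \matrix_(k, a) if a == 0 then T k else T' k.
pose E : 'M[poly]_(N, c) := \matrix_(k, b) (k == e b)%:R.
have AE : A *m E = colsub e A.
  apply/matrixP => a b; rewrite !mxE (bigD1 (e b)) //= mxE eqxx mulr1 big1 ?addr0 // => k kb.
  by rewrite mxE (negbTE kb) mulr0.
have DE : D = \det (P *m S).
  by rewrite det2 !mxE /D /pairing; congr (_ * _ - _ * _); apply: eq_bigr => k _; rewrite !mxE.
pose bordered : 'M[poly]_(2 + c) := col_mx P A *m row_mx S E.
have Jb : J (\det bordered).
  apply: (@ideal_minors _ _ _ _ (lagrange_rows G Q) _ _ _ id (col_mx P A)) => //.
  - by apply/matrixP => a b; rewrite !mxE.
  - by move=> p mp; apply: ideal_addr; apply: ideal_gen_sub.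
  - move=> a; case: (split_ordP a) => b ->; last by rewrite rowKd; left; apply: rA.
    rewrite rowKu; right; have [->|->] : b = 0 \/ b = 1.
      by case: b {a} => -[|[|//]] bP; [left|right]; apply/val_inj.
      by left; apply/rowP => k; rewrite !mxE.
    by right; apply/rowP => k; rewrite !mxE.
have -> : D * \det (colsub e A) = \det (block_mx (P *m S) (P *m E) 0 (A *m E)).
  by rewrite det_ublock DE AE.
have : J (\det (block_mx (P *m S) (P *m E) 0 (A *m E)) - \det bordered).
  apply: ideal_det_congr => // a b; apply: ideal_addl.
  rewrite /bordered mul_col_row.
  case: (split_ordP a) => a' ->; case: (split_ordP b) => b' ->.
  - by rewrite !block_mxEul subrr; case: iI.
  - by rewrite !block_mxEur subrr; case: iI.
  - rewrite !block_mxEdl mxE sub0r; apply: (ideal_opp iI).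
    have [f Gf fA] := rA a'.
    have -> : (A *m S) a' b' = \sum_k f^`M(k) * (if b' == 0 then T k else T' k).
      by rewrite mxE; apply: eq_bigr => k _; have /rowP/(_ k) := fA; rewrite !mxE => ->.
    by case: (b' == 0); [apply: tT | apply: tT']; apply: GM.
  - by rewrite !block_mxEdr subrr; case: iI.
by move=> JJ; rewrite -[X in J X](subrK (\det bordered)); apply: JD.
Qed.

End LagrangianMembership.

(** * The Jacobian matrix on the big cell *)

Section JacobianOnCell.
Variables (F : numFieldType) (n : nat) (i j : 'I_n).
Hypothesis ij : (i < j)%N.
Implicit Types (X T Z W : 'M[F]_n) (f : {mpoly F[ncoord n]}).

Local Notation M := (@schubert F n i j).
Local Notation I := (vanishing_ideal M).
Local Notation N := (ncoord n).
Local Notation free := (@free_coord n i j).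
Local Notation codim := (@codim_schubert n i j).

Definition tangent_to X T : Prop :=
  skew T /\ exists Z, forall s, schubert_cone i j (X + s *: T + s ^+ 2 *: Z).

Lemma tangent_dir X T f : M X -> tangent_to X T -> I f -> dir X T f = 0.
Proof.
move=> MX [_ [Z cZ]] If; apply: (curve_tangent _ cZ If).
by have [] := (schubertP i j X).1 MX.
Qed.

Lemma zeroed_coord_vanishes k : zeroed i j (prow k) (pcol k) -> I 'X_k.
Proof. by move=> zk X MX; rewrite mevalXU /plucker (schubert_zeroed MX). Qed.

(** The tangent spaces contain a vector with any prescribed free coordinates,
    so the pairing of the rows with them has rank at most one only if the
    rows span a space of dimension at most [codim + 1]. *)
Lemma bordered_minors_vanish X (rows : 'rV[{mpoly F[N]}]_N -> Prop) (r0 : 'I_N -> F) :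
  M X -> X i j != 0 ->
  (forall R, rows R -> exists b, forall T, tangent_to X T ->
     \sum_k (R 0 k).@[plucker X] * plucker T k = b * \sum_k r0 k * plucker T k) ->
  forall p, minors codim.+2 rows p -> p.@[plucker X] = 0.
Proof.
move=> MX Xij rowsP p [A [h [rA ->]]].
have skX := schubert_skew MX.
have BP (l : 'I_#|free|) : exists T, tangent_to X T /\
    forall k, free k -> plucker T k = (k == enum_val l :> 'I_N)%:R.
  pose W : 'M[F]_n := of_coords (fun k => (free k && (k == enum_val l))%:R).
  have skW : skew W by case: (@alternating_of_coords n F (fun k => (free k && (k == enum_val l))%:R)).
  have Wk k : plucker W k = (free k && (k == enum_val l))%:R by apply: of_coordsE.
  have zW : in_support i j W.
    by apply: in_support_coords => // k zk; rewrite Wk /free_coord zk.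
  have [T [Z [skT cT Ti Tj]]] := cell_tangent ij MX Xij skW zW.
  exists T; split; first by split=> //; exists Z.
  by move=> k fk; rewrite (free_coord_rows skT skW Ti Tj fk) Wk fk.
have [B BT] := choice BP.
pose MB : 'M[F]_(N, #|free|) := \matrix_(k, l) plucker (B l) k.
pose EA : 'M[F]_(codim.+2, N) := map_mx (meval (plucker X)) A.
have [b bP] := choice (fun a => rowsP _ (rA a)).
have rkAB : (\rank (EA *m MB) <= 1)%N.
  have -> : EA *m MB = (\col_a b a) *m (\row_l \sum_k r0 k * plucker (B l) k).
    apply/matrixP => a l; rewrite !mxE big_ord1 !mxE -bP; last exact: (BT l).1.
    by apply: eq_bigr => k _; rewrite !mxE.
  by apply: leq_trans (mxrankM_maxr _ _) _; apply: rank_leq_row.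
have rkB : \rank MB = #|free|.
  apply/eqP; rewrite eqn_leq rank_leq_col /= -[X in (X <= _)%N](mxrank1 F).
  have -> : 1%:M = rowsub (fun l => enum_val l) MB.
    apply/matrixP => l l'; rewrite !mxE (BT l').2; last exact: enum_valP l.
    by rewrite (inj_eq enum_val_inj).
  exact/mxrankS/rowsub_sub.
have rkA : (\rank EA <= codim.+1)%N.
  have := mxrank_mul_min EA MB; rewrite rkB.
  by have := card_free_coord i j; move: rkAB; set x := \rank _; set y := \rank _; set z := #|_|; lia.
rewrite -det_map_mx map_mxsub -/EA; apply/eqP; apply: contraLR rkA.
rewrite -unitfE -unitmxE -row_free_unit -ltnNge => /eqP rk.
apply: leq_trans (_ : (\rank (colsub h EA) <= _)%N); first by rewrite rk.
have -> : colsub h EA = EA *m colsub h 1%:M by rewrite mulmx_colsub mulmx1.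
exact: mxrankM_maxl.
Qed.

(** Differentiating the Plucker relation
    [x_ij x_rs = x_ir x_js - x_is x_jr] at [X] along a direction whose rows [i]
    and [j] vanish leaves only [X i j * W r s = 0]. *)
Lemma tangent_kernel_free X W : M X -> X i j != 0 -> skew W ->
  (forall f, I f -> dir X W f = 0) -> (forall k, free k -> plucker W k = 0) -> W = 0.
Proof.
move=> MX Xij skW Wf Wfree; have skX := schubert_skew MX.
have W0 : alternating (0 : 'M[F]_n).
  by split=> [|r]; rewrite ?mxE // trmx0 oppr0.
have upper (r s : 'I_n) : (r < s)%N -> [|| r == i, r == j, s == i | s == j] -> W r s = 0.
  case/coord_of => k <- <- meets; rewrite -[W _ _]/(plucker W k).
  have [zk|nzk] := boolP (zeroed i j (prow k) (pcol k)).
    by rewrite -(dirX X) Wf //; apply: zeroed_coord_vanishes.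
  by apply: Wfree; rewrite /free_coord nzk.
have rowij r s : [|| r == i, r == j, s == i | s == j] -> W r s = 0.
  have [rs|sr|/val_inj ->] := ltngtP r s; [exact: upper | | by rewrite skew_diag].
  move=> meets; rewrite (skewE skW) upper ?oppr0 //.
  by move: meets; do 4 case: (_ == _).
apply: (alternating_ext (alternating_skew skW) W0) => k; rewrite [RHS]mxE.
set r := prow k; set s := pcol k.
pose f := @generic_skew F n i j * @generic_skew F n r s -
  (@generic_skew F n i r * @generic_skew F n j s -
   @generic_skew F n i s * @generic_skew F n j r).
have If : I f.
  move=> X' MX'; have skX' := schubert_skew MX'; rewrite !mevalB !mevalM !ev_entry //.
  by rewrite (gr2_plucker i j r s MX'.1) subrr.
have /eqP := Wf _ If; rewrite !dirB !dirM !dir_generic // !ev_entry //.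
rewrite ![W i _]rowij ?[W j _]rowij ?eqxx ?orbT //.
by rewrite !(mul0r, mulr0, add0r, oppr0, addr0) mulf_eq0 (negbTE Xij) => /eqP.
Qed.

(** As long as fewer than [codim] gradients have been chosen, some nonzero
    direction is killed by all of them and has no free coordinate; it is not
    tangent, so the gradient of one more generator detects it. *)
Lemma independent_gradients X (G : {mpoly F[N]} -> Prop) :
  M X -> X i j != 0 -> (forall f, I f -> ideal_gen G f) -> (forall f, G f -> I f) ->
  forall r, (r <= codim)%N -> exists A : 'I_r -> {mpoly F[N]},
    (forall a, G (A a)) /\
    row_free (\matrix_(a, k) ((A a)^`M(k)).@[plucker X] : 'M[F]_(r, N)).
Proof.
move=> MX Xij IG GI; elim=> [_|r IHr ltr].
  exists (fun a => 0); split; first by case.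
  by rewrite /row_free -leqn0 rank_leq_row.
have [A [GA frA]] := IHr (ltnW ltr).
set JA := (\matrix_(a, k) _) in frA.
pose Sel : 'M[F]_(N, #|free|) := \matrix_(k, l) (k == enum_val l)%:R.
have [|w w0] := @exists_left_kernel _ _ _ (row_mx JA^T Sel).
  by have := card_free_coord i j; lia.
rewrite mul_mx_row -[0]row_mx0 => /eq_row_mx[wJ wS].
pose W : 'M[F]_n := of_coords (w 0).
have skW : skew W by case: (alternating_of_coords (w 0)).
have Ww k : plucker W k = w 0 k by apply: of_coordsE.
have [g Gg dg] : exists2 g, G g & dir X W g != 0.
  apply: contrapT => ng; case/eqP: w0.
  have W0 : W = 0.
    apply: (tangent_kernel_free MX Xij skW) => [f If|k fk].
      have [m [a [b [Gb ->]]]] := IG f If; rewrite dir_sum big1 // => x _.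
      rewrite dirM (GI _ (Gb x)) // mulr0 add0r.
      suff -> : dir X W (b x) = 0 by rewrite mulr0.
      by apply/eqP/negPn/negP => db; apply: ng; exists (b x).
    have /rowP/(_ (enum_rank_in (fk : k \in free) k)) := wS; rewrite !mxE.
    rewrite (bigD1 k) //= mxE enum_rankK_in // eqxx mulr1 Ww big1 ?addr0 // => l lk.
    by rewrite mxE enum_rankK_in // (negbTE lk) mulr0.
  by apply/rowP => k; rewrite -Ww W0 /plucker !mxE.
exists (fun a => if unlift ord0 a is Some b then A b else g); split.
  by move=> a; case: unliftP.
apply: inj_row_free => v /rowP vJ.
have vk k : v 0 0 * (g^`M(k)).@[plucker X] + \sum_b v 0 (lift ord0 b) * JA b k = 0.
  have := vJ k; rewrite !mxE big_ord_recl !mxE unlift_none; apply: etrans.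
  by congr (_ + _); apply: eq_bigr => b _; rewrite !mxE liftK.
have v0 : v 0 0 = 0.
  have : \sum_k (v 0 0 * (g^`M(k)).@[plucker X] + \sum_b v 0 (lift ord0 b) * JA b k) * w 0 k = 0.
    by rewrite big1 // => k _; rewrite vk mul0r.
  under eq_bigr => k _ do rewrite mulrDl -mulrA.
  rewrite big_split /= -mulr_sumr [X in _ + X](_ : _ = 0) ?addr0.
    move/eqP; rewrite mulf_eq0 => /orP[/eqP//|/eqP d0]; case/eqP: dg.
    by rewrite -[RHS]d0 /dir; apply: eq_bigr => k _; rewrite Ww.
  under eq_bigr => k _ do rewrite mulr_suml.
  rewrite exchange_big big1 // => b _ /=.
  under eq_bigr => k _ do rewrite -mulrA.
  rewrite -mulr_sumr; have /rowP/(_ b) := wJ; rewrite !mxE => wJb.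
  have -> : \sum_k JA b k * w 0 k = 0; last by rewrite mulr0.
  by rewrite -[RHS]wJb; apply: eq_bigr => k _; rewrite !mxE mulrC.
have /(row_free_inj frA)/rowP vb : (\row_b v 0 (lift ord0 b)) *m JA = 0 *m JA.
  rewrite mul0mx; apply/rowP => k; rewrite !mxE -[RHS](vk k) v0 mul0r add0r.
  by apply: eq_bigr => b _; rewrite mxE.
apply/rowP => a; rewrite mxE; case: (unliftP ord0 a) => [b|] ->.
  by have := vb b; rewrite !mxE.
exact: v0.
Qed.

(** A row-free matrix has a nonzero maximal minor, so the singular ideal does
    not vanish on the big cell. *)
Lemma smooth_on_cell X (G : {mpoly F[N]} -> Prop) :
  M X -> X i j != 0 -> (forall f, I f -> ideal_gen G f) -> (forall f, G f -> I f) ->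
  exists2 p, minors codim (jacobian_rows G) p & p.@[plucker X] != 0.
Proof.
move=> MX Xij IG GI.
have [A [GA frA]] := independent_gradients MX Xij IG GI (leqnn _).
set JA := (\matrix_(a, k) _) in frA.
have full : row_full JA^T by rewrite /row_full mxrank_tr.
pose h := fullrankfun full.
pose P : 'M[{mpoly F[N]}]_(codim, N) := \matrix_(a, k) (A a)^`M(k).
exists (\det (colsub h P)).
  exists P, h; split=> // a; exists (A a) => //.
  by apply/rowP => k; rewrite !mxE.
have := fullrowsub_unit full; rewrite -/h unitmxE unitfE -det_tr.
rewrite -det_map_mx; apply: contraNneq => <-; apply/eqP; congr (\det _).
by apply/matrixP => a b; rewrite !mxE.
Qed.

End JacobianOnCell.

(** * Zeros of the critical ideal *)

Section CriticalIdeal.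
Variables (F : numFieldType) (n : nat) (i j : 'I_n).
Hypothesis ij : (i < j)%N.
Implicit Types (X T Z W Y Q : 'M[F]_n) (f : {mpoly F[ncoord n]}).

Local Notation N := (ncoord n).
Local Notation poly := {mpoly F[N]}.
Local Notation M := (@schubert F n i j).
Local Notation I := (vanishing_ideal M).
Local Notation codim := (@codim_schubert n i j).
Local Notation gen := (@generic_skew F n).

Variable G : poly -> Prop.
Hypothesis genG : ideal_gen G = I.

Let IG f : I f -> ideal_gen G f.
Proof. by rewrite genG. Qed.

Let GI f : G f -> I f.
Proof. by move=> Gf; rewrite -genG; apply: ideal_gen_sub. Qed.

Lemma ev_upper_row X (P : 'M[poly]_n) k :
  (upper_row P 0 k).@[plucker X] = ev X P (prow k) (pcol k).
Proof. by rewrite !mxE. Qed.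

Lemma ev_commutant X Q : skew X ->
  ev X (gen *m cst_mx Q + cst_mx Q *m gen) = X *m Q + Q *m X.
Proof. by move=> skX; rewrite evD !evM ev_generic // ev_cst. Qed.

Lemma lagrangian_is_ideal Q : is_ideal (lagrangian_ideal M G codim Q).
Proof. by apply/saturation_ideal/ideal_gen_ideal. Qed.

Lemma vanishing_sub_lagrangian Q f : I f -> lagrangian_ideal M G codim Q f.
Proof.
by move=> If; apply: saturation_sub; [apply: ideal_gen_ideal | apply: ideal_addl].
Qed.

(** A point of the cell is a smooth point of [M], so that the saturation by the
    singular ideal keeps it; and at an eigenvector the two extra rows are
    proportional on the tangent space, which makes the bordered minors vanish. *)
Lemma lagrangian_zero X Q la : M X -> X i j != 0 ->
  (forall k, ~~ zeroed i j (prow k) (pcol k) ->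
     plucker (X *m Q + Q *m X) k = la * plucker X k) ->
  forall f, lagrangian_ideal M G codim Q f -> f.@[plucker X] = 0.
Proof.
move=> MX Xij XQ f; have skX := schubert_skew MX.
have [p mp pX] := smooth_on_cell ij MX Xij IG GI.
have iX : is_ideal (fun f : poly => f.@[plucker X] = 0).
  split=> [|g h gX hX|a g gX]; first exact: meval0.
    by rewrite mevalD gX hX addr0.
  by rewrite mevalM gX mulr0.
apply: saturation_zero pX _; first by apply: ideal_addr; apply: ideal_gen_sub.
move=> h; apply: (ideal_gen_min iX) => {}h [/(_ X MX)//|].
apply: (ideal_gen_min iX); apply: (bordered_minors_vanish ij (r0 := plucker X) MX Xij).
move=> R [[g Gg <-]|[->|->]].
- exists 0 => T tT; rewrite mul0r -[RHS](tangent_dir MX tT (GI Gg)).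
  by apply: eq_bigr => k _; rewrite mxE.
- exists la => T tT; rewrite mulr_sumr; apply: eq_bigr => k _.
  have [zk|nzk] := boolP (zeroed i j (prow k) (pcol k)).
    rewrite -(dirX X) (tangent_dir MX tT) ?mulr0 //.
    exact: zeroed_coord_vanishes.
  by rewrite ev_upper_row ev_commutant // -[_ (prow k) _]/(plucker _ k) XQ // mulrA.
- exists 1 => T tT; rewrite mul1r; apply: eq_bigr => k _.
  by rewrite ev_upper_row ev_generic.
Qed.

Lemma critical_zero X Y la : M X -> X i j != 0 ->
  (forall k, ~~ zeroed i j (prow k) (pcol k) ->
     plucker (X *m proj_of Y + proj_of Y *m X) k = la * plucker X k) ->
  \tr (X *m Y) != 0 -> \tr (X *m X) != 0 ->
  zero_locus (GD_critical_ideal M G codim Y) X.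
Proof.
move=> MX Xij XQ XY XX; have skX := schubert_skew MX.
have [X0 _] := (schubertP i j X).1 MX; split=> // f.
have LX := lagrangian_zero MX Xij XQ.
have sat_zero g : saturation (lagrangian_ideal M G codim (proj_of Y))
    (ideal_gen (fun x => x = trXY Y)) g -> g.@[plucker X] = 0.
  apply: (saturation_zero (h := trXY Y)) => //; first exact: ideal_gen_sub.
  by rewrite ev_trXY.
rewrite /GD_critical_ideal; case: ifP => _; first exact: sat_zero.
apply: (saturation_zero (h := @trX2 F n)) sat_zero; first exact: ideal_gen_sub.
by rewrite ev_trX2.
Qed.

Lemma in_critical_ideal Y f a :
  lagrangian_ideal M G codim (proj_of Y) (f * trXY Y ^+ a) ->
  GD_critical_ideal M G codim Y f.
Proof.
have iL := lagrangian_is_ideal (proj_of Y).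
move=> Lf; have Sf := saturation_principal iL Lf.
rewrite /GD_critical_ideal; case: ifP => _ //.
by apply: saturation_sub => //; apply: saturation_ideal.
Qed.

Lemma in_critical_ideal_nontransverse Y f a b :
  ~ transverse_to_quadric M G codim ->
  lagrangian_ideal M G codim (proj_of Y) (f * (trXY Y ^+ a * @trX2 F n ^+ b)) ->
  GD_critical_ideal M G codim Y f.
Proof.
move=> nT Lf; rewrite /GD_critical_ideal; case: asboolP => // _.
have iL := lagrangian_is_ideal (proj_of Y).
apply: (@saturation_principal _ _ _ _ b); first exact: saturation_ideal.
by apply: (@saturation_principal _ _ _ _ a) => //; rewrite -mulrA [_ ^+ b * _]mulrC.
Qed.

Lemma critical_zero_support Y X :
  zero_locus (GD_critical_ideal M G codim Y) X -> in_support i j X.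
Proof.
move=> [skX _ KX]; apply: in_support_coords => // k zk.
rewrite -[plucker X k](mevalXU (plucker X)); apply/KX/(@in_critical_ideal _ _ 0).
by rewrite expr0 mulr1; apply/vanishing_sub_lagrangian/zeroed_coord_vanishes.
Qed.

(** When [M] is the projective space of all skew matrices with the given
    support, its tangent spaces are constant and contain the candidate point
    [Y']. Pairing with [Y'] turns the Lagrangian minors into [tr (X Y)] times
    the linear equations of an eigenvector problem. *)
Lemma linear_critical_equations Y Y' la :
  (forall X, skew X -> in_support i j X -> schubert_cone i j X) ->
  skew Y -> skew Y' -> in_support i j Y' ->
  (forall k, ~~ zeroed i j (prow k) (pcol k) -> plucker Y' k = plucker Y k) ->
  (forall k, ~~ zeroed i j (prow k) (pcol k) ->
     plucker (Y' *m proj_of Y + proj_of Y *m Y') k = la * plucker Y' k) ->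
  forall X, zero_locus (GD_critical_ideal M G codim Y) X ->
  forall k, ~~ zeroed i j (prow k) (pcol k) ->
     plucker (X *m proj_of Y + proj_of Y *m X) k = la * plucker X k.
Proof.
move=> lin skY skY' zY' Y'Y eigY' X KX k nzk; have [skX _ KX0] := KX.
set Q := proj_of Y.
pose R1 := upper_row (gen *m cst_mx Q + cst_mx Q *m gen); pose R2 := upper_row gen.
suff : GD_critical_ideal M G codim Y (R1 0 k - la *: R2 0 k).
  move/KX0; rewrite mevalB mevalZ !ev_upper_row ev_commutant // ev_generic //.
  by move/eqP; rewrite subr_eq0 => /eqP.
have tangent_const W : skew W -> in_support i j W ->
    tangent_field M (fun l => (plucker W l)%:MP).
  move=> skW zW f If X' MX'; have skX' := schubert_skew MX'.
  rewrite raddf_sum /= -[RHS](@tangent_dir _ _ i j X' W f MX' _ If).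
    by apply: eq_bigr => l _; rewrite mevalM mevalC.
  split=> //; exists 0 => s; rewrite scaler0 addr0; apply: lin.
    by apply/matrixP => a b; rewrite !mxE (skewE skX') (skewE skW); ring.
  by move=> a b zab; rewrite !mxE (schubert_zeroed MX') // zW // mulr0 addr0.
pose W := of_coords (fun l => (l == k)%:R : F).
have skW : skew W by case: (alternating_of_coords (fun l => (l == k)%:R : F)).
have Wl l : plucker W l = (l == k)%:R by apply: of_coordsE.
have zW : in_support i j W.
  apply: in_support_coords => // l zl; rewrite Wl.
  by case: eqP zl => // ->; rewrite (negbTE nzk).
have LD := lagrangian_pairings codim GI Q (tangent_const W skW zW) (tangent_const Y' skY' zY').
have pairW R : pairing R (fun l => (plucker W l)%:MP) = R 0 k.
  rewrite /pairing (bigD1 k) //= Wl eqxx mpolyC1 mulr1 big1 ?addr0 // => l lk.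
  by rewrite Wl (negbTE lk) mpolyC0 mulr0.
have iL := lagrangian_is_ideal Q; have [L0 LD' LM] := iL.
apply: (@in_critical_ideal _ _ 1); rewrite expr1 -/Q.
move/(ideal_scale (-2) iL): (LD); rewrite !pairW -/R1 -/R2 => LD2.
rewrite -[X in lagrangian_ideal _ _ _ _ X](subrK (-2 *: (R1 0 k * pairing R2 (fun l => (plucker Y' l)%:MP) -
   pairing R1 (fun l => (plucker Y' l)%:MP) * R2 0 k))).
apply: LD' => //; apply: vanishing_sub_lagrangian => X' MX'.
have skX' := schubert_skew MX'; have zX' l := @schubert_zeroed _ _ i j X' (prow l) (pcol l) MX'.
have evpair P : (pairing (upper_row P) (fun l => (plucker Y' l)%:MP)).@[plucker X'] =
    \sum_l plucker (ev X' P) l * plucker Y' l.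
  by rewrite /pairing raddf_sum; apply: eq_bigr => l _; rewrite /= mevalM mevalC ev_upper_row.
have trXY' : \tr (X' *m Y) = - 2 * \sum_l plucker X' l * plucker Y' l.
  rewrite trace_alternating; try exact: alternating_skew.
  congr (_ * _); apply: eq_bigr => l _; rewrite -[X' _ _]/(plucker X' l).
  have [zl|nzl] := boolP (zeroed i j (prow l) (pcol l)).
    by rewrite /plucker zX' // !mul0r.
  by rewrite Y'Y.
have symQ : Q^T = Q.
  by rewrite /Q /proj_of linearZ /= trmx_mul skY mulNmx mulmxN opprK.
have R1Y' : -2 * (\sum_l plucker (X' *m Q + Q *m X') l * plucker Y' l) = la * \tr (X' *m Y).
  have skQ A : skew A -> skew (A *m Q + Q *m A).
    by move=> skA; rewrite /skew linearD /= !trmx_mul symQ skA mulNmx mulmxN -opprD addrC.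
  rewrite -trace_alternating; try exact/alternating_skew/skQ; try exact: alternating_skew.
  rewrite mulmxDl mxtraceD -!mulmxA [\tr (Q *m _)]mxtrace_mulC -mulmxA -mxtraceD -mulmxDr.
  rewrite addrC trace_alternating; try exact/alternating_skew/skQ; try exact: alternating_skew.
  rewrite trXY' [RHS]mulrCA; congr (_ * _); rewrite mulr_sumr; apply: eq_bigr => l _.
  rewrite -[X' _ _]/(plucker X' l).
  have [zl|nzl] := boolP (zeroed i j (prow l) (pcol l)).
    by rewrite /plucker zX' // !(mul0r, mulr0).
  by rewrite -[fun_of_matrix (_ + _) _ _]/(plucker _ l) eigY' // mulrCA.
rewrite mevalB mevalZ !mevalB !mevalM mevalB mevalZ !evpair ev_trXY // ev_commutant // ev_generic //.
rewrite mulrBr [-2 * (_ * _)]mulrCA -trXY' [-2 * (_ * _)]mulrA R1Y'.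
by rewrite mulrBl; ring.
Qed.

End CriticalIdeal.

(** * Compressions of the projection to a plane *)

Section RankTwoIdentities.
Variables (F : numFieldType) (n : nat).
Implicit Types (X Y A S : 'M[F]_n).

(** The Plucker relations contracted with a skew matrix. *)
Lemma gr2_sandwich X A : gr2 X -> skew A ->
  X *m A *m X = (2^-1 * \tr (X *m A)) *: X.
Proof.
move=> gX skA; have [skX _] := gX; apply/matrixP => r s.
have two0 : 2 != 0 :> F by rewrite pnatr_eq0.
apply: (mulfI two0); rewrite [in RHS]mxE mulrA mulVKf //.
have XAX : (X *m A *m X) r s = \sum_a \sum_b X r a * A a b * X b s.
  rewrite mxE exchange_big /=; apply: eq_bigr => b _.
  by rewrite mxE mulr_suml.
have XAX' : (X *m A *m X) r s = - \sum_a \sum_b X r b * A a b * X a s.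
  rewrite XAX exchange_big /= -sumrN; apply: eq_bigr => b _; rewrite -sumrN.
  by apply: eq_bigr => a _; rewrite [A a b](skewE skA) mulrN mulNr.
have -> : \tr (X *m A) * X r s = - \sum_a \sum_b A a b * (X a b * X r s).
  rewrite /mxtrace mulr_suml -sumrN; apply: eq_bigr => a _.
  rewrite mxE mulr_suml -sumrN; apply: eq_bigr => b _.
  by rewrite [A b a](skewE skA); ring.
rewrite mulr_natl mulr2n {1}XAX XAX' -!sumrN -big_split; apply: eq_bigr => a _.
rewrite -!sumrN -big_split; apply: eq_bigr => b _ /=.
by rewrite (gr2_plucker a b r s gX) [X r a](skewE skX) [X r b](skewE skX); ring.
Qed.

Lemma gr2_cube X : gr2 X -> X *m X *m X = (2^-1 * \tr (X *m X)) *: X.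
Proof. by move=> gX; apply: gr2_sandwich => //; case: gX. Qed.

Lemma proj_of_sym Y : skew Y -> (proj_of Y)^T = proj_of Y.
Proof. by move=> skY; rewrite /proj_of linearZ /= trmx_mul skY mulNmx mulmxN opprK. Qed.

Lemma proj_of_mulr Y : gr2 Y -> \tr (Y *m Y) != 0 -> Y *m proj_of Y = Y.
Proof.
move=> gY Y0; rewrite /proj_of -scalemxAr mulmxA gr2_cube // scalerA.
by rewrite [X in X *: _](_ : _ = 1) ?scale1r //; field.
Qed.

Lemma proj_of_mull Y : gr2 Y -> \tr (Y *m Y) != 0 -> proj_of Y *m Y = Y.
Proof.
move=> gY Y0; rewrite /proj_of -scalemxAl gr2_cube // scalerA.
by rewrite [X in X *: _](_ : _ = 1) ?scale1r //; field.
Qed.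

Lemma proj_of_idem Y : gr2 Y -> \tr (Y *m Y) != 0 -> proj_of Y *m proj_of Y = proj_of Y.
Proof.
by move=> gY Y0; rewrite {1}/proj_of -scalemxAl -mulmxA proj_of_mulr.
Qed.

End RankTwoIdentities.

Section Compression.
Variables (F : numFieldType) (n : nat) (Y S : 'M[F]_n).
Hypotheses (gY : gr2 Y) (Y0 : \tr (Y *m Y) != 0).
Hypotheses (symS : S^T = S) (idS : S *m S = S).
Local Notation Q := (S *m proj_of Y *m S).
Local Notation Y' := (S *m Y *m S).
Implicit Type X : 'M[F]_n.

Let skY : skew Y. Proof. by case: gY. Qed.

(** In what follows [S] is a coordinate projection, [Q] and [Y'] are the
    compressions of the projection of [Y] and of [Y]. Every identity comes from
    [gr2_sandwich], that is, from collapsing [Y A Y] for a skew matrix [A]. *)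
Lemma trace_rot (A B C : 'M[F]_n) : \tr (A *m B *m C) = \tr (C *m A *m B) :> F.
Proof. by rewrite mxtrace_mulC mulmxA. Qed.

Lemma compress_trE : \tr (S *m Y *m Y *m S) = \tr (Y *m Y *m S).
Proof. by rewrite trace_rot !mulmxA idS -mulmxA mxtrace_mulC. Qed.

Lemma compress_skew X : skew X -> skew (S *m X *m S).
Proof. by move=> skX; rewrite /skew !trmx_mul symS skX mulNmx mulmxN mulmxA. Qed.

Lemma compress_sym X : X^T = X -> (S *m X *m S)^T = S *m X *m S.
Proof. by move=> symX; rewrite !trmx_mul symS symX mulmxA. Qed.

Lemma compress_projE : Q = (2 / \tr (Y *m Y)) *: (S *m Y *m Y *m S).
Proof. by rewrite /proj_of -scalemxAr -scalemxAl !mulmxA. Qed.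

Lemma compress_tr X : \tr (X *m Y') = \tr (S *m X *m S *m Y).
Proof. by rewrite mulmxA mxtrace_mulC !mulmxA. Qed.

Lemma compress_conj X : skew X -> Q *m X *m Q = (\tr (X *m Y') / \tr (Y *m Y)) *: Y'.
Proof.
move=> skX; rewrite compress_projE -!scalemxAl -!scalemxAr scalerA.
have -> : S *m Y *m Y *m S *m X *m (S *m Y *m Y *m S) =
    S *m Y *m (Y *m (S *m X *m S) *m Y) *m Y *m S by rewrite !mulmxA.
rewrite (gr2_sandwich gY (compress_skew skX)) -!scalemxAr -!scalemxAl scalerA.
have -> : S *m Y *m Y *m Y *m S = S *m (Y *m Y *m Y) *m S by rewrite !mulmxA.
rewrite gr2_cube // -scalemxAr -scalemxAl scalerA compress_tr [\tr (Y *m (S *m _ *m S))]mxtrace_mulC.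
by congr (_ *: _); field.
Qed.

Lemma compress_eigen : Q *m Y' + Y' *m Q = \tr Q *: Y'.
Proof.
rewrite compress_projE -scalemxAl -[Y' *m _]scalemxAr -scalerDr mxtraceZ.
have -> : S *m Y *m Y *m S *m Y' + Y' *m (S *m Y *m Y *m S) =
    S *m (Y *m (Y *m S + S *m Y) *m Y) *m S.
  by rewrite !(mulmxDr, mulmxDl) !mulmxA -![_ *m S *m S]mulmxA idS.
have skA : skew (Y *m S + S *m Y).
  by rewrite /skew linearD /= !trmx_mul symS skY mulmxN mulNmx -opprD addrC.
rewrite (gr2_sandwich gY skA) -scalemxAr -scalemxAl scalerA; congr (_ *: _).
rewrite compress_trE mulmxDr mxtraceD !mulmxA [\tr (Y *m S *m Y)]trace_rot.
by field.
Qed.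

(** The Cayley-Hamilton identity of the compressed projection, whose two
    nonzero eigenvalues have sum [\tr Q] and product
    [\tr (Y' ^2) / \tr (Y ^2)]. *)
Lemma compress_cayley_hamilton :
  Q *m Q *m Q - \tr Q *: (Q *m Q) + (\tr (Y' *m Y') / \tr (Y *m Y)) *: Q = 0.
Proof.
set t := \tr Q; set tau := \tr (Y' *m Y'); set th := \tr (Y *m Y).
pose t0 := \tr (Y *m Y *m S).
have tE : t = 2 / th * t0.
  by rewrite /t compress_projE mxtraceZ compress_trE.
have skA : skew (Y *m S + S *m Y).
  by rewrite /skew linearD /= !trmx_mul symS skY mulmxN mulNmx -opprD addrC.
have E1 : Y *m Y *m S *m Y + Y *m S *m Y *m Y = t0 *: Y.
  have := gr2_sandwich gY skA; rewrite mulmxDr mulmxDl !mulmxA => ->.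
  rewrite mxtraceD -/t0 [X in _ + X](_ : _ = t0); first by congr (_ *: _); field.
  by rewrite trace_rot.
have E2 : Y *m S *m Y *m S *m Y = (2^-1 * tau) *: Y.
  have := gr2_sandwich gY (compress_skew skY); rewrite !mulmxA => ->.
  by rewrite /tau compress_tr !mulmxA -[S *m S *m _ *m _]mulmxA idS mxtrace_mulC !mulmxA
     -![_ *m S *m S]mulmxA idS.
pose U := Y *m S *m Y; pose V := Y *m Y.
have E3 : V *m S *m V = t0 *: V - (2^-1 * th) *: U.
  have := congr1 (mulmx^~ Y) E1; rewrite mulmxDl -scalemxAl => <-.
  rewrite [(_ * th) *: U](_ : _ = Y *m S *m Y *m Y *m Y) ?addrK /V ?mulmxA //.
  by rewrite /U -[RHS]mulmxA -[RHS]mulmxA [Y *m (Y *m Y)]mulmxA gr2_cube // -scalemxAr.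
have E4 : U *m S *m V = (2^-1 * tau) *: V.
  by have := congr1 (mulmx^~ Y) E2; rewrite -scalemxAl /U /V !mulmxA.
have E5 : V *m S *m V *m S *m V = t0 *: (V *m S *m V) - (2^-1 * th * (2^-1 * tau)) *: V.
  by rewrite E3 !mulmxBl -!scalemxAl E4 scalerA E3.
have QE : Q = (2 / th) *: (S *m V *m S) by rewrite compress_projE /V mulmxA.
have SS A : A *m S *m S = A *m S by rewrite -mulmxA idS.
have Q2 : Q *m Q = (2 / th) ^+ 2 *: (S *m (V *m S *m V) *m S).
  by rewrite QE -scalemxAl -scalemxAr scalerA !mulmxA SS.
have Q3 : Q *m Q *m Q = (2 / th) ^+ 3 *: (S *m (V *m S *m V *m S *m V) *m S).
  by rewrite Q2 {1}QE -scalemxAl -scalemxAr scalerA -exprSr !mulmxA SS.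
rewrite Q3 Q2 E5 {1}QE; set A := V *m S *m V.
rewrite mulmxBr mulmxBl -!(scalemxAr, scalemxAl) tE.
move: (S *m A *m S) (S *m V *m S) => P1 P2.
by apply/matrixP => a b; rewrite !mxE; field.
Qed.

(** Multiplying the eigenvector equation by [Q] twice and inserting
    [compress_conj] and Cayley-Hamilton leaves a relation between [Q X] and
    [Q Y']; adding its transpose gives back the eigenvalue on both sides. *)
Lemma compress_eigen_uniq X : skew X -> \tr Q != 0 -> \tr (Y' *m Y') != 0 ->
  Q *m X + X *m Q = \tr Q *: X -> X = (\tr (X *m Y') / \tr (Y' *m Y')) *: Y'.
Proof.
move=> skX t0 tau0 eig; set t := \tr Q in t0 eig.
set tau := \tr (Y' *m Y') in tau0 *; set g := \tr (X *m Y').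
pose th := \tr (Y *m Y).
have conj := compress_conj skX; rewrite -/g -/th in conj.
have QX : tau *: (Q *m X) = g *: (Q *m Y').
  have H1 : Q *m (Q *m X) + (g / th) *: Y' = t *: (Q *m X).
    by have := congr1 (mulmx Q) eig; rewrite mulmxDr -[Q *m (t *: X)]scalemxAr [Q *m (X *m Q)]mulmxA conj.
  have H : Q *m (Q *m (Q *m X)) + (g / th) *: (Q *m Y') = t *: (Q *m (Q *m X)).
    by have := congr1 (mulmx Q) H1; rewrite mulmxDr -[Q *m (t *: _)]scalemxAr -[Q *m ((g / th) *: _)]scalemxAr.
  have CH : Q *m (Q *m (Q *m X)) - t *: (Q *m (Q *m X)) + (tau / th) *: (Q *m X) = 0.
    have := congr1 (mulmx^~ X) compress_cayley_hamilton.
    by rewrite mul0mx mulmxDl mulmxBl -[(t *: _) *m _]scalemxAl -[((tau / th) *: _) *m _]scalemxAl -!(mulmxA Q).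
  rewrite -H opprD addNKr addrC in CH.
  have /(congr1 (fun A => th *: A)) : (tau / th) *: (Q *m X) = (g / th) *: (Q *m Y').
    by apply/eqP; rewrite -subr_eq0 CH.
  by rewrite !scalerA mulrCA mulfV // mulr1 mulrCA mulfV // mulr1.
have XQ : tau *: (X *m Q) = g *: (Y' *m Q).
  have trQ A : skew A -> (Q *m A)^T = - (A *m Q).
    by move=> skA; rewrite trmx_mul (compress_sym (proj_of_sym skY)) skA mulNmx.
  have := congr1 trmx QX; rewrite [(tau *: _)^T]linearZ [(g *: _)^T]linearZ /=.
  by rewrite (trQ _ skX) (trQ _ (compress_skew skY)) !scalerN => /oppr_inj.
have : tau *: (t *: X) = g *: (t *: Y').
  by rewrite -eig -compress_eigen !scalerDr QX XQ.
rewrite !scalerA ![_ * t]mulrC -!scalerA => /(scalerI t0) E.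
by rewrite scalerA mulrC -scalerA -E scalerA mulVf // scale1r.
Qed.

End Compression.

(** * Critical equations on the Grassmannian of a coordinate subspace *)

Section BlockProjection.
Variables (F : numFieldType) (n : nat) (i : 'I_n).

Definition block_proj : 'M[F]_n := \matrix_(r, s) ((r == s) && (i <= r)%N)%:R.

Lemma block_proj_mull (A : 'M[F]_n) r s :
  (block_proj *m A) r s = if (i <= r)%N then A r s else 0.
Proof.
rewrite mxE (bigD1 r) //= mxE eqxx big1 ?addr0 => [|t tr]; last first.
  by rewrite mxE eq_sym (negbTE tr) mul0r.
by case: ifP; rewrite ?mul1r ?mul0r.
Qed.

Lemma block_proj_sym : block_proj^T = block_proj.
Proof. by apply/matrixP => r s; rewrite !mxE eq_sym; case: eqP => // ->. Qed.

Lemma block_proj_mulr (A : 'M[F]_n) r s :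
  (A *m block_proj) r s = if (i <= s)%N then A r s else 0.
Proof.
rewrite -[A *m _]trmxK mxE trmx_mul block_proj_sym block_proj_mull.
by case: ifP; rewrite ?mxE.
Qed.

Lemma block_proj_idem : block_proj *m block_proj = block_proj.
Proof.
apply/matrixP => r s; rewrite block_proj_mull; case: ifP => // ri.
by rewrite mxE ri andbF.
Qed.

Lemma block_projE (A : 'M[F]_n) r s :
  (block_proj *m A *m block_proj) r s = if (i <= r)%N && (i <= s)%N then A r s else 0.
Proof. by rewrite block_proj_mulr block_proj_mull; do 2 case: (_ <= _)%N. Qed.

Variable j : 'I_n.
Hypothesis ji : j = i.+1 :> nat.

Lemma zeroed_block r s : r != s -> zeroed i j r s = ~~ ((i <= r)%N && (i <= s)%N).
Proof. by rewrite -val_eqE /= /zeroed; lia. Qed.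

Lemma zero_out_block Y : skew Y -> zero_out i j Y = block_proj *m Y *m block_proj.
Proof.
move=> skY; apply/matrixP => r s; rewrite block_projE mxE.
rewrite -[(_ || _)]/(zeroed i j r s).
have [->|rs] := eqVneq r s; first by rewrite skew_diag // !if_same.
by rewrite zeroed_block //; case: (_ && _).
Qed.

Lemma block_support X : skew X -> (in_support i j X <-> block_proj *m X *m block_proj = X).
Proof.
move=> skX; split=> [zX|XE r s].
  apply/matrixP => r s; rewrite block_projE.
  have [->|rs] := eqVneq r s; first by rewrite skew_diag // !if_same.
  by case: ifPn => // h; rewrite zX // zeroed_block.
rewrite -XE block_projE; have [->|rs] := eqVneq r s; first by rewrite skew_diag // !if_same.
by rewrite zeroed_block // => /negbTE ->.
Qed.

Lemma block_absorb X : block_proj *m X *m block_proj = X ->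
  block_proj *m X = X /\ X *m block_proj = X.
Proof.
move=> XE; split; rewrite -[in LHS]XE; first by rewrite !mulmxA block_proj_idem.
by rewrite -mulmxA block_proj_idem.
Qed.

End BlockProjection.

Section NonlinearCriticalIdeal.
Variables (F : numFieldType) (n : nat) (i j : 'I_n).
Hypothesis ji : j = i.+1 :> nat.
Implicit Types (X T Z W Y : 'M[F]_n).

Local Notation N := (ncoord n).
Local Notation poly := {mpoly F[N]}.
Local Notation M := (@schubert F n i j).
Local Notation I := (vanishing_ideal M).
Local Notation codim := (@codim_schubert n i j).
Local Notation gen := (@generic_skew F n).
Local Notation S := (block_proj F i).

Let ij : (i < j)%N. Proof. by rewrite ji. Qed.

Lemma schubert_absorb X : M X -> S *m X = X /\ X *m S = X.
Proof.
move=> MX; apply/block_absorb/(block_support ji); first exact: schubert_skew MX.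
by move=> r s; apply: schubert_zeroed MX.
Qed.

Lemma action_skew (E X : 'M[F]_n) : skew X -> skew (E *m X + X *m E^T).
Proof.
by move=> skX; rewrite /skew linearD /= !trmx_mul trmxK skX mulNmx mulmxN addrC -opprD.
Qed.

Lemma action_curve (E X : 'M[F]_n) s :
  X + s *: (E *m X + X *m E^T) + s ^+ 2 *: (E *m X *m E^T) =
  (1%:M + s *: E) *m X *m (1%:M + s *: E)^T.
Proof.
rewrite [(_ + _)^T]linearD /= [(s *: E)^T]linearZ /= trmx1.
rewrite !(mulmxDl, mulmxDr, mul1mx, mulmx1) -!(scalemxAl, scalemxAr).
by rewrite scalerDr scalerA -expr2 [_ + s *: (X *m _)]addrC !addrA.
Qed.

(** The infinitesimal action [X |-> E X + X E^T] of block matrices [E]. *)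
Definition block_field (a b : 'I_n) : 'M[poly]_n :=
  let E := cst_mx (S *m delta_mx a b *m S) in E *m gen + gen *m E^T.

Lemma block_field_tangent a b :
  tangent_field M (fun k => block_field a b (prow k) (pcol k)).
Proof.
move=> f If X MX; have skX := schubert_skew MX; have [SX XS] := schubert_absorb MX.
set E := S *m delta_mx a b *m S; pose T := E *m X + X *m E^T.
have skT : skew T by apply: action_skew.
rewrite raddf_sum /= -[RHS](@tangent_dir _ _ i j X T f MX _ If).
  apply: eq_bigr => k _; rewrite mevalM; congr (_ * _).
  rewrite /plucker /T; have -> : E *m X + X *m E^T = ev X (block_field a b).
    by rewrite /block_field evD !evM evT ev_cst ev_generic.
  by rewrite [RHS]mxE.
split=> //; exists (E *m X *m E^T) => s.
have [u [v [su sv XE]]] := cone_wedge ij (((schubertP i j X).1 MX).2).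
rewrite action_curve; have SE0 : S *m E = E by rewrite /E !mulmxA block_proj_idem.
move: E SE0 {T skT} => E SE0.
split.
  exists (u *m (1%:M + s *: E)^T), (v *m (1%:M + s *: E)^T); rewrite {1}XE /wedge.
  by rewrite !trmx_mul !trmxK mulmxBr mulmxBl !mulmxA.
apply/(block_support ji).
  by rewrite /skew !trmx_mul trmxK skX mulNmx mulmxN mulmxA.
have SE : S *m (1%:M + s *: E) *m X = (1%:M + s *: E) *m X.
  by rewrite mulmxDr mulmx1 -scalemxAr SE0 !mulmxDl mul1mx SX.
have ES : X *m (1%:M + s *: E)^T *m S = X *m (1%:M + s *: E)^T.
  have := congr1 trmx SE; rewrite !trmx_mul skX block_proj_sym !mulNmx.
  by move/oppr_inj; rewrite mulmxA.
by rewrite !mulmxA SE -!mulmxA [X *m (_ *m S)]mulmxA ES.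
Qed.

(** The trace form turns the pairing with the vector field of the elementary
    block matrix [(a, b)] into a matrix entry of a product. *)
Lemma pairing_block_field X (P : 'M[poly]_n) a b : M X -> skew (ev X P) ->
  (pairing (upper_row P) (fun k => block_field a b (prow k) (pcol k))).@[plucker X] =
  - (S *m X *m ev X P *m S) b a.
Proof.
move=> MX skP; have skX := schubert_skew MX.
set E := S *m delta_mx a b *m S; pose T := E *m X + X *m E^T.
have skT : skew T by apply: action_skew.
have TE : T = ev X (block_field a b).
  by rewrite /block_field evD !evM evT ev_cst ev_generic.
have two0 : -2 != 0 :> F by rewrite oppr_eq0 pnatr_eq0.
apply: (mulfI two0).
have -> : (pairing (upper_row P) (fun k => block_field a b (prow k) (pcol k))).@[plucker X] =
   \sum_k ev X P (prow k) (pcol k) * T (prow k) (pcol k).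
  rewrite /pairing raddf_sum /=; apply: eq_bigr => k _.
  by rewrite mevalM TE !mxE.
rewrite -trace_alternating; try exact: alternating_skew.
set R := ev X P in skP *; have trE : \tr (E *m X *m R) = (S *m X *m R *m S) b a.
  rewrite /E -!mulmxA mxtrace_mulC -!mulmxA mxtrace_mulC /mxtrace.
  rewrite (bigD1 b) //= big1 ?addr0 => [|c cb].
    rewrite mxE (bigD1 a) //= big1 ?addr0 => [|d da]; last by rewrite [delta_mx _ _ _ _]mxE (negbTE da) mulr0.
    by rewrite [delta_mx _ _ _ _]mxE !eqxx mulr1 !mulmxA.
  by rewrite mxE big1 // => d _; rewrite [delta_mx _ _ _ _]mxE (negbTE cb) andbF mulr0.
rewrite -trE /T; move: E {T skT TE trE} => E; rewrite mulmxDr mxtraceD mulmxA.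
have -> : \tr (R *m E *m X) = \tr (E *m X *m R) by rewrite -mulmxA mxtrace_mulC.
have -> : \tr (R *m (X *m E^T)) = \tr (E *m X *m R).
  by rewrite -mxtrace_tr !trmx_mul trmxK skX skP !(mulmxN, mulNmx) opprK.
by ring.
Qed.

Section FixedData.
Variable G : poly -> Prop.
Hypothesis genG : ideal_gen G = I.
Variables (Y : 'M[F]_n).
Hypotheses (gY : gr2 Y) (Y0 : \tr (Y *m Y) != 0).

Local Notation Q := (S *m proj_of Y *m S).
Local Notation Y' := (S *m Y *m S).
Local Notation L := (lagrangian_ideal M G codim (proj_of Y)).

Let GI f : G f -> I f.
Proof. by move=> Gf; rewrite -genG; apply: ideal_gen_sub. Qed.

Let iL : is_ideal L. Proof. exact: lagrangian_is_ideal. Qed.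

Definition mx_in (J : poly -> Prop) m p (P : 'M[poly]_(m, p)) := forall a b, J (P a b).

Lemma mx_in_mulr J m p q (A : 'M_(m, p)) (B : 'M_(p, q)) :
  is_ideal J -> mx_in J A -> mx_in J (A *m B).
Proof.
move=> iJ JA a b; rewrite mxE; apply: ideal_sum => // c _; exact: ideal_mulr.
Qed.

Lemma mx_inZ J m p x (A : 'M_(m, p)) : is_ideal J -> mx_in J A -> mx_in J (x *: A).
Proof. by move=> [_ _ JM] JA a b; rewrite mxE; apply: JM. Qed.

Lemma mx_inB J m p (A B : 'M_(m, p)) :
  is_ideal J -> mx_in J A -> mx_in J B -> mx_in J (A - B).
Proof. by move=> iJ JA JB a b; rewrite 2!mxE; apply: ideal_sub. Qed.

Lemma mx_in_congr (P P' : 'M[poly]_n) :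
  (forall X, M X -> ev X P = ev X P') -> mx_in L P -> mx_in L P'.
Proof.
move=> PP' LP a b; rewrite -[P' a b](subrK (P a b)).
have [_ LD _] := iL; apply: LD => //; apply: vanishing_sub_lagrangian => X MX.
by have /matrixP/(_ a b) := PP' X MX; rewrite mevalB !mxE => ->; rewrite subrr.
Qed.

(** The elements of [J] after inverting [g] and [h]; a saturation by [g] and [h]
    contains them. *)
Definition localized (J : poly -> Prop) (g h : poly) (f : poly) : Prop :=
  exists a b, J (f * (g ^+ a * h ^+ b)).

Lemma localized_ideal J g h : is_ideal J -> is_ideal (localized J g h).
Proof.
move=> [J0 JD JM]; split=> [|f f' [a [b fJ]] [a' [b' fJ']]|c f [a [b fJ]]].
- by exists 0%N, 0%N; rewrite mul0r.
- exists (a + a')%N, (b + b')%N; rewrite mulrDl !exprD; apply: JD.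
    rewrite (_ : _ * _ = g ^+ a' * h ^+ b' * (f * (g ^+ a * h ^+ b))); last by ring.
    exact: JM.
  rewrite (_ : _ * _ = g ^+ a * h ^+ b * (f' * (g ^+ a' * h ^+ b'))); last by ring.
  exact: JM.
- by exists a, b; rewrite -mulrA; apply: JM.
Qed.

Lemma localized_sub J g h f : J f -> localized J g h f.
Proof. by exists 0%N, 0%N; rewrite !expr0 !mulr1. Qed.

Lemma localized_cancel J g h f a b :
  localized J g h (f * (g ^+ a * h ^+ b)) -> localized J g h f.
Proof.
move=> [a' [b' fJ]]; exists (a + a')%N, (b + b')%N; move: fJ.
by rewrite !exprD; congr (J _); ring.
Qed.

Lemma commutator_identity X : gr2 X ->
  2 *: (\tr (X *m X) *: (X *m X *m Q - Q *m (X *m X)) *m (X *m Q)) =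
  (\tr (Y *m Y))^-1 *:
    ((\tr (X *m Y') * \tr (X *m X)) *: (2 *: (X *m X *m Y') - \tr (X *m X) *: Y')).
Proof.
move=> gX; have [skX _] := gX.
have conj := compress_conj gY Y0 (block_proj_sym F i) skX.
rewrite -scalemxAl mulmxBl.
have -> : X *m X *m Q *m (X *m Q) = X *m X *m (Q *m X *m Q) by rewrite !mulmxA.
have -> : Q *m (X *m X) *m (X *m Q) = Q *m (X *m X *m X) *m Q by rewrite !mulmxA.
rewrite gr2_cube // -[Q *m (_ *: X)]scalemxAr -[(_ *: (Q *m X)) *m Q]scalemxAl conj.
rewrite -[X *m X *m (_ *: _)]scalemxAr; move: (X *m X *m Y') Y' => A B.
by apply/matrixP => a b; rewrite !mxE; field.
Qed.

Lemma relation_identity X : gr2 X ->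
  \tr (X *m X) *: (\tr (X *m X) *: Y' - \tr (X *m Y') *: X) =
  \tr (X *m X) *: (2 *: (X *m X *m Y') - \tr (X *m X) *: Y')^T -
  2 *: ((2 *: (X *m X *m Y') - \tr (X *m X) *: Y') *m (X *m X)).
Proof.
move=> gX; have [skX _] := gX.
have skY' := compress_skew (block_proj_sym F i) gY.1.
set tau := \tr (X *m X); set g := \tr (X *m Y').
have -> : (2 *: (X *m X *m Y') - tau *: Y')^T = tau *: Y' - 2 *: (Y' *m (X *m X)).
  move: Y' skY' @g => W skW _.
  rewrite linearB /= ![(_ *: _)^T]linearZ /= !trmx_mul skX skW.
  by rewrite !(mulmxN, mulNmx, opprK, scalerN) addrC.
have XYX : X *m X *m Y' *m (X *m X) = (2^-1 * g * (2^-1 * tau)) *: X.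
  rewrite (_ : _ *m _ = X *m (X *m Y' *m X) *m X); last by rewrite !mulmxA.
  by rewrite (gr2_sandwich gX skY') -scalemxAr -scalemxAl gr2_cube // scalerA.
rewrite mulmxBl -![(_ *: _) *m (X *m X)]scalemxAl XYX.
move: (Y' *m (X *m X)) Y' => A B.
by apply/matrixP => a b; rewrite !mxE; field.
Qed.

(** Up to the factor [tr (X^2)], the square of [X] commutes with [Q] modulo the
    Lagrangian ideal. *)
Lemma lagrangian_commutator :
  mx_in L (@trX2 F n *: (gen *m gen *m cst_mx Q - cst_mx Q *m (gen *m gen))).
Proof.
pose R1 := upper_row (gen *m cst_mx (proj_of Y) + cst_mx (proj_of Y) *m gen).
pose R2 := upper_row gen; pose t a b k := block_field a b (prow k) (pcol k).
pose D a b c := pairing R1 (t a b) * pairing R2 (t c c) - pairing R1 (t c c) * pairing R2 (t a b).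
(* Contracting one of the two fields with the trace form replaces one factor
   of the determinants by [tr (X^2)]; subtracting the transpose cancels the
   symmetric term [X Q X]. *)
pose Z : 'M[poly]_n := \matrix_(b, a) \sum_c D a b c.
have LZ : mx_in L Z.
  move=> b a; rewrite mxE; apply: ideal_sum => // c _.
  by apply: lagrangian_pairings; try exact: GI; apply: block_field_tangent.
have LZT : mx_in L (Z - Z^T).
  move=> a b; have -> : (Z - Z^T) a b = Z a b - Z b a by rewrite !mxE.
  exact: (ideal_sub iL).
apply: mx_in_congr LZT => X MX; have skX := schubert_skew MX.
have [SX XS] := schubert_absorb MX.
have symQ0 := proj_of_sym (gY.1); set Q0 := proj_of Y in symQ0 *.
pose A := X *m X *m Q + X *m Q *m X.
have ZE : ev X Z = \tr (X *m X) *: A - \tr A *: (X *m X).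
  have skR1 : skew (X *m Q0 + Q0 *m X).
    by rewrite /skew linearD /= !trmx_mul symQ0 skX mulNmx mulmxN -opprD addrC.
  have AE : S *m X *m (X *m Q0 + Q0 *m X) *m S = A.
    rewrite SX mulmxDr mulmxDl /A !mulmxA -[X *m X *m S]mulmxA XS.
    by rewrite -[X *m Q0 *m X *m S]mulmxA XS -[X *m Q0 *m S *m X]mulmxA SX.
  have XXE : S *m X *m X *m S = X *m X by rewrite SX -mulmxA XS.
  have pR1 a b : (pairing R1 (t a b)).@[plucker X] = - A b a.
    have evP := ev_commutant Q0 skX; rewrite -AE -evP.
    by apply: pairing_block_field; rewrite // evP.
  have pR2 a b : (pairing R2 (t a b)).@[plucker X] = - (X *m X) b a.
    by have := pairing_block_field a b MX (P := gen); rewrite ev_generic // XXE; apply.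
  apply/matrixP => b a; rewrite [LHS]mxE [Z b a]mxE raddf_sum /=.
  have evD' c : (D a b c).@[plucker X] = A b a * (X *m X) c c - A c c * (X *m X) b a.
    have ev2 (p q p' q' : poly) : (p * q - p' * q').@[plucker X] =
        p.@[plucker X] * q.@[plucker X] - p'.@[plucker X] * q'.@[plucker X].
      by rewrite mevalB !mevalM.
    rewrite /D ev2 -[A b a * _]mulrNN -[A c c * _]mulrNN.
    congr (_ * _ - _ * _); [exact: (pR1 a b)|exact: (pR2 c c)|exact: (pR1 c c)|exact: (pR2 a b)].
  under eq_bigr => c _ do rewrite evD'.
  have mxE2 (x y : F) (U V : 'M[F]_n) : (x *: U - y *: V) b a = x * U b a - y * V b a.
    by rewrite !mxE.
  by rewrite sumrB -mulr_sumr -mulr_suml mxE2 [\tr (X *m X) * _]mulrC.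
have trA : A^T = Q *m X *m X + X *m Q *m X.
  have symQ : Q^T = Q by rewrite !trmx_mul block_proj_sym symQ0 mulmxA.
  rewrite /A [LHS]raddfD /= [(X *m X *m _)^T]trmx_mul [(X *m _ *m X)^T]trmx_mul.
  rewrite [(X *m X)^T]trmx_mul [(X *m Q)^T]trmx_mul symQ skX.
  by rewrite !(mulmxN, mulNmx) !opprK !mulmxA.
have UT (B : 'M[F]_n) x y : (x *: B - y *: (X *m X))^T = x *: B^T - y *: (X *m X).
  have XXT : (X *m X)^T = X *m X by rewrite trmx_mul skX mulmxN mulNmx opprK.
  by rewrite linearB /= ![(_ *: _)^T]linearZ /= XXT.
rewrite evB evT ZE UT opprB addrA subrK -scalerBr evZ ev_trX2 //; congr (_ *: _).
by rewrite trA evB !evM ev_generic // ev_cst /A -!mulmxA opprD addrACA subrr addr0.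
Qed.

(** Once [tr (X^2)] and [tr (X Y)] are invertible, [P = 2 X^2 / tr (X^2)] is an
    idempotent that fixes [X] and commutes with [Q]. Hence it fixes [Q X Q],
    which is proportional to [Y'] by [compress_conj], and
    [Y' = P Y' P] is a multiple of [X (X Y' X) X], hence of [X]. *)
Lemma critical_relation :
  mx_in (localized L (trXY Y) (@trX2 F n)) (@trX2 F n *: cst_mx Y' - trXY Y *: gen).
Proof.
set g := trXY Y; set tau := @trX2 F n; set K := localized L g tau.
have iK : is_ideal K by apply: localized_ideal.
have [K0 KD KM] := iK.
have LK f : L f -> K f by apply: localized_sub.
have skY := gY.1; have skY' := compress_skew (block_proj_sym F i) skY.
have evg X : M X -> g.@[plucker X] = \tr (X *m Y').
  move=> MX; rewrite ev_trXY; last exact: schubert_skew MX.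
  by have [SX XS] := schubert_absorb MX; rewrite (compress_tr Y S) SX XS.
have ev2 X : (2 : poly).@[plucker X] = 2 by rewrite -[2 in LHS]/(1 + 1) mevalD meval1.
(* The relation [P Y' = Y'], cleared of its denominator. *)
pose B : 'M[poly]_n := 2 *: (gen *m gen *m cst_mx Y') - tau *: cst_mx Y'.
have BE X : M X -> ev X B = 2 *: (X *m X *m Y') - \tr (X *m X) *: Y'.
  move=> MX; have skX := schubert_skew MX.
  by rewrite evB !evZ !evM ev_generic // ev_cst ev_trX2 // ev2.
have KB : mx_in K B.
  have LC : mx_in L (2 *: (tau *: (gen *m gen *m cst_mx Q - cst_mx Q *m (gen *m gen))
                       *m (gen *m cst_mx Q))).
    by apply: mx_inZ => //; apply: mx_in_mulr => //; apply: lagrangian_commutator.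
  have LB : mx_in L ((\tr (Y *m Y))^-1%:MP *: ((g * tau) *: B)).
    apply: mx_in_congr LC => X MX; have skX := schubert_skew MX.
    have [gX _] := MX.
    rewrite evZ ev2 evM evZ ev_trX2 // (@evM _ _ X _ _ _ gen) ev_generic // !ev_cst.
    rewrite [ev X (_ - _)]evB !evM ev_generic // ev_cst.
    rewrite !evZ mevalC mevalM evg // ev_trX2 // BE //.
    exact: commutator_identity.
  have entryZ (x : poly) (A : 'M[poly]_n) a b : (x *: A) a b = x * A a b by rewrite mxE.
  move=> a b; apply: (@localized_cancel _ _ _ _ 1 1); apply: LK.
  have := LB a b; rewrite !entryZ mul_mpolyC => /(ideal_unscale iL).
  by rewrite !expr1 mulrC; apply; rewrite invr_eq0.
have KR : mx_in K (tau *: (tau *: cst_mx Y' - g *: gen)).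
  pose P := tau *: B^T - 2 *: (B *m (gen *m gen)).
  have KP : mx_in K P.
    apply: mx_inB => //; apply: mx_inZ => //; last exact: mx_in_mulr.
    by move=> a b; rewrite mxE; apply: KB.
  have IP : mx_in L (tau *: (tau *: cst_mx Y' - g *: gen) - P).
    move=> a b; apply: vanishing_sub_lagrangian => X MX.
    have skX := schubert_skew MX; have [gX _] := MX.
    suff /matrixP/(_ a b) : ev X (tau *: (tau *: cst_mx Y' - g *: gen) - P) = 0 by rewrite !mxE.
    rewrite evB evZ [ev X P]evB !evZ evB !evZ evT !evM BE // ev_generic // ev_cst.
    rewrite ev_trX2 // evg // ev2; apply/eqP; rewrite subr_eq0; apply/eqP.
    exact: relation_identity.
  move=> a b; rewrite -[X in K X](subrK (P a b)); apply: KD; last exact: KP.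
  by apply: LK; have := IP a b; rewrite mxE [(- P) a b]mxE.
move=> a b; apply: (@localized_cancel _ _ _ _ 0 1).
by have := KR a b; rewrite mxE mulrC expr0 expr1 mul1r.
Qed.

End FixedData.
End NonlinearCriticalIdeal.

(** * Totally isotropic planes *)

Section Transversality.
Variables (F : numClosedFieldType) (n : nat) (i j : 'I_n).
Hypothesis ji : j = i.+1 :> nat.
Hypothesis in4 : (i + 4 <= n)%N.

Local Notation M := (@schubert F n i j).
Local Notation gen := (@generic_skew F n).

Let ij : (i < j)%N. Proof. by rewrite ji. Qed.
Let kP : (i.+2 < n)%N. Proof. by rewrite -addn2; lia. Qed.
Let lP : (i.+3 < n)%N. Proof. by rewrite -addn3; lia. Qed.
Local Notation k := (Ordinal kP).
Local Notation l := (Ordinal lP).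

(** At a totally isotropic plane [X], spanned by [e_i + sqrt(-1) e_(i+1)] and
    [e_(i+2) + sqrt(-1) e_(i+3)], the gradient of the Plucker relation on the
    four indices is [X] itself, so that the tangent spaces of [M] and of the
    quadric at [X] both lie in the hyperplane orthogonal to [X]. *)
Lemma not_transverse G c : ~ transverse_to_quadric M G c.
Proof.
move=> tr; have two0 : 2 != 0 :> F by rewrite pnatr_eq0.
pose u : 'rV[F]_n := delta_mx 0 i + 'i *: delta_mx 0 j.
pose v : 'rV[F]_n := delta_mx 0 k + 'i *: delta_mx 0 l.
pose X := wedge u v; have skX : skew X := skew_wedge u v.
have neq (a b : 'I_n) : (a < b)%N -> ((a == b) = false) * ((b == a) = false).
  by move=> ab; split; apply/negbTE; rewrite neq_ltn ab ?orbT.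
have nij := neq i j ij; have nik : ((i == k) = false) * ((k == i) = false) by apply: neq => /=; lia.
have nil : ((i == l) = false) * ((l == i) = false) by apply: neq => /=; lia.
have njk : ((j == k) = false) * ((k == j) = false) by apply: neq => /=; lia.
have njl : ((j == l) = false) * ((l == j) = false) by apply: neq => /=; lia.
have nkl : ((k == l) = false) * ((l == k) = false) by apply: neq => /=; lia.
have ev := (nij, nik, nil, njk, njl, nkl, eqxx).
have uE r : u 0 r = (r == i)%:R + 'i * (r == j)%:R by rewrite !mxE.
have vE r : v 0 r = (r == k)%:R + 'i * (r == l)%:R by rewrite !mxE.
have Xik : X i k = 1 by rewrite wedgeE !uE !vE !ev /=; ring.
have Xil : X i l = 'i by rewrite wedgeE !uE !vE !ev /=; ring.
have Xjk : X j k = 'i by rewrite wedgeE !uE !vE !ev /=; ring.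
have Xjl : X j l = -1 by rewrite wedgeE !uE !vE !ev /= -(sqrCi F); ring.
have Xij : X i j = 0 by rewrite wedgeE !uE !vE !ev /=; ring.
have Xkl : X k l = 0 by rewrite wedgeE !uE !vE !ev /=; ring.
have MX : M X.
  apply/(schubertP i j); split.
    by apply: contra_eq_neq Xik => ->; rewrite mxE eq_sym oner_eq0.
  apply: wedge_in_cone => // r ri.
    by rewrite uE !(neq _ _ _) ?mulr0 ?addr0 // ; lia.
  by rewrite vE !(neq _ _ _) ?mulr0 ?addr0 //=; lia.
have dotE (a b a' b' : 'I_n) : (delta_mx 0 a + 'i *: delta_mx 0 b) *m
    (delta_mx 0 a' + 'i *: delta_mx 0 b')^T =
    ((a == a')%:R + 'i * (a == b')%:R + 'i * (b == a')%:R - (b == b')%:R)%:M :> 'M[F]_1.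
  rewrite linearD linearZ /= !trmx_delta !(mulmxDl, mulmxDr) -!(scalemxAl, scalemxAr).
  rewrite !mul_delta_mx_cond; apply/matrixP => x y; rewrite !ord1 !mxE !eqxx /= !mulr1n.
  have ii : 'i * 'i = -1 :> F by rewrite -expr2 sqrCi.
  by do 4 case: (_ == _); rewrite /= ?mulr1n ?mulr0n ?mxE ?eqxx ?scalerA /=; ring: ii.
have uu : u *m u^T = 0 by rewrite dotE !ev /= !mulr0 !addr0 subrr raddf0.
have vv : v *m v^T = 0 by rewrite dotE !ev /= !mulr0 !addr0 subrr raddf0.
have uv : u *m v^T = 0 by rewrite dotE !ev /= !mulr0 !addr0 subrr raddf0.
have vu : v *m u^T = 0 by rewrite -[LHS]trmxK trmx_mul trmxK uv trmx0.
have XX : X *m X = 0.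
  rewrite /X /wedge mulmxBl !mulmxBr !mulmxA -![_ *m _ *m u^T]mulmxA -![_ *m _ *m v^T]mulmxA.
  by rewrite uu vv uv vu !mulmx0 !mul0mx !subrr.
have trXX : \tr (X *m X) = 0 by rewrite XX mxtrace0.
have [m0 m0i m0k] : exists2 m, prow m = i & pcol m = k by apply: coord_of => /=; lia.
have [_ span] := tr X MX trXX.
have [u' [v' [tu tv wE]]] := span (\row_m (m == m0)%:R).
pose W (y : 'rV[F]_(ncoord n)) : 'M[F]_n := of_coords (y 0).
have skW y : skew (W y) by case: (alternating_of_coords (y 0)).
have Wm y m : plucker (W y) m = y 0 m by apply: of_coordsE.
pose f := gen i j * gen k l - (gen i k * gen j l - gen i l * gen j k).
have If : vanishing_ideal M f.
  move=> X' MX'; have skX' := schubert_skew MX'; have [gX' _] := MX'.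
  by rewrite !mevalB !mevalM !ev_entry // (gr2_plucker i j k l gX') subrr.
have dirE y g : dir X (W y) g = \sum_m (g^`M(m)).@[plucker X] * y 0 m.
  by apply: eq_bigr => m _; rewrite Wm.
have dirf y : dir X (W y) f = W y i l * 'i + W y j k * 'i + W y i k - W y j l.
  rewrite !dirB !dirM !dir_generic // !ev_entry // Xij Xik Xil Xjk Xjl Xkl; ring.
have dirq y : dir X (W y) (@trX2 F n) = - 4 * dir X (W y) f.
  have -> : dir X (W y) (@trX2 F n) = 2 * \tr (X *m W y).
    have trE (A B : 'M[F]_n) : \tr (A *m B) = \sum_r \sum_s A r s * B s r.
      by apply: eq_bigr => r _; rewrite mxE.
    rewrite mulr_natl mulr2n {1}mxtrace_mulC !trE -big_split /trX2 /mxtrace dir_sum.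
    apply: eq_bigr => r _; rewrite mxE dir_sum -big_split; apply: eq_bigr => s _ /=.
    by rewrite dirM !dir_generic // !ev_entry.
  have uWv : (u *m W y *m v^T) 0 0 = W y i k + 'i * W y i l + 'i * W y j k - W y j l.
    rewrite /u /v linearD linearZ /= !trmx_delta !(mulmxDl, mulmxDr) -!(scalemxAl, scalemxAr).
    rewrite -!rowE -!colE !mxE; have ii := mulCii F.
    by ring: ii.
  have -> : \tr (X *m W y) = - 2 * (u *m W y *m v^T) 0 0.
    rewrite /X /wedge mulmxBl raddfB /= -!mulmxA !(mxtrace_mulC _^T) !trace_mx11.
    have -> : (v *m W y *m u^T) 0 0 = - (u *m W y *m v^T) 0 0.
      have -> : u *m W y *m v^T = - (v *m W y *m u^T)^T.
        by rewrite !trmx_mul trmxK skW mulNmx mulmxN opprK mulmxA.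
      by rewrite !mxE opprK.
    by rewrite !mulmxA; ring.
  by rewrite uWv dirf; ring.
have phiw : dir X (W (\row_m (m == m0)%:R)) f = 1.
  rewrite dirf.
  have Ww (a b : 'I_n) : (a < b)%N -> W (\row_m (m == m0)%:R) a b = ((a == i) && (b == k))%:R.
    case/coord_of=> m <- <-; rewrite -[LHS]/(plucker _ m) Wm mxE; congr (nat_of_bool _)%:R.
    apply/idP/idP => [/eqP ->|/andP[/eqP ri /eqP ck]].
      by rewrite m0i m0k !eqxx.
    by apply/eqP/coord_inj; rewrite ?m0i ?m0k.
  rewrite !Ww /=; try lia.
  by rewrite !ev /=; ring.
have := oner_eq0 F; rewrite -phiw wE dirE.
under eq_bigr => m _ do rewrite mxE mulrDr.
rewrite big_split /= (tu _ If) add0r -dirE.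
have /eqP := tv _ (erefl : [set trX2 F n]%classic (trX2 F n)).
by rewrite -dirE dirq mulf_eq0 oppr_eq0 pnatr_eq0 /= => /eqP ->; rewrite eqxx.
Qed.

End Transversality.

(** * Generic data *)

Section GenericPolynomial.
Variables (F : numFieldType) (n : nat) (i j : 'I_n).
Hypothesis ij : (i < j)%N.
Local Notation N := (ncoord n).
Local Notation poly := {mpoly F[N]}.
Local Notation gen := (@generic_skew F n).

Lemma mx_homog_mul m p q d e (A : 'M[poly]_(m, p)) (B : 'M[poly]_(p, q)) :
  (forall r s, A r s \is d.-homog) -> (forall r s, B r s \is e.-homog) ->
  forall r s, (A *m B) r s \is (d + e).-homog.
Proof. by move=> hA hB r s; rewrite mxE; apply: rpred_sum => t _; apply: dhomogM. Qed.

Lemma mx_homog_tr m d (A : 'M[poly]_m) :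
  (forall r s, A r s \is d.-homog) -> \tr A \is d.-homog.
Proof. by move=> hA; apply: rpred_sum => r _. Qed.

Lemma generic_homog r s : gen r s \is 1.-homog.
Proof.
have upper (a b : 'I_n) : (a < b)%N -> gen a b \is 1.-homog.
  by case/coord_of=> k <- <-; rewrite generic_skewE dhomogX; apply/eqP; apply: mdeg1.
have [tG dG] := @alternating_generic n F.
have [rs|sr|/val_inj ->] := ltngtP r s; first exact: upper.
  have /matrixP/(_ s r) := tG; rewrite [in X in X = _]mxE [in X in _ = X]mxE => ->.
  by rewrite rpredN; apply: upper.
by rewrite dG rpred0.
Qed.

Definition zeroed_generic : 'M[poly]_n :=
  \matrix_(r, s) if zeroed i j r s then 0 else gen r s.

(** The factors say that the projection of [Y] exists, that the plane of
    [zero_out Y] is not isotropic, that the compressed projection has nonzero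
    trace, and that [zero_out Y] lies on the big cell. *)
Definition generic_condition : poly :=
  @trX2 F n * \tr (zeroed_generic *m zeroed_generic) *
  \tr (gen *m gen *m cst_mx (block_proj F i)) * gen i j.

Lemma generic_condition_homog : generic_condition \is (1 + 1 + (1 + 1) + (1 + 1 + 0) + 1)%N.-homog.
Proof.
have hZ r s : zeroed_generic r s \is 1.-homog.
  by rewrite mxE; case: ifP => _; [apply: rpred0 | apply: generic_homog].
apply: dhomogM; last exact: generic_homog.
apply: dhomogM; first apply: dhomogM.
- by apply: mx_homog_tr; apply: mx_homog_mul; apply: generic_homog.
- by apply: mx_homog_tr; apply: mx_homog_mul.
- apply: mx_homog_tr; apply: mx_homog_mul; first by apply: mx_homog_mul; apply: generic_homog.
  move=> r s; rewrite mxE -[_%:MP]mulr1 mul_mpolyC; apply: rpredZ; exact: dhomog1.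
Qed.

Lemma generic_conditionE Y : skew Y -> generic_condition.@[plucker Y] =
  \tr (Y *m Y) * \tr (zero_out i j Y *m zero_out i j Y) *
  \tr (Y *m Y *m block_proj F i) * Y i j.
Proof.
move=> skY; rewrite !mevalM ev_trX2 // ev_entry // !ev_tr !evM ev_generic // ev_cst.
suff -> : ev Y zeroed_generic = zero_out i j Y by [].
apply/matrixP => r s; rewrite !mxE -/(zeroed i j r s).
by case: (zeroed i j r s); rewrite ?meval0 // ev_entry.
Qed.

(** The plane spanned by two basis vectors satisfies all the conditions. *)
Lemma generic_condition_witness : exists2 Y, gr2 Y & generic_condition.@[plucker Y] != 0.
Proof.
pose Y : 'M[F]_n := wedge (delta_mx 0 i) (delta_mx 0 j).
have YE r s : Y r s = ((r == i) && (s == j))%:R - ((r == j) && (s == i))%:R.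
  by rewrite wedgeE !mxE /= -!natrM !mulnb.
have skY : skew Y := skew_wedge _ _.
have Yij : Y i j = 1.
  by rewrite YE !eqxx (_ : i == j = false) ?subr0 //; apply/negbTE; rewrite neq_ltn ij.
have Yz : zero_out i j Y = Y.
  apply/matrixP => r s; rewrite mxE; case: ifPn => // zrs; rewrite YE.
  have -> : (r == i) && (s == j) = false.
    by apply: contraTF zrs => /andP[/eqP -> /eqP ->]; lia.
  have -> : (r == j) && (s == i) = false.
    by apply: contraTF zrs => /andP[/eqP -> /eqP ->]; lia.
  by rewrite subrr.
have Yp : Y *m block_proj F i = Y.
  apply/matrixP => r s; rewrite block_proj_mulr; case: ifPn => // is_; rewrite YE.
  have -> : (s == j) = false by apply: contraNF is_ => /eqP ->; lia.
  have -> : (s == i) = false by apply: contraNF is_ => /eqP ->.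
  by rewrite !andbF subrr.
have trYY : \tr (Y *m Y) = - 2.
  rewrite trace_alternating; try exact: alternating_skew.
  have [k0 ki kj] := coord_of ij.
  rewrite (bigD1 k0) //= big1 ?addr0 => [|k kk0]; first by rewrite ki kj Yij !mulr1.
  suff -> : Y (prow k) (pcol k) = 0 by rewrite mul0r.
  rewrite YE; have -> : (prow k == i) && (pcol k == j) = false.
    apply: contraNF kk0 => /andP[/eqP ri /eqP cj].
    by apply/eqP/coord_inj; rewrite ?ri ?cj ?ki ?kj.
  have -> : (prow k == j) && (pcol k == i) = false; last by rewrite subrr.
  by apply/negP => /andP[/eqP rj /eqP ci]; have := prow_lt_pcol k; rewrite rj ci; lia.
exists Y.
  by apply: wedge_gr2; apply: contra_eq_neq Yij; rewrite -/Y => ->; rewrite mxE eq_sym oner_eq0.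
rewrite generic_conditionE // Yz -mulmxA Yp trYY Yij.
by rewrite !mulf_neq0 ?oppr_eq0 ?pnatr_eq0 ?oner_eq0.
Qed.

Lemma generic_conditionP (P : 'M[F]_n -> Prop) :
  (forall Y, gr2 Y -> \tr (Y *m Y) != 0 ->
     \tr (zero_out i j Y *m zero_out i j Y) != 0 ->
     \tr (Y *m Y *m block_proj F i) != 0 -> Y i j != 0 -> P Y) ->
  generic_gr2 P.
Proof.
move=> hP; exists (1 + 1 + (1 + 1) + (1 + 1 + 0) + 1)%N, generic_condition; split.
- exact: generic_condition_homog.
- exact: generic_condition_witness.
- move=> Y gY; rewrite generic_conditionE; last by case: gY.
  by rewrite !mulf_eq0 !negb_or => /andP[/andP[/andP[? ?] ?] ?]; apply: hP.
Qed.

End GenericPolynomial.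

Section ZeroOut.
Variables (F : numFieldType) (n : nat) (i j : 'I_n).
Hypothesis ij : (i < j)%N.
Implicit Types (X Y : 'M[F]_n).

Lemma zero_outE Y r s : zero_out i j Y r s = if zeroed i j r s then 0 else Y r s.
Proof. by rewrite mxE. Qed.

Lemma zero_out_skew Y : skew Y -> skew (zero_out i j Y).
Proof.
move=> skY; apply/matrixP => r s; rewrite [LHS]mxE [RHS]mxE !zero_outE zeroedC.
by case: ifP; rewrite ?oppr0 // (skewE skY).
Qed.

Lemma zero_out_corner Y : zero_out i j Y i j = Y i j.
Proof. by rewrite zero_outE /zeroed; case: ifP => //; lia. Qed.

Lemma zero_out_coord Y k : ~~ zeroed i j (prow k) (pcol k) ->
  plucker (zero_out i j Y) k = plucker Y k.
Proof. by rewrite /plucker zero_outE => /negbTE ->. Qed.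

Lemma zero_out_support Y : in_support i j (zero_out i j Y).
Proof. by move=> r s zrs; rewrite zero_outE zrs. Qed.

Lemma zero_out_trace X Y : skew X -> in_support i j X -> skew Y ->
  \tr (X *m zero_out i j Y) = \tr (X *m Y).
Proof.
move=> skX zX skY; rewrite !trace_alternating; try exact/alternating_skew/zero_out_skew;
  try exact: alternating_skew.
congr (_ * _); apply: eq_bigr => k _.
have [zk|nzk] := boolP (zeroed i j (prow k) (pcol k)); first by rewrite zX // !mul0r.
by congr (_ * _); apply: zero_out_coord.
Qed.

Lemma scaled_prop_to X Y : X != 0 -> (exists c, X = c *: Y) -> prop_to X Y.
Proof.
move=> X0 [c XE]; exists c => //.
by apply: contraNneq X0 => c0; rewrite XE c0 scale0r.
Qed.

End ZeroOut.

(** * The two families of Schubert varieties *)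

(** ** The subspace case [j = i + 1] *)

Lemma commutant_skew (F : numFieldType) n (Q X : 'M[F]_n) :
  Q^T = Q -> skew X -> skew (X *m Q + Q *m X).
Proof.
by move=> symQ skX; rewrite /skew linearD /= !trmx_mul symQ skX mulNmx mulmxN -opprD addrC.
Qed.

Section BlockCase.
Variables (F : numFieldType) (n : nat) (i j : 'I_n).
Hypothesis ji : j = i.+1 :> nat.
Implicit Types (X Y : 'M[F]_n).
Local Notation S := (block_proj F i).

Let ij : (i < j)%N. Proof. by rewrite ji. Qed.

Lemma block_zero_out_schubert Y : gr2 Y -> Y i j != 0 -> schubert i j (zero_out i j Y).
Proof.
move=> gY Yij; have skY := gY.1; apply/schubertP; split.
  by apply: contraNneq Yij => Y0; rewrite -(zero_out_corner ij) Y0 mxE.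
split; last exact: zero_out_support.
rewrite (zero_out_block ji) //; have [_ [u [v ->]]] := (gr2P Y).1 gY.
exists (u *m S), (v *m S).
by rewrite /wedge mulmxBr mulmxBl !trmx_mul block_proj_sym !mulmxA.
Qed.

Lemma block_coord k : ~~ zeroed i j (prow k) (pcol k) -> (i <= prow k)%N /\ (i <= pcol k)%N.
Proof.
rewrite zeroed_block // ?negbK => [/andP[]//|].
by rewrite neq_ltn prow_lt_pcol.
Qed.

Lemma block_coord_compress X k : ~~ zeroed i j (prow k) (pcol k) ->
  plucker (S *m X *m S) k = plucker X k.
Proof. by case/block_coord => ri ci; rewrite /plucker block_projE ri ci. Qed.

Lemma block_compress_commutant X (Q : 'M[F]_n) : S *m X *m S = X ->
  S *m (X *m Q + Q *m X) *m S = X *m (S *m Q *m S) + S *m Q *m S *m X.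
Proof.
case/block_absorb=> SX XS.
rewrite mulmxDr mulmxDl !mulmxA SX -[S *m Q *m X *m S]mulmxA XS.
by rewrite -[S *m Q *m S *m X]mulmxA SX.
Qed.

(** Three indices are too few for a Plucker relation. *)
Lemma block_linear : (n <= i + 3)%N ->
  forall X, skew X -> in_support i j X -> schubert_cone i j X.
Proof.
move=> ni X skX zX; split=> //; have [->|X0] := eqVneq X 0.
  by exists 0, 0; rewrite /wedge mulmx0 subrr.
have [a [b Xab]] := mx_neq0_entry X0.
exists (- (X a b)^-1 *: row b X), (row a X); apply/matrixP => r s.
have SXS : S *m X *m S = X by apply/(block_support ji).
have Xout (x y : 'I_n) : ~~ ((i <= x)%N && (i <= y)%N) -> X x y = 0.
  by move=> h; rewrite -SXS block_projE (negbTE h).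
have Xba : X b a != 0 by rewrite (skewE skX) oppr_eq0.
have ai : (i <= a)%N by apply: contraNT Xab => h; rewrite Xout // (negbTE h).
have bi : (i <= b)%N by apply: contraNT Xba => h; rewrite Xout // (negbTE h).
have nab : a <> b by move=> e; move: Xab; rewrite e skew_diag // eqxx.
rewrite wedgeE !mxE.
have [ri|ri] := leqP i r; last by rewrite !(Xout _ r) ?(Xout r) ?andbF -?ltnNge //; try ring; lia.
have [si|si] := leqP i s; last by rewrite !(Xout _ s) ?andbF -?ltnNge //; try ring; lia.
have : [\/ r = s, r = a, r = b | s = a] \/ s = b.
  have := ltn_ord a; have := ltn_ord b; have := ltn_ord r; have := ltn_ord s.
  case: (eqVneq r s) => [->|rs]; first by left; constructor 1.
  case: (eqVneq r a) => [->|ra]; first by left; constructor 2.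
  case: (eqVneq r b) => [->|rb]; first by left; constructor 3.
  case: (eqVneq s a) => [->|sa]; first by left; constructor 4.
  case: (eqVneq s b) => [->|sb]; first by right.
  move: rs ra rb sa sb nab; rewrite -!val_eqE /= => rs ra rb sa sb nab.
  have : a <> b :> nat by move=> /val_inj.
  by lia.
case=> [[] ->|->]; rewrite !(skew_diag skX).
- by ring.
- by rewrite [X b a](skewE skX); field.
- by field.
- by rewrite [X b a](skewE skX) [X r a](skewE skX); field.
- by rewrite [X r b](skewE skX); field.
Qed.

Variable Y : 'M[F]_n.
Hypotheses (gY : gr2 Y) (Y0 : \tr (Y *m Y) != 0).
Local Notation Q := (S *m proj_of Y *m S).

Lemma block_eigen k : ~~ zeroed i j (prow k) (pcol k) ->
  plucker (zero_out i j Y *m proj_of Y + proj_of Y *m zero_out i j Y) k =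
  \tr Q * plucker (zero_out i j Y) k.
Proof.
move=> nzk; have skY := gY.1; rewrite (zero_out_block ji) //.
have idS := block_proj_idem F i; have symS := block_proj_sym F i.
rewrite -(block_coord_compress (_ + _)) // block_compress_commutant; last first.
  by rewrite !mulmxA idS -mulmxA idS.
by rewrite addrC (compress_eigen gY Y0 symS idS) /plucker mxE.
Qed.

Lemma block_linear_uniq X : skew X -> in_support i j X ->
  \tr (Y *m Y *m S) != 0 -> \tr (zero_out i j Y *m zero_out i j Y) != 0 ->
  (forall k, ~~ zeroed i j (prow k) (pcol k) ->
     plucker (X *m proj_of Y + proj_of Y *m X) k = \tr Q * plucker X k) ->
  exists c, X = c *: zero_out i j Y.
Proof.
move=> skX zX t0 tau0 eigX; have skY := gY.1.
have idS := block_proj_idem F i; have symS := block_proj_sym F i.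
rewrite (zero_out_block ji) // in tau0 *.
have SXS : S *m X *m S = X by apply/(block_support ji).
have symQ : Q^T = Q by apply: compress_sym => //; apply: proj_of_sym.
have trQ : \tr Q != 0.
  rewrite compress_projE mxtraceZ compress_trE // !mulf_neq0 ?invr_eq0 ?pnatr_eq0 //.
exists (\tr (X *m (S *m Y *m S)) / \tr (S *m Y *m S *m (S *m Y *m S))).
apply: (compress_eigen_uniq gY Y0 symS idS skX trQ tau0).
apply: alternating_ext => [||k].
- by apply: alternating_skew; rewrite addrC; apply: commutant_skew.
- by apply: alternating_skew; apply/matrixP => r s; rewrite !mxE (skewE skX); ring.
rewrite addrC -block_compress_commutant // [RHS]mxE.
have [zk|nzk] := boolP (zeroed i j (prow k) (pcol k)).
  rewrite block_projE zX // mulr0; move: zk; rewrite zeroed_block //; first by move/negbTE => ->.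
  by rewrite neq_ltn prow_lt_pcol.
by rewrite -[LHS]/(plucker _ k) block_coord_compress // eigX.
Qed.

End BlockCase.

(** ** The case of the planes through the last basis vector *)

Section PointCase.
Variables (F : numFieldType) (n : nat) (i j : 'I_n).
Hypotheses (i0 : i = 0%N :> nat) (jn : j = n.-1 :> nat).
Implicit Types (X Y : 'M[F]_n).

Lemma point_zeroed r s : zeroed i j r s = (r != j) && (s != j).
Proof.
have := ltn_ord r; have := ltn_ord s.
by rewrite -!val_eqE /= /zeroed i0 ltn0 /= jn; lia.
Qed.

Lemma point_cone X : skew X -> in_support i j X -> schubert_cone i j X.
Proof.
move=> skX zX; split=> //; exists (row j X), (- delta_mx 0 j); apply/matrixP => r s.
rewrite wedgeE !mxE /=; have [->|rj] := eqVneq r j; have [->|sj] := eqVneq s j.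
- by rewrite !(skew_diag skX); ring.
- by rewrite (skew_diag skX) /=; ring.
- by rewrite (skew_diag skX) (skewE skX) /=; ring.
- by rewrite zX ?point_zeroed ?rj ?sj //=; ring.
Qed.

Lemma point_coord k : ~~ zeroed i j (prow k) (pcol k) -> pcol k = j.
Proof.
have := prow_lt_pcol k; have := ltn_ord (pcol k).
rewrite point_zeroed negb_and !negbK -!val_eqE /= => h1 h2 /orP[] /eqP h; apply/val_inj => /=; lia.
Qed.

Variable Y : 'M[F]_n.
Hypotheses (gY : gr2 Y) (Y0 : \tr (Y *m Y) != 0).
Local Notation Q := (proj_of Y).

Lemma point_commutant X r : skew X -> in_support i j X -> r != j ->
  (X *m Q + Q *m X) r j = X r j * Q j j + (Q *m X) r j.
Proof.
move=> skX zX rj; rewrite [LHS]mxE; congr (_ + _).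
rewrite mxE (bigD1 j) //= big1 ?addr0 // => s sj.
by rewrite zX ?mul0r // point_zeroed rj.
Qed.

Lemma point_eigen k : ~~ zeroed i j (prow k) (pcol k) ->
  plucker (zero_out i j Y *m Q + Q *m zero_out i j Y) k =
  (1 + Q j j) * plucker (zero_out i j Y) k.
Proof.
move=> nzk; have kj := point_coord nzk; have skY := gY.1.
have rj : prow k != j by rewrite -kj neq_ltn prow_lt_pcol.
rewrite /plucker kj point_commutant //; last exact: zero_out_support; last exact: zero_out_skew.
have -> : (Q *m zero_out i j Y) (prow k) j = Y (prow k) j.
  rewrite -[in RHS](proj_of_mull gY Y0) !mxE; apply: eq_bigr => s _; rewrite zero_outE point_zeroed.
  by rewrite eqxx andbF.
by rewrite zero_outE point_zeroed eqxx andbF; ring.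
Qed.

(** For [X = v /\ e_j] the eigenvector equation says that [Q v] and [v] agree
    outside the coordinate [j]; as [Q] is idempotent and does not kill [e_j],
    they are equal, so [v] is in the plane of [Y] and in [e_j = 0]. *)
Lemma point_linear_uniq X : skew X -> in_support i j X -> Y i j != 0 ->
  (forall k, ~~ zeroed i j (prow k) (pcol k) ->
     plucker (X *m Q + Q *m X) k = (1 + Q j j) * plucker X k) ->
  exists c, X = c *: zero_out i j Y.
Proof.
move=> skX zX Yij eigX; have skY := gY.1.
pose v := col j X.
have Qv r : r != j -> (Q *m v) r 0 = v r 0.
  move=> rj; have rltj : (r < j)%N.
    have := ltn_ord r; move: rj; rewrite -val_eqE /= jn; lia.
  have [k kr kj] := coord_of rltj.
  have := eigX k; rewrite /plucker kr kj point_commutant // point_zeroed eqxx andbF.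
  move=> /(_ isT); rewrite mulrDl mul1r addrC [Q j j * _]mulrC => /addIr.
  move=> QX; rewrite [RHS]mxE -QX [LHS]mxE [RHS]mxE; apply: eq_bigr => s _.
  by congr (_ * _); rewrite mxE.
have [c cE] : exists c, c = (Q *m v) j 0 by exists ((Q *m v) j 0).
have vj : v j 0 = 0 by rewrite mxE skew_diag.
have QvE : Q *m v = v + c *: delta_mx j 0.
  apply/colP => r; have -> : (v + c *: delta_mx j 0) r 0 = v r 0 + c * (r == j)%:R.
    by rewrite !mxE eqxx andbT.
  have [->|rj] := eqVneq r j; first by rewrite vj add0r mulr1 cE.
  by rewrite mulr0 addr0 Qv.
have c0 : c = 0.
  have YE : Y i j = \sum_s Y i s * Q s j by rewrite -[in LHS](proj_of_mulr gY Y0) mxE.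
  apply: contraNeq Yij => c0; rewrite YE.
  have : Q *m (Q *m v) = Q *m v by rewrite mulmxA proj_of_idem.
  rewrite {1}QvE mulmxDr -scalemxAr => /eqP; rewrite -subr_eq0 addrAC subrr add0r scaler_eq0.
  rewrite (negbTE c0) -colE /= => /eqP/colP Qj.
  rewrite big1 // => s _; have := Qj s; rewrite [LHS]mxE [RHS]mxE => ->; by rewrite mulr0.
have {}QvE : v = Y *m ((2 / \tr (Y *m Y)) *: (Y *m v)).
  by rewrite -scalemxAr mulmxA scalemxAl -[LHS]addr0 -(scale0r (delta_mx j 0)) -c0 -QvE.
have vY a : v a 0 * Y i j = v i 0 * Y a j.
  have plucker3 s : Y a i * Y j s + Y i j * Y a s + Y j a * Y i s = 0.
    by rewrite (gr2_plucker a i j s gY) [Y j a](skewE skY); ring.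
  pose z := (2 / \tr (Y *m Y)) *: (Y *m v).
  have vz x : v x 0 = \sum_s Y x s * z s 0 by rewrite {1}QvE mxE.
  have : Y a i * v j 0 + Y i j * v a 0 + Y j a * v i 0 = 0.
    rewrite !vz !mulr_sumr -!big_split big1 // => s _ /=.
    by rewrite !mulrA -!mulrDl plucker3 mul0r.
  by rewrite vj mulr0 add0r [Y j a](skewE skY) mulNr => /eqP; rewrite subr_eq0 => /eqP; rewrite ![_ * v _ _]mulrC.
have XrE r : X r j = v i 0 / Y i j * Y r j.
  by have := vY r; rewrite mxE => E; rewrite mulrAC -E mulfK.
exists (v i 0 / Y i j); apply/matrixP => r s; rewrite [RHS]mxE zero_outE point_zeroed.
have [->|sj] := eqVneq s j; first by rewrite andbF XrE.
have [->|rj] := eqVneq r j; last by rewrite /= mulr0 zX // point_zeroed rj.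
by rewrite (skewE skX) XrE (skewE skY j) mulrN.
Qed.

End PointCase.

(** * The GD degree *)

(** The relation [tr (X^2) Y' = tr (X Y) X] is void where both traces vanish.
    Eliminating the traces between two of its entries leaves the linear forms
    [x_rs y'_ij - x_ij y'_rs] in the saturated ideal. *)
Lemma block_nonlinear_uniq (F : numFieldType) n (i j : 'I_n) G (Y X : 'M[F]_n) :
  j = i.+1 :> nat -> ideal_gen G = vanishing_ideal (@schubert F n i j) ->
  gr2 Y -> \tr (Y *m Y) != 0 -> Y i j != 0 ->
  ~ transverse_to_quadric (@schubert F n i j) G (codim_schubert i j) ->
  zero_locus (GD_critical_ideal (@schubert F n i j) G (codim_schubert i j) Y) X ->
  exists c, X = c *: zero_out i j Y.
Proof.
move=> ji genG gY Y0 Yij ntr [skX X0 KX].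
have ij : (i < j)%N by rewrite ji.
have skY := gY.1; set Y' := zero_out i j Y.
have Y'ij : Y' i j = Y i j by apply: zero_out_corner.
set M := @schubert F n i j in genG ntr KX.
pose L := lagrangian_ideal M G (codim_schubert i j) (proj_of Y).
pose g := trXY Y; pose tau := @trX2 F n.
have iL : is_ideal L by apply: lagrangian_is_ideal.
have [K0 KD KM] := localized_ideal g tau iL.
have rel r s : localized L g tau (tau * (Y' r s)%:MP - g * @generic_skew F n r s).
  have := critical_relation ji genG gY Y0 r s; rewrite -(zero_out_block ji) // -/Y'.
  by rewrite [fun_of_matrix (_ - _) _ _]mxE [fun_of_matrix (- _) _ _]mxE ![fun_of_matrix (_ *: _) _ _]mxE [fun_of_matrix (cst_mx _) _ _]mxE.
have lin r s : X r s * Y' i j = X i j * Y' r s.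
  pose f := @generic_skew F n r s * (Y' i j)%:MP - @generic_skew F n i j * (Y' r s)%:MP.
  have : f.@[plucker X] = 0.
    apply: KX; have [a [b Lf]] : localized L g tau f.
      suff: localized L g tau (f * (g ^+ 1 * tau ^+ 0)) by apply: localized_cancel.
      rewrite expr1 expr0 mulr1.
      rewrite (_ : f * g = (Y' r s)%:MP * (tau * (Y' i j)%:MP - g * @generic_skew F n i j) +
        (- (Y' i j)%:MP) * (tau * (Y' r s)%:MP - g * @generic_skew F n r s)); last by rewrite /f; ring.
      by apply: KD; apply/KM/rel.
    exact: (in_critical_ideal_nontransverse ntr Lf).
  by rewrite mevalB !mevalM !mevalC !ev_entry // => /eqP; rewrite subr_eq0 => /eqP.
exists (X i j / Y i j); apply/matrixP => r s; rewrite [RHS]mxE -/Y' mulrAC -lin Y'ij.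
by rewrite mulfK.
Qed.

Theorem schubert_GD_degree (F : numClosedFieldType) n (i j : 'I_n) :
  (3 <= n)%N ->
  (j = i.+1 :> nat) \/ (i = 0%N :> nat /\ j = n.-1 :> nat) ->
  GD_degree (@schubert F n i j) 1.
Proof.
move=> n3 hij; have ij : (i < j)%N by case: hij => [->//|[-> ->]]; lia.
exists (codim_schubert i j); first exact: codim_schubertP.
move=> G genG; apply: (generic_conditionP ij) => Y gY Y0 tau0 t0 Yij.
have skY := gY.1; set Y' := zero_out i j Y in tau0 *.
have skY' : skew Y' by apply: zero_out_skew.
have zY' : in_support i j Y' by apply: zero_out_support.
have Y'ij : Y' i j != 0 by rewrite /Y' zero_out_corner.
suff [MY' [la eig] uniq] : [/\ schubert i j Y',
    exists la, forall k, ~~ zeroed i j (prow k) (pcol k) ->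
      plucker (Y' *m proj_of Y + proj_of Y *m Y') k = la * plucker Y' k &
    forall X, zero_locus (GD_critical_ideal (@schubert F n i j) G (codim_schubert i j) Y) X ->
      exists c, X = c *: Y'].
  exists (fun=> Y'); split=> [_|a b _|X VX].
  - by apply: (critical_zero ij genG MY' Y'ij eig) => //; rewrite -(zero_out_trace skY' zY' skY).
  - by rewrite !ord1.
  - exists 0; have [_ X0 _] := VX; apply: scaled_prop_to => //; exact: uniq.
have linear_uniq la :
    (forall X : 'M[F]_n, skew X -> in_support i j X -> schubert_cone i j X) ->
    (forall k, ~~ zeroed i j (prow k) (pcol k) ->
      plucker (Y' *m proj_of Y + proj_of Y *m Y') k = la * plucker Y' k) ->
    (forall X : 'M[F]_n, skew X -> in_support i j X ->
      (forall k, ~~ zeroed i j (prow k) (pcol k) ->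
        plucker (X *m proj_of Y + proj_of Y *m X) k = la * plucker X k) ->
      exists c, X = c *: Y') ->
    forall X, zero_locus (GD_critical_ideal (@schubert F n i j) G (codim_schubert i j) Y) X ->
      exists c, X = c *: Y'.
  move=> lin eig uniq X VX; have [skX _ _] := VX.
  apply: uniq => //; first exact: critical_zero_support VX.
  have nzY' k : ~~ zeroed i j (prow k) (pcol k) -> plucker Y' k = plucker Y k by apply: zero_out_coord.
  exact: (linear_critical_equations genG lin skY skY' zY' nzY' eig VX).
case: hij => [ji|[i0 jn]].
  have eig := block_eigen ji gY Y0.
  split; [exact: block_zero_out_schubert | by eexists; exact: eig |].
  (* From four indices on, [tr (X^2)] may be inverted because there are totally
     isotropic planes; below, the variety is a projective space. *)
  have [n4|n3'] := leqP (i + 4) n; last first.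
    apply: (linear_uniq _ _ eig); first by apply: (block_linear ji); rewrite -ltnS -addnS.
    by move=> X skX zX; apply: block_linear_uniq.
  move=> X; apply: block_nonlinear_uniq => //; exact: not_transverse.
have eig := point_eigen i0 jn gY Y0.
have lin := @point_cone F n i j i0 jn.
split; [|by eexists; exact: eig |].
  apply/schubertP; split; last exact: lin.
  by apply: contraNneq Y'ij => ->; rewrite mxE.
apply: (linear_uniq _ lin eig) => X skX zX eigX.
exact: (point_linear_uniq i0 jn gY Y0 skX zX Yij eigX).
Qed.

(** * The closest point over the reals *)

Section RealProjections.
Variables (R : rcfType) (n : nat).
Implicit Types (A B P Q N : 'M[R]_n) (X Y : 'M[R]_n).

Definition sq_norm A : R := \sum_r \sum_s A r s ^+ 2.

Lemma sq_norm_ge0 A : 0 <= sq_norm A.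
Proof. by apply: sumr_ge0 => r _; apply: sumr_ge0 => s _; apply: sqr_ge0. Qed.

Lemma frobenius_sq A : frobenius A ^+ 2 = sq_norm A.
Proof. by rewrite sqr_sqrtr // sq_norm_ge0. Qed.

Lemma sq_norm_eq0 A : (sq_norm A == 0) = (A == 0).
Proof.
apply/eqP/eqP => [A0|->]; last first.
  by rewrite /sq_norm big1 // => r _; rewrite big1 // => s _; rewrite mxE expr0n.
apply/matrixP => r s; rewrite mxE; apply/eqP; rewrite -sqrf_eq0; apply/eqP.
have row0 : \sum_s A r s ^+ 2 = 0.
  by apply: (psumr_eq0P _ A0) => // t _; apply: sumr_ge0 => u _; apply: sqr_ge0.
by apply: (psumr_eq0P _ row0) => // t _; apply: sqr_ge0.
Qed.

Lemma sq_normE A : sq_norm A = \tr (A *m A^T).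
Proof. by apply: eq_bigr => r _; rewrite mxE; apply: eq_bigr => s _; rewrite mxE expr2. Qed.

Lemma real_trace_neq0 X : skew X -> X != 0 -> \tr (X *m X) != 0.
Proof.
move=> skX X0; have -> : X *m X = - (X *m X^T) by rewrite skX mulmxN opprK.
by rewrite raddfN /= -sq_normE oppr_eq0 sq_norm_eq0.
Qed.

Definition orth_proj P := P^T = P /\ P *m P = P.

Lemma orth_proj_of X : gr2 X -> orth_proj (proj_of X) /\ \tr (proj_of X) = 2.
Proof.
move=> gX; have skX := gX.1; have X0 := real_trace_neq0 skX (gr2_neq0 gX).
split; first by split; [apply: proj_of_sym | apply: proj_of_idem].
by rewrite /proj_of mxtraceZ divfK.
Qed.

(** [tr (P Q) = tr ((P Q) (P Q)^T)] because both factors are symmetric and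
    idempotent. *)
Lemma trace_orth_proj P Q : orth_proj P -> orth_proj Q -> \tr (P *m Q) = sq_norm (P *m Q).
Proof.
move=> [symP idP] [symQ idQ]; rewrite sq_normE trmx_mul symP symQ.
by rewrite mulmxA -[P *m Q *m Q]mulmxA idQ [RHS]mxtrace_mulC mulmxA idP.
Qed.

Lemma orth_proj_dist P Q : orth_proj P -> orth_proj Q -> \tr P = 2 -> \tr Q = 2 ->
  frobenius (P - Q) ^+ 2 = 4 - 2 * \tr (P *m Q).
Proof.
move=> [symP idP] [symQ idQ] trP trQ.
rewrite frobenius_sq sq_normE linearB /= symP symQ mulmxBr !mulmxBl !raddfB /= idP idQ.
by rewrite [\tr (Q *m P)]mxtrace_mulC trP trQ; ring.
Qed.

Lemma closest_leif P P' Q N :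
  orth_proj P -> orth_proj P' -> orth_proj Q -> \tr P = 2 -> \tr P' = 2 -> \tr Q = 2 ->
  \tr (P *m Q) + sq_norm N = \tr (P' *m Q) ->
  frobenius (P' - Q) ^+ 2 <= frobenius (P - Q) ^+ 2 ?= iff (N == 0).
Proof.
move=> oP oP' oQ tP tP' tQ trE; rewrite !orth_proj_dist // -trE -sq_norm_eq0.
have N0 := sq_norm_ge0 N; split; first by rewrite lerD2l lerN2 ler_pM2l ?ltr0n // lerDl.
rewrite (inj_eq (addrI _)) eqr_opp (inj_eq (mulfI _)) ?pnatr_eq0 //.
by rewrite -subr_eq0 addrAC subrr add0r.
Qed.

Lemma prop_to_proj X Y : prop_to X Y -> proj_of X = proj_of Y.
Proof.
move=> [a a0 ->]; rewrite /proj_of -scalemxAl -scalemxAr !scalerA mxtraceZ; congr (_ *: _).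
by rewrite -[LHS]mulrA invfM [(a * a)^-1 * _]mulrC [2 * (_ * _)]mulrA divfK ?mulf_neq0.
Qed.

End RealProjections.

Section ClosestPoint.
Variables (R : rcfType) (n : nat) (i j : 'I_n).
Implicit Types (X Y : 'M[R]_n).

Definition zero_out_minimizes Y : Prop :=
  schubert i j (zero_out i j Y) /\
  forall X, schubert i j X ->
    frobenius (proj_of (zero_out i j Y) - proj_of Y) ^+ 2
      <= frobenius (proj_of X - proj_of Y) ^+ 2
      ?= iff `[< prop_to X (zero_out i j Y) >].

(** Maximizing [tr (P Q)] by completing it with a squared norm [N X] to a
    quantity that does not depend on [X]. *)
Lemma minimizes_of_defect Y (N : 'M[R]_n -> 'M[R]_n) :
  gr2 Y -> schubert i j (zero_out i j Y) ->
  (forall X, schubert i j X ->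
     \tr (proj_of X *m proj_of Y) + sq_norm (N X) = \tr (proj_of (zero_out i j Y) *m proj_of Y)) ->
  (forall X, schubert i j X -> N X = 0 -> exists c, X = c *: zero_out i j Y) ->
  zero_out_minimizes Y.
Proof.
move=> gY MY' trN N0; split=> // X MX.
have [oX tX] := orth_proj_of MX.1; have [oY tY] := orth_proj_of gY.
have [oY' tY'] := orth_proj_of MY'.1.
have leif := closest_leif oX oY' oY tX tY' tY (trN X MX).
suff -> : `[< prop_to X (zero_out i j Y) >] = (N X == 0) by [].
apply/asboolP/eqP => [XY'|/(N0 X MX)]; last first.
  by apply: scaled_prop_to; exact: gr2_neq0 MX.1.
have := trN X MX; rewrite (prop_to_proj XY') -[RHS]addr0 => /addrI/eqP.
by rewrite sq_norm_eq0 => /eqP.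
Qed.

(** The projection [P] of a plane inside the coordinate subspace satisfies
    [P <= S], so that [tr (S Q) - tr (P Q)] is the squared norm of [(S - P) Q].
    It vanishes when [P Y = S Y], that is, when the plane of [X] is the
    projection of the plane of [Y]. *)
Lemma block_minimizes Y : j = i.+1 :> nat -> gr2 Y -> Y i j != 0 -> zero_out_minimizes Y.
Proof.
move=> ji gY Yij; have skY := gY.1.
have MY' := block_zero_out_schubert ji gY Yij.
pose S := block_proj R i; have idS := block_proj_idem R i; have symS := block_proj_sym R i.
have Y'E : zero_out i j Y = S *m Y *m S by apply: zero_out_block.
have gY' := MY'.1; have skY' := gY'.1.
have Y0 := real_trace_neq0 skY (gr2_neq0 gY).
have Y'0 := real_trace_neq0 skY' (gr2_neq0 gY').
have projS X : schubert i j X -> S *m proj_of X = proj_of X /\ proj_of X *m S = proj_of X.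
  move=> MX; have [SX XS] := schubert_absorb ji MX.
  by rewrite /proj_of -scalemxAr -scalemxAl mulmxA SX -mulmxA XS.
have oSP X : schubert i j X -> orth_proj (S - proj_of X).
  move=> MX; have [[symP idP] _] := orth_proj_of MX.1; have [SP PS] := projS X MX.
  split; first by rewrite linearB /= symS symP.
  by rewrite mulmxBr !mulmxBl idS SP PS idP subrr subr0.
have [oY _] := orth_proj_of gY.
apply: (minimizes_of_defect (N := fun X => (S - proj_of X) *m proj_of Y)) => // X MX.
  rewrite -trace_orth_proj //; last exact: oSP.
  rewrite mulmxBl raddfB /= addrC subrK.
  suff -> : S *m proj_of Y = proj_of (zero_out i j Y) *m proj_of Y by [].
  suff P'Y : S *m Y = proj_of (zero_out i j Y) *m Y.
    rewrite {2}/proj_of {2}/proj_of -[in LHS]scalemxAr -[in RHS]scalemxAr.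
    by rewrite !mulmxA P'Y.
  have trE : \tr (Y *m (S *m Y *m S)) = \tr (S *m Y *m S *m (S *m Y *m S)).
    have SSYSS : S *m (S *m Y *m S) *m S = S *m Y *m S.
      by rewrite !mulmxA idS -mulmxA idS.
    by rewrite (compress_tr Y S (S *m Y *m S)) SSYSS mxtrace_mulC.
  have skSYS : skew (S *m Y *m S) by rewrite -Y'E.
  have SYE : S *m Y *m S *m (S *m Y *m S) *m Y = S *m (Y *m (S *m Y *m S) *m Y).
    by rewrite !mulmxA -[S *m Y *m S *m S]mulmxA idS.
  rewrite Y'E /proj_of -scalemxAl SYE (gr2_sandwich gY skSYS) trE -scalemxAr scalerA.
  rewrite [X in _ = X *: _](_ : _ = 1) ?scale1r //.
  by have tau0 := Y'0; rewrite Y'E in tau0; field.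
move=> N0; have [SP PS] := projS X MX; set P := proj_of X in N0 SP PS *.
have symP : P^T = P := proj_of_sym (schubert_skew MX).
have PY : P *m Y = S *m Y.
  have := congr1 (mulmx^~ Y) N0; rewrite mul0mx -mulmxA proj_of_mull // mulmxBl.
  by move/eqP; rewrite subr_eq0 => /eqP.
set Y' := zero_out i j Y in MY' Y'E gY' skY' Y'0 *.
have PY' : P *m Y' = Y' by rewrite Y'E !mulmxA PS PY.
have Y'P : Y' *m P = Y'.
  have := congr1 trmx PY'; rewrite trmx_mul symP skY' mulNmx.
  exact: oppr_inj.
have [gX _] := MX.
have [c] : exists c, P *m Y' *m P = c *: X.
  rewrite /P /proj_of -!scalemxAl -!scalemxAr scalerA.
  have -> : X *m X *m Y' *m (X *m X) = X *m (X *m Y' *m X) *m X by rewrite !mulmxA.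
  rewrite (gr2_sandwich gX skY') -scalemxAr -scalemxAl gr2_cube // !scalerA.
  by eexists.
rewrite PY' Y'P => Y'c; have c0 : c != 0.
  by apply: contraNneq (gr2_neq0 gY') => c0; rewrite Y'c c0 scale0r.
by exists c^-1; rewrite Y'c scalerA mulVf // scale1r.
Qed.

(** A plane through [e_j] has [P = E + L], with [E] and [L] the projections to
    the lines of [e_j] and of some [v] orthogonal to it. Here
    [tr (P Q) = tr (E Q) + 1 - tr (L (1 - Q))] is largest when [v] is in the
    plane of [Y], whose vectors orthogonal to [e_j] are the multiples of
    [Y e_j]. *)
Lemma point_minimizes Y : i = 0%N :> nat -> j = n.-1 :> nat -> (3 <= n)%N ->
  gr2 Y -> Y i j != 0 -> zero_out_minimizes Y.
Proof.
move=> i0 jn n3 gY Yij; have skY := gY.1; have ij : (i < j)%N by rewrite i0 jn; lia.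
have skY' : skew (zero_out i j Y) by apply: zero_out_skew.
have MY' : schubert i j (zero_out i j Y).
  apply/schubertP; split; first by apply: contraNneq Yij => Y'0; rewrite -(zero_out_corner ij) Y'0 mxE.
  by apply: (point_cone i0 jn) => //; apply: zero_out_support.
have Y0 := real_trace_neq0 skY (gr2_neq0 gY).
have [oY tY] := orth_proj_of gY; have [symQ idQ] := oY.
pose E : 'M[R]_n := delta_mx j j.
have symE : E^T = E by rewrite trmx_delta.
have idE : E *m E = E by rewrite mul_delta_mx.
have mulE Z r s : (Z *m E) r s = Z r j * (s == j)%:R.
  rewrite mxE (bigD1 j) //= big1 ?addr0 => [|t tj]; rewrite mxE ?eqxx //.
  by rewrite (negbTE tj) mulr0.
have Emul Z r s : (E *m Z) r s = (r == j)%:R * Z j s.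
  rewrite mxE (bigD1 j) //= big1 ?addr0 => [|t tj]; rewrite mxE ?eqxx ?andbT //.
  by rewrite (negbTE tj) andbF mul0r.
have trE Z : \tr (E *m Z) = Z j j.
  rewrite /mxtrace (bigD1 j) //= big1 ?addr0 => [|t tj]; rewrite Emul ?eqxx ?mul1r //.
  by rewrite (negbTE tj) mul0r.
have sandE Z : E *m Z *m E = Z j j *: E.
  by apply/matrixP => r s; rewrite mulE Emul !mxE; case: (r == j); case: (s == j); rewrite /=; ring.
have splitE X : skew X -> in_support i j X -> X = X *m E + E *m X.
  move=> skX zX; apply/matrixP => r s; rewrite [RHS]mxE mulE Emul.
  have [->|rj] := eqVneq r j; have [->|sj] := eqVneq s j; rewrite ?(skew_diag skX) /=; try ring.
  by rewrite zX ?point_zeroed ?rj ?sj //; ring.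
(* The splitting [P = L + E]. *)
have projE X : skew X -> in_support i j X -> X != 0 ->
    proj_of X = (2 / \tr (X *m X)) *: (X *m E *m X) + E.
  move=> skX zX X0; have EXE : E *m X *m E = 0 by rewrite sandE skew_diag // scale0r.
  have EXX : E *m X *m X = (X *m X) j j *: E.
    have := congr1 (mulmx (E *m X)) (splitE X skX zX).
    rewrite mulmxDr !mulmxA EXE mul0mx addr0 => ->.
    by rewrite -[E *m X *m X]mulmxA sandE.
  have XX : X *m X = X *m E *m X + (X *m X) j j *: E.
    by have := congr1 (mulmx^~ X) (splitE X skX zX); rewrite mulmxDl EXX.
  have trXEX : \tr (X *m E *m X) = (X *m X) j j by rewrite mxtrace_mulC mulmxA mxtrace_mulC trE.
  have trXX : \tr (X *m X) = 2 * (X *m X) j j.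
    rewrite {1}XX mxtraceD mxtraceZ trXEX; have -> : \tr E = 1 by rewrite -[E]mulmx1 trE mxE eqxx.
    by ring.
  have := real_trace_neq0 skX X0; rewrite /proj_of {3}XX scalerDr scalerA trXX => t0.
  by congr (_ + _); rewrite [X in X *: E](_ : _ = 1) ?scale1r //; field; move: t0; rewrite mulf_eq0 negb_or => /andP[].
pose N X := (proj_of X - E) *m (1%:M - proj_of Y).
have oN X : schubert i j X -> orth_proj (proj_of X - E).
  move=> MX; have [[symP idP] _] := orth_proj_of MX.1; have skX := schubert_skew MX.
  have zX : in_support i j X by move=> r s; apply: schubert_zeroed MX.
  have PE : proj_of X *m E = E.
    rewrite projE // ?gr2_neq0 //; last by case: MX.
    by rewrite mulmxDl idE -scalemxAl -!mulmxA [E *m (X *m E)]mulmxA sandE skew_diag // scale0r mulmx0 scaler0 add0r.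
  have EP : E *m proj_of X = E by rewrite -[LHS]trmxK trmx_mul symE symP PE.
  split; first by rewrite linearB /= symP symE.
  by rewrite mulmxBr !mulmxBl idP EP PE idE subrr subr0.
have oQ : orth_proj (1%:M - proj_of Y).
  split; first by rewrite linearB /= trmx1 symQ.
  by rewrite mulmxBr !mulmxBl !mul1mx mulmx1 idQ subrr subr0.
have Ntr X : schubert i j X -> \tr (proj_of X *m proj_of Y) + sq_norm (N X) = 1 + proj_of Y j j.
  move=> MX; rewrite -(trace_orth_proj (oN X MX) oQ).
  have [_ tX] := orth_proj_of MX.1.
  rewrite mulmxBr mulmx1 mulmxBl !raddfB /= trE tX.
  have -> : \tr E = 1 by rewrite -[E]mulmx1 trE mxE eqxx.
  by ring.
have NY' : N (zero_out i j Y) = 0.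
  set Y' := zero_out i j Y in skY' *.
  have Y'r r : Y' r j = Y r j by rewrite zero_outE point_zeroed ?eqxx ?andbF.
  have Y'E : Y' *m E = Y *m E by apply/matrixP => r s; rewrite !mulE Y'r.
  have EY' : E *m Y' = E *m Y.
    by apply/matrixP => r s; rewrite !Emul (skewE skY') Y'r -(skewE skY).
  have zY' : in_support i j Y' by apply: zero_out_support.
  have Y'0 : Y' != 0 by have [gY' _] := MY'; apply: gr2_neq0 gY'.
  have YEY : Y' *m E *m Y' = Y *m E *m Y by rewrite Y'E -[LHS]mulmxA EY' mulmxA.
  rewrite /N projE // addrK -scalemxAl YEY mulmxBr mulmx1 -[Y *m E *m Y *m _]mulmxA.
  by rewrite proj_of_mulr // subrr scaler0.
apply: (minimizes_of_defect (N := N)) => // X MX.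
  by rewrite Ntr // -(Ntr _ MY') NY' (_ : sq_norm 0 = 0) ?addr0 //; apply/eqP; rewrite sq_norm_eq0.
move=> NX; have skX := schubert_skew MX; have [gX _] := MX.
have zX : in_support i j X by move=> r s; apply: schubert_zeroed MX.
have [[symP _] _] := orth_proj_of gX.
have NT : (1%:M - proj_of Y) *m (proj_of X - E) = 0.
  have := congr1 trmx NX; rewrite /N trmx_mul trmx0 !linearB /= trmx1.
  by rewrite symP symE symQ.
have QXE : proj_of Y *m X *m E = X *m E.
  have PXE : (proj_of X - E) *m (X *m E) = X *m E.
    rewrite mulmxBl !mulmxA sandE skew_diag // scale0r subr0 proj_of_mull //.
    exact: real_trace_neq0 skX (gr2_neq0 gX).
  have := congr1 (mulmx^~ (X *m E)) NT; rewrite mul0mx -[_ *m (X *m E)]mulmxA PXE mulmxBl mul1mx mulmxA.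
  by move/eqP; rewrite subr_eq0 eq_sym => /eqP.
apply: (point_linear_uniq i0 jn gY Y0 skX zX Yij) => k nzk.
have kj := point_coord i0 jn nzk.
have rj : prow k != j by rewrite -kj neq_ltn prow_lt_pcol.
rewrite /plucker kj (point_commutant i0 jn) //.
have /matrixP/(_ (prow k) j) := QXE; rewrite !mulE eqxx !mulr1 => ->.
by ring.
Qed.

End ClosestPoint.

(** * GD degree one and zeroing out coordinates *)

Theorem theorem6p6 (R : realType) (n : nat) (hn : (3 <= n)%N) (i j : 'I_n)
    (hij : (j = i.+1 :> nat) \/ (i = 0%N :> nat /\ j = n.-1 :> nat)) :
  GD_degree (@schubert R[i]%C n i j) 1 /\
  generic_gr2 (fun Y : 'M[R]_n =>
    schubert i j (zero_out i j Y) /\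
    forall X : 'M[R]_n, schubert i j X ->
      frobenius (proj_of (zero_out i j Y) - proj_of Y) ^+ 2
        <= frobenius (proj_of X - proj_of Y) ^+ 2
        ?= iff `[< prop_to X (zero_out i j Y) >]).
Proof.
split; first exact: schubert_GD_degree.
have ij : (i < j)%N by case: hij => [->//|[-> ->]]; lia.
apply: (generic_conditionP ij) => Y gY _ _ _ Yij.
case: hij => [ji|[i0 jn]]; first exact: block_minimizes.
exact: point_minimizes.
Qed.
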